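(* Let $1<\alpha<2$, let $A$ generate an $\alpha$-times resolvent family $\{S_\alpha(t)\}_{t\ge0}$ on a Banach space $X$, and let $r>0$. Then the function $$u(t)=S_\alpha(t)x+\int_0^tS_\alpha(s)y\,ds+(P_\alpha*f)(t),\qquad t\in[0,r],$$ is a strong solution of $\mathbf D_t^\alpha u(t)=Au(t)+f(t)$, $t\in[0,r]$, $u(0)=x$, $u'(0)=y$, for every pair $x,y\in D(A)$ and every $f\in C([0,r];X)$ if and only if $S_\alpha(\cdot)$ is of bounded semivariation on $[0,r]$.
   Context: For $\beta>0$ let $g_\beta(t)=\frac{t^{\beta-1}}{\Gamma(\beta)}$ for $t>0$, and $(g_\beta*f)(t)=\int_0^tg_\beta(t-s)f(s)\,ds$. Let $A$ be a closed, densely defined linear operator on $X$. A family $\{S_\alpha(t)\}_{t\ge0}$ of bounded operators is an $\alpha$-times resolvent family generated by $A$ if: (i) it is strongly continuous on $[0,\infty)$ with $S_\alpha(0)=I$; (ii) $S_\alpha(t)D(A)\subset D(A)$ and $AS_\alpha(t)x=S_\alpha(t)Ax$ for $x\in D(A)$; (iii) $S_\alpha(t)x=x+(g_\alpha*S_\alpha)(t)Ax$ for $x\in D(A)$, $t\ge0$. Define $P_\alpha(t)x=\int_0^tg_{\alpha-1}(t-s)S_\alpha(s)x\,ds$ and $(P_\alpha*f)(t)=\int_0^tP_\alpha(t-s)f(s)\,ds$. The Caputo derivative is $\mathbf D_t^\alpha u(t)=\frac{d^2}{dt^2}\big(g_{2-\alpha}*(u-x-\cdot\,y)\big)(t)$.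 A strong solution of $\mathbf D_t^\alpha u=Au+f$ on $[0,r]$, $u(0)=x$, $u'(0)=y$, is $u\in C([0,r];D(A))\cap C^1([0,r];X)$ with $u(0)=x$, $u'(0)=y$, $g_{2-\alpha}*(u(\cdot)-x-\cdot\,y)\in C^2([0,r];X)$ and $\mathbf D_t^\alpha u(t)=Au(t)+f(t)$ for all $t\in[0,r]$. For $G:[a,b]\to B(X)$ and a subdivision $d: a=d_0<d_1<\dots<d_n=b$, let $SV_d[G]=\sup\{\|\sum_{i=1}^n[G(d_i)-G(d_{i-1})]x_i\|: x_i\in X,\ \|x_i\|\le1\}$ and $SV[G]=\sup_d SV_d[G]$ over all subdivisions; $G$ is of bounded semivariation on $[a,b]$ if $SV[G]<\infty$. *)

(* Defs.v *)
From Stdlib Require Import Reals.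
From Coquelicot Require Import Coquelicot.
Open Scope R_scope.

Definition Gamma (b : R) : R :=
  RInt_gen (fun t => Rpower t (b - 1) * exp (- t)) (at_right 0) (Rbar_locally p_infty).

Definition gk (b t : R) : R :=
  if Rlt_dec 0 t then Rpower t (b - 1) / Gamma b else 0.

Section Banach.
Context {X : CompleteNormedModule R_AbsRing}.

(* Integral over (a,b), allowing integrable endpoint singularities
   (improper Riemann integral); equal to 0 when b <= a. *)
Definition Iint (f : R -> X) (a b : R) : X :=
  if Rlt_dec a b then RInt_gen f (at_right a) (at_left b) else zero.

Definition cont_on (a b : R) (f : R -> X) : Prop :=
  forall t, a <= t <= b ->
    filterlim f (within (fun s => a <= s <= b) (locally t)) (locally (f t)).

Definition deriv_on (a b : R) (f f' : R -> X) : Prop :=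
  forall t, a <= t <= b ->
    filterlim (fun h => scal (/ h) (minus (f (t + h)) (f t)))
      (within (fun h => h <> 0 /\ a <= t + h <= b) (locally 0))
      (locally (f' t)).

(* A : D(A) -> X closed, densely defined, linear; A is given as a total map
   whose values outside D are irrelevant. *)
Record closed_dense_op (D : X -> Prop) (A : X -> X) : Prop := {
  op_dom_zero : D zero;
  op_dom_plus : forall x y, D x -> D y -> D (plus x y);
  op_dom_scal : forall (k : R) x, D x -> D (scal k x);
  op_plus : forall x y, D x -> D y -> A (plus x y) = plus (A x) (A y);
  op_scal : forall (k : R) x, D x -> A (scal k x) = scal k (A x);
  op_closed : forall (xn : nat -> X) (x y : X),
      (forall n, D (xn n)) ->
      filterlim xn eventually (locally x) ->
      filterlim (fun n => A (xn n)) eventually (locally y) ->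
      D x /\ A x = y;
  op_dense : forall x (eps : R), 0 < eps -> exists d, D d /\ norm (minus d x) < eps
}.

Definition resolvent_family (D : X -> Prop) (A : X -> X) (alpha : R)
    (S : R -> X -> X) : Prop :=
  (forall t, 0 <= t -> is_linear (S t)) /\
  (forall x t, 0 <= t ->
     filterlim (fun s => S s x) (within (fun s => 0 <= s) (locally t))
       (locally (S t x))) /\
  (forall x, S 0 x = x) /\
  (forall t x, 0 <= t -> D x -> D (S t x) /\ A (S t x) = S t (A x)) /\
  (forall t x, 0 <= t -> D x ->
     S t x = plus x (RInt (fun s => scal (gk alpha (t - s)) (S s (A x))) 0 t)).

Definition Pop (alpha : R) (S : R -> X -> X) (t : R) (z : X) : X :=
  Iint (fun s => scal (gk (alpha - 1) (t - s)) (S s z)) 0 t.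

Definition Pconv (alpha : R) (S : R -> X -> X) (f : R -> X) (t : R) : X :=
  RInt (fun s => Pop alpha S (t - s) (f s)) 0 t.

Definition caputo_pre (alpha : R) (u : R -> X) (x y : X) (t : R) : X :=
  Iint (fun s => scal (gk (2 - alpha) (t - s)) (minus (u s) (plus x (scal s y)))) 0 t.

Definition strong_solution (D : X -> Prop) (A : X -> X) (alpha r : R)
    (f : R -> X) (x y : X) (u : R -> X) : Prop :=
  (* u in C([0,r]; D(A)) (graph norm) *)
  (forall t, 0 <= t <= r -> D (u t)) /\
  cont_on 0 r u /\ cont_on 0 r (fun t => A (u t)) /\
  (exists u1, deriv_on 0 r u u1 /\ cont_on 0 r u1 /\ u1 0 = y) /\
  u 0 = x /\
  (* g_{2-alpha} * (u - x - . y) in C^2([0,r];X) and its second derivative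
     (the Caputo derivative) equals A u + f on [0,r] *)
  (exists v1 v2,
     deriv_on 0 r (caputo_pre alpha u x y) v1 /\
     deriv_on 0 r v1 v2 /\ cont_on 0 r v2 /\
     forall t, 0 <= t <= r -> v2 t = plus (A (u t)) (f t)).

Definition bounded_semivariation (a b : R) (G : R -> X -> X) : Prop :=
  exists M : R, forall (n : nat) (d : nat -> R) (xs : nat -> X),
    d O = a -> d n = b -> (forall i, (i < n)%nat -> d i < d (S i)) ->
    (forall i, norm (xs i) <= 1) ->
    norm (sum_n_m (fun i => minus (G (d i) (xs i)) (G (d (i - 1)%nat) (xs i))) 1 n)
      <= M.

End Banach.

(* Main.v *)
(** The operators [phi |-> int_0^t C (t-s)^(b-1) phi(s) ds] compose up to a
    constant by homogeneity, once continuous functions are approximated by step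
    functions; testing on the exponential, an approximate eigenfunction with
    eigenvalue 1 after normalisation by [Gamma], shows that the constant is 1.
    So no Beta integral is needed for the fractional calculus.

    With [Q = g_alpha * S] one has [A Q = S - I].  Hence [A] maps the Stieltjes
    sums of [Q] against [f], which converge to [w = P_alpha * f], to those of
    [S].  If [S] has bounded semivariation the latter converge uniformly to
    some [z = A w], and translation invariance gives
    [w = g_alpha * (f + A w)]; thus [u = x + t y + g_alpha * (A u + f)], and all
    the regularity follows from the semigroup law of the kernels.

    Conversely, if [w(r)] always lies in [D(A)], then [A w(r)] is the limit of
    [(S(h) w(r) - w(r)) / g_(alpha+1)(h)] as [h -> 0], so uniform boundedness on
    the space of continuous functions yields [|A w(r)| <= C |f|].  Applied to a
    continuous, piecewise linear approximation of the step function attached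
    to a subdivision, [A w(r)] is a sum of averages of [S] near the subdivision
    points, and letting the averaging length go to 0 bounds the semivariation. *)

Require Import Defs.
From Stdlib Require Import Reals.
From Coquelicot Require Import Coquelicot.
From Stdlib Require Import Lra Lia List Classical ClassicalEpsilon FunctionalExtensionality ssreflect.
Open Scope R_scope.
Open Scope general_if_scope.

(** * Normalisation of vector expressions *)

(** The obstacle is that [f] is merely continuous: [P_alpha(t) z] is not known to lie in [D(A)], so
    [A] cannot be moved under the integral defining [P_alpha * f]. The primitive [Q] of [P_alpha]
    does map all of [X] into [D(A)], which is why the convolution is read as a Stieltjes integral
    against [Q]. Two Stieltjes sums of [S] differ, on a common refinement, by increments of [S]
    applied to vectors no longer than the oscillation of [f]; semivariation controls exactly this.
    The same sums replace interchanges of integrals: a sum is a finite combination of translates of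
    one kernel, so a composition rule need only be known for that kernel. Orders 1 and 2 are
    normalised along with [alpha], [alpha - 1] and [2 - alpha], because the laws used are
    [1 + (alpha - 1) = alpha] and [(2 - alpha) + alpha = 1 + 1]. In the converse the difference
    quotients in [h] are explicit bounded operators, and [w(r)] in [D(A)] gives their pointwise
    boundedness; this takes the place of a closed graph argument. *)

Inductive vexp : Type :=
  VZ | VA (n : nat) | VP (a b : vexp) | VO (a : vexp) | VS (k : R) (a : vexp).

Fixpoint vcoef (e : vexp) (n : nat) : R :=
  match e with
  | VZ => 0
  | VA m => if Nat.eqb m n then 1 else 0
  | VP a b => vcoef a n + vcoef b n
  | VO a => - vcoef a n
  | VS k a => k * vcoef a n
  end.

(** Coefficients are compared only at positions occupied in [l], so an equality of vector
    expressions unfolds to one real equation per atom. *)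
Fixpoint veqc {T : Type} (c d : nat -> R) (l : list T) : Prop :=
  match l with
  | nil => True
  | _ :: l => c O = d O /\ veqc (fun n => c (S n)) (fun n => d (S n)) l
  end.

Section Vexp.
Context {X : ModuleSpace R_Ring}.

Fixpoint veval (l : list X) (e : vexp) : X :=
  match e with
  | VZ => zero
  | VA n => List.nth n l zero
  | VP a b => plus (veval l a) (veval l b)
  | VO a => opp (veval l a)
  | VS k a => scal k (veval l a)
  end.

Fixpoint vlin (c : nat -> R) (l : list X) : X :=
  match l with
  | nil => zero
  | x :: l => plus (scal (c O) x) (vlin (fun n => c (S n)) l)
  end.

Lemma vlin_plus c d (l : list X) :
  vlin (fun n => c n + d n) l = plus (vlin c l) (vlin d l).
Proof.
elim: l c d => [|x l IH] c d /=; first by rewrite plus_zero_l.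
rewrite (IH (fun n => c (S n)) (fun n => d (S n))).
rewrite -[c O + d O]/(plus (c O) (d O)) scal_distr_r.
rewrite -!plus_assoc; congr plus.
by rewrite plus_assoc (plus_comm (scal (d O) x)) -plus_assoc.
Qed.

Lemma vlin_scal k c (l : list X) : vlin (fun n => k * c n) l = scal k (vlin c l).
Proof.
elim: l c => [|x l IH] c /=; first by rewrite scal_zero_r.
by rewrite (IH (fun n => c (S n))) scal_distr_l scal_assoc.
Qed.

Lemma vlin_ext c d (l : list X) : veqc c d l -> vlin c l = vlin d l.
Proof.
elim: l c d => [|x l IH] c d //= [-> H].
by rewrite (IH _ _ H).
Qed.

Lemma vlin_zero (l : list X) : vlin (fun _ => 0) l = zero.
Proof.
elim: l => [|x l IH] //=; rewrite IH plus_zero_r.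
exact: scal_zero_l.
Qed.

Lemma vlin_opp c (l : list X) : vlin (fun n => - c n) l = opp (vlin c l).
Proof.
rewrite -scal_opp_one -vlin_scal; apply: vlin_ext.
elim: l c => [|x l IH] c //=; split; last exact: IH.
rewrite /opp /one /=; ring.
Qed.

Lemma vlin_atom m (l : list X) :
  vlin (fun n => if Nat.eqb m n then 1 else 0) l = List.nth m l zero.
Proof.
elim: l m => [|x l IH] [|m] //=.
  by rewrite vlin_zero plus_zero_r; exact: scal_one.
rewrite IH -[RHS]plus_zero_l; congr plus; exact: scal_zero_l.
Qed.

Lemma veval_lin (l : list X) (e : vexp) : veval l e = vlin (vcoef e) l.
Proof.
elim: e => [|m|a IHa b IHb|a IHa|k a IHa] /=; rewrite ?IHa ?IHb.
- by rewrite vlin_zero.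
- by rewrite vlin_atom.
- by rewrite vlin_plus.
- by rewrite vlin_opp.
- by rewrite vlin_scal.
Qed.

Lemma veval_eq (l : list X) (e1 e2 : vexp) :
  veqc (vcoef e1) (vcoef e2) l -> veval l e1 = veval l e2.
Proof. by move=> H; rewrite !veval_lin; exact: vlin_ext. Qed.

End Vexp.

Ltac vmem x l :=
  match l with
  | nil => constr:(false)
  | x :: _ => constr:(true)
  | _ :: ?l => vmem x l
  end.
Ltac vatoms e l :=
  match e with
  | zero => l
  | plus ?a ?b => let l := vatoms a l in vatoms b l
  | minus ?a ?b => let l := vatoms a l in vatoms b l
  | opp ?a => vatoms a l
  | scal _ ?a => vatoms a l
  | ?x => let b := vmem x l in
          match b with true => l | false => constr:(x :: l) end
  end.
Ltac vidx x l :=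
  match l with
  | x :: _ => constr:(O)
  | _ :: ?l => let n := vidx x l in constr:(S n)
  end.
Ltac vreify e l :=
  match e with
  | zero => constr:(VZ)
  | plus ?a ?b => let a := vreify a l in let b := vreify b l in constr:(VP a b)
  | minus ?a ?b => let a := vreify a l in let b := vreify b l in constr:(VP a (VO b))
  | opp ?a => let a := vreify a l in constr:(VO a)
  | scal ?k ?a => let a := vreify a l in constr:(VS k a)
  | ?x => let n := vidx x l in constr:(VA n)
  end.
Ltac vnorm :=
  match goal with
  | |- @eq ?T ?a ?b =>
    let l := vatoms a (@nil T) in
    let l := vatoms b l in
    let ea := vreify a l in
    let eb := vreify b l in
    change (veval l ea = veval l eb);
    apply veval_eq; cbn [veqc vcoef Nat.eqb]; repeat split
  end.
Ltac vring := vnorm; rewrite /mult /plus /opp /one /zero /=; try ring; try field.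

(** * Finite sums and basic estimates *)

Section Sums.
Context {X : CompleteNormedModule R_AbsRing}.

Fixpoint vsum (u : nat -> X) (n : nat) : X :=
  match n with O => zero | S n => plus (vsum u n) (u n) end.

Lemma vsum_ext (u v : nat -> X) n :
  (forall i, (i < n)%nat -> u i = v i) -> vsum u n = vsum v n.
Proof.
elim: n => [|n IH] H //=; rewrite (H n (Nat.lt_succ_diag_r n)) IH //.
by move=> i Hi; apply: H; lia.
Qed.

Lemma vsum_minus (u v : nat -> X) n :
  vsum (fun i => minus (u i) (v i)) n = minus (vsum u n) (vsum v n).
Proof. by elim: n => [|n IH] /=; rewrite ?IH; vring. Qed.

Lemma vsum_scal (k : R) (u : nat -> X) n :
  vsum (fun i => scal k (u i)) n = scal k (vsum u n).
Proof. by elim: n => [|n IH] /=; rewrite ?IH; vring. Qed.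

Lemma vsum_shift (u : nat -> X) n :
  vsum u (S n) = plus (u O) (vsum (fun i => u (S i)) n).
Proof.
elim: n => [|n IH]; first by rewrite /=; vring.
rewrite -[LHS]/(plus (vsum u (S n)) (u (S n))) IH /=; vring.
Qed.

Lemma vsum_rev (u : nat -> X) n : vsum (fun i => u (n - 1 - i)%nat) n = vsum u n.
Proof.
elim: n => [|n IH] //.
rewrite vsum_shift [RHS]/= -IH plus_comm; congr plus.
  by apply: vsum_ext => i Hi; congr u; lia.
by congr u; lia.
Qed.

Lemma vsum_add (u : nat -> X) m n :
  vsum u (m + n) = plus (vsum u m) (vsum (fun i => u (m + i)%nat) n).
Proof.
elim: n => [|n IH]; first by rewrite Nat.add_0_r /=; vring.
by rewrite Nat.add_succ_r /= IH; vring.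
Qed.

Lemma vsum_sum_n_m (u : nat -> X) n :
  sum_n_m u 1 n = vsum (fun i => u (S i)) n.
Proof.
elim: n => [|n IH]; first by rewrite sum_n_m_zero //; lia.
by rewrite sum_n_Sm ?IH //; lia.
Qed.

Lemma norm_minus_sym (x y : X) : norm (minus x y) = norm (minus y x).
Proof. by rewrite -norm_opp opp_minus. Qed.

Lemma norm_minus_le (x y : X) : norm (minus x y) <= norm x + norm y.
Proof.
rewrite -(norm_opp y); exact: norm_triangle.
Qed.

Lemma norm_minus_trans (x y z : X) :
  norm (minus x z) <= norm (minus x y) + norm (minus y z).
Proof.
have -> : minus x z = plus (minus x y) (minus y z) by vring.
exact: norm_triangle.
Qed.

Lemma norm_le_minus (x y : X) : norm x <= norm y + norm (minus x y).
Proof.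
have {1}-> : x = plus y (minus x y) by vring.
exact: norm_triangle.
Qed.

Lemma norm_scal_le (k : R) (x : X) : norm (scal k x) <= Rabs k * norm x.
Proof. exact: norm_scal. Qed.

(** A normed module postulates only [<=]; the converse is the same inequality for [/ k]. *)
Lemma norm_scal_eq (k : R) (x : X) : norm (scal k x) = Rabs k * norm x.
Proof.
apply: Rle_antisym; first exact: norm_scal_le.
case: (Req_dec k 0) => [->|Hk].
  by rewrite Rabs_R0 Rmult_0_l; exact: norm_ge_0.
have Hk' := Rabs_pos_lt k Hk.
have E : x = scal (/ k) (scal k x) by vring.
have := norm_scal_le (/ k) (scal k x); rewrite -E Rabs_inv => H.
apply: (Rmult_le_reg_l (/ Rabs k)); first exact: Rinv_0_lt_compat.
by rewrite -Rmult_assoc Rinv_l ?Rmult_1_l //; lra.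
Qed.

Lemma norm_minus_eq0 (x y : X) :
  (forall e, 0 < e -> norm (minus x y) <= e) -> x = y.
Proof.
move=> H.
have H0 : norm (minus x y) = 0.
  have := norm_ge_0 (minus x y) => Hp.
  case: (Rle_lt_or_eq_dec _ _ Hp) => // Hlt.
  have := H (norm (minus x y) / 2); lra.
have := norm_eq_zero _ H0 => E.
have -> : x = plus (minus x y) y by vring.
by rewrite E plus_zero_l.
Qed.

(** Each term is charged to an increment of [b], so the error of a whole Stieltjes sum is the total
    growth of [b], whatever the number of cells. *)
Lemma norm_vsum_le (u : nat -> X) (b : nat -> R) n :
  (forall i, (i < n)%nat -> norm (u i) <= b (S i) - b i) ->
  norm (vsum u n) <= b n - b O.
Proof.
elim: n => [|n IH] H /=; first by rewrite norm_zero; lra.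
apply: Rle_trans (norm_triangle _ _) _.
have := H n (Nat.lt_succ_diag_r _).
have : norm (vsum u n) <= b n - b O by apply: IH => i Hi; apply: H; lia.
lra.
Qed.

Lemma vsum_telescope (w : nat -> X) n :
  vsum (fun i => minus (w (S i)) (w i)) n = minus (w n) (w O).
Proof. by elim: n => [|n IH] /=; rewrite ?IH; vring. Qed.

Lemma norm_telescope_le (w u : nat -> X) (b : nat -> R) n :
  (forall i, (i < n)%nat -> norm (minus (minus (w (S i)) (w i)) (u i)) <= b (S i) - b i) ->
  norm (minus (minus (w n) (w O)) (vsum u n)) <= b n - b O.
Proof.
move=> H; rewrite -vsum_telescope -vsum_minus.
exact: norm_vsum_le.
Qed.

Lemma filterlim_normE {T} (F : (T -> Prop) -> Prop) {FF : Filter F} (f : T -> X) (l : X) :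
  filterlim f F (locally l) <->
  (forall e, 0 < e -> F (fun x => norm (minus (f x) l) < e)).
Proof.
split.
  by move/filterlim_locally_ball_norm => H e He; exact: (H (mkposreal e He)).
move=> H; apply/filterlim_locally_ball_norm => e.
exact: H (cond_pos e).
Qed.

Lemma continuous_normE (f : R -> X) (t : R) :
  continuous f t <->
  (forall e, 0 < e -> exists d, 0 < d /\
     forall s, Rabs (s - t) < d -> norm (minus (f s) (f t)) < e).
Proof.
split.
  move/filterlim_normE => H e He.
  have [d Hd] := H e He.
  by exists d; split; [exact: cond_pos | move=> s Hs; apply: Hd].
move=> H; apply/filterlim_normE => e He.
have [d [Hd H']] := H e He.
by exists (mkposreal d Hd) => s Hs; apply: H'.
Qed.

Lemma continuous_vsum (u : nat -> R -> X) n t :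
  (forall i, continuous (u i) t) -> continuous (fun s => vsum (fun i => u i s) n) t.
Proof.
move=> H; elim: n => [|n IH] /=; first exact: continuous_const.
exact: continuous_plus.
Qed.

End Sums.

(** * Power kernels *)

(** [Rpower] takes the value 1 at nonpositive bases, hence the cut by hand. Vanishing there makes
    the kernels causal, and for [b > 0] continuous on the whole line. *)
Definition ppow (b t : R) : R := if Rlt_dec 0 t then Rpower t b else 0.

Lemma ppow_pos b t : 0 < t -> ppow b t = Rpower t b.
Proof. by rewrite /ppow; case: Rlt_dec. Qed.

Lemma ppow_npos b t : t <= 0 -> ppow b t = 0.
Proof. by rewrite /ppow; case: Rlt_dec => //; lra. Qed.

Lemma Rpower_gt0 x b : 0 < Rpower x b.
Proof. exact: exp_pos. Qed.

Lemma ppow_gt0 b t : 0 < t -> 0 < ppow b t.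
Proof. by move=> Ht; rewrite ppow_pos //; exact: Rpower_gt0. Qed.

Lemma ppow_ge0 b t : 0 <= ppow b t.
Proof.
rewrite /ppow; case: Rlt_dec => _; last lra.
exact/Rlt_le/Rpower_gt0.
Qed.

Lemma ppow_le b s t : 0 < b -> s <= t -> ppow b s <= ppow b t.
Proof.
move=> Hb Hst; rewrite {1}/ppow; case: Rlt_dec => Hs; last exact: ppow_ge0.
rewrite ppow_pos; last lra.
by apply: Rle_Rpower_l; lra.
Qed.

Lemma ppow_1 t : 0 <= t -> ppow 1 t = t.
Proof.
move=> Ht; rewrite /ppow; case: Rlt_dec => H; last lra.
exact: Rpower_1.
Qed.

Lemma ppow_mult b s t : 0 < s -> ppow b (s * t) = Rpower s b * ppow b t.
Proof.
move=> Hs; case: (Rlt_dec 0 t) => Ht.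
  rewrite !ppow_pos //; last exact: Rmult_lt_0_compat.
  by rewrite Rpower_mult_distr.
rewrite !ppow_npos; try lra; nra.
Qed.

Lemma ppow_ppow b c t : ppow c (ppow b t) = ppow (b * c) t.
Proof.
case: (Rlt_dec 0 t) => Ht.
  rewrite (ppow_pos b) // (ppow_pos (b * c)) // ppow_pos; last exact: Rpower_gt0.
  exact: Rpower_mult.
rewrite (ppow_npos b); last lra.
rewrite !ppow_npos; lra.
Qed.

Lemma ppow_inv b t : 0 < b -> 0 <= t -> ppow (/ b) (ppow b t) = t.
Proof.
move=> Hb Ht; rewrite ppow_ppow Rinv_r; last lra.
exact: ppow_1.
Qed.

Lemma is_derive_Rpower b t : 0 < t -> is_derive (fun t => Rpower t b) t (b * Rpower t (b - 1)).
Proof.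
move=> Ht; rewrite /Rpower; auto_derive; first by [].
have -> : (b - 1) * ln t = b * ln t + - ln t by ring.
rewrite exp_plus exp_Ropp exp_ln //.
field; lra.
Qed.

Lemma is_derive_ppow b t : 0 < t -> is_derive (ppow b) t (b * Rpower t (b - 1)).
Proof.
move=> Ht; apply: is_derive_ext_loc (is_derive_Rpower b t Ht).
exists (mkposreal _ Ht) => s /=.
rewrite /ball /= /AbsRing_ball /abs /minus /plus /opp /= => /Rabs_def2 Hs.
rewrite ppow_pos //; lra.
Qed.

Lemma continuous_ppow b t : 0 < b -> continuous (ppow b) t.
Proof.
move=> Hb; case: (Rlt_dec 0 t) => Ht.
  by apply: (@ex_derive_continuous R_AbsRing R_NormedModule); eexists; exact: is_derive_ppow.
apply/continuous_normE => e He.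
rewrite (ppow_npos b t); last lra.
(* The radius is [e^(1/b)], the point at which the power reaches [e]. *)
exists (ppow (/ b) e); split; first exact: ppow_gt0.
move=> s Hs.
rewrite /minus /opp /plus /norm /= /abs /= Ropp_0 Rplus_0_r Rabs_pos_eq; last exact: ppow_ge0.
case: (Rlt_dec 0 s) => H0; last by rewrite ppow_npos; lra.
have Hs' : s < ppow (/ b) e by move: Hs => /Rabs_def2; lra.
have Hmono : ppow b s < ppow b (ppow (/ b) e).
  rewrite !ppow_pos //; last exact: Rpower_gt0.
    by apply: Rlt_Rpower_l => //; rewrite -ppow_pos.
move: Hmono; rewrite ppow_ppow Rinv_l ?ppow_1; lra.
Qed.

(** The primitive of the kernel [C * t^(b-1)], equal to [g_(b+1)] when [C = / Gamma b]; [pH] is its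
    inverse on the half line. *)
Definition pG (b C t : R) : R := C / b * ppow b t.
Definition pH (b C s : R) : R := ppow (/ b) (b / C * s).

Section Kernel.
Context {X : CompleteNormedModule R_AbsRing}.
Variables b C : R.
Hypothesis b_gt0 : 0 < b.
Hypothesis C_gt0 : 0 < C.

Lemma pG_coef : 0 < C / b.
Proof. exact: Rdiv_lt_0_compat. Qed.

Lemma pG_ge0 t : 0 <= pG b C t.
Proof. have := pG_coef; have := ppow_ge0 b t; rewrite /pG; nra. Qed.

Lemma pG_gt0 t : 0 < t -> 0 < pG b C t.
Proof. move=> Ht; apply: Rmult_lt_0_compat (pG_coef) (ppow_gt0 _ _ Ht). Qed.

Lemma pG_npos t : t <= 0 -> pG b C t = 0.
Proof. by move=> Ht; rewrite /pG ppow_npos // Rmult_0_r. Qed.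

Lemma pG_le s t : s <= t -> pG b C s <= pG b C t.
Proof.
move=> Hst; apply: Rmult_le_compat_l; first exact: Rlt_le pG_coef.
exact: ppow_le.
Qed.

Lemma continuous_pG t : continuous (pG b C) t.
Proof. by apply: (continuous_scal_r (V := R_NormedModule)); exact: continuous_ppow. Qed.

Lemma is_derive_pG t : 0 < t -> is_derive (pG b C) t (C * Rpower t (b - 1)).
Proof.
move=> Ht; have := is_derive_scal (ppow b) t (C / b) _ (is_derive_ppow b t Ht).
have -> : C / b * (b * Rpower t (b - 1)) = C * Rpower t (b - 1) by field; lra.
by [].
Qed.

Lemma pH_ge0 s : 0 <= pH b C s.
Proof. exact: ppow_ge0. Qed.

Lemma pH_le s t : s <= t -> pH b C s <= pH b C t.
Proof.
move=> Hst; apply: ppow_le; first exact: Rinv_0_lt_compat.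
apply: Rmult_le_compat_l Hst; exact/Rlt_le/Rdiv_lt_0_compat.
Qed.

Lemma continuous_pH s : continuous (pH b C) s.
Proof.
apply: (continuous_comp (fun s => b / C * s) (ppow (/ b))).
  by apply: (continuous_scal_r (V := R_NormedModule)); exact: continuous_id.
by apply: continuous_ppow; exact: Rinv_0_lt_compat.
Qed.

Lemma pH_pG t : 0 <= t -> pH b C (pG b C t) = t.
Proof.
move=> Ht; rewrite /pH /pG.
have -> : b / C * (C / b * ppow b t) = ppow b t by field; lra.
exact: ppow_inv.
Qed.

Lemma pG_pH s : 0 <= s -> pG b C (pH b C s) = s.
Proof.
move=> Hs; rewrite /pH /pG ppow_ppow Rinv_l; last lra.
rewrite ppow_1; first by field; lra.
apply: Rmult_le_pos Hs; exact/Rlt_le/Rdiv_lt_0_compat.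
Qed.

Lemma pG_mult l t : 0 < l -> pG b C (l * t) = Rpower l b * pG b C t.
Proof. by move=> Hl; rewrite /pG ppow_mult //; ring. Qed.

Lemma pH_mult l s : 0 < l -> pH b C (Rpower l b * s) = l * pH b C s.
Proof.
move=> Hl; rewrite /pH.
have -> : b / C * (Rpower l b * s) = Rpower l b * (b / C * s) by ring.
rewrite ppow_mult; last exact: Rpower_gt0.
rewrite Rpower_mult Rinv_r ?Rpower_1 //; lra.
Qed.

Lemma pG_lim e : 0 < e -> exists T, 0 < T /\ forall t, T <= t -> e <= pG b C t.
Proof.
move=> He; exists (pH b C e); split.
  by apply: ppow_gt0; apply: Rmult_lt_0_compat He; exact: Rdiv_lt_0_compat.
move=> t Ht; rewrite -{1}(pG_pH e); last lra.
exact: pG_le.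
Qed.

(* The substitution [sigma = pG b C (t - s)] turns the weakly singular integral
   of [C * (t - s)^(b-1) * phi s] over (0,t) into this proper one. *)
Definition pK (phi : R -> X) (t : R) : X :=
  RInt (fun s => phi (t - pH b C s)) 0 (pG b C t).

Lemma continuous_pK_integrand (phi : R -> X) t s :
  (forall u, continuous phi u) -> continuous (fun s => phi (t - pH b C s)) s.
Proof.
move=> Hphi; apply: (continuous_comp (fun s => t - pH b C s) phi) (Hphi _).
apply: (continuous_minus (V := R_NormedModule)); first exact: continuous_const.
exact: continuous_pH.
Qed.

Lemma ex_RInt_pK (phi : R -> X) t u v :
  (forall u, continuous phi u) -> ex_RInt (fun s => phi (t - pH b C s)) u v.
Proof.
by move=> Hphi; apply: ex_RInt_continuous => s _; exact: continuous_pK_integrand.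
Qed.

Lemma pK_npos (phi : R -> X) t : t <= 0 -> pK phi t = zero.
Proof. by move=> Ht; rewrite /pK pG_npos // RInt_point. Qed.

Lemma pH_range t s : 0 <= t -> 0 <= s <= pG b C t -> 0 <= pH b C s <= t.
Proof.
move=> Ht [H0 H1]; split; first exact: pH_ge0.
by rewrite -(pH_pG t) //; exact: pH_le.
Qed.

Lemma pK_ext (phi psi : R -> X) t :
  (forall s, 0 <= s <= t -> phi s = psi s) -> pK phi t = pK psi t.
Proof.
move=> H; case: (Rle_dec t 0) => Ht; first by rewrite !pK_npos.
apply: RInt_ext => s; rewrite Rmin_left ?Rmax_right; try exact: pG_ge0.
move=> Hs; apply: H.
have := pH_range t s; lra.
Qed.

Lemma pK_norm_le (phi : R -> X) t M :
  (forall u, continuous phi u) ->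
  (forall s, 0 <= s <= t -> norm (phi s) <= M) -> norm (pK phi t) <= pG b C t * M.
Proof.
move=> Hphi HM; case: (Rle_dec t 0) => Ht.
  by rewrite pK_npos // pG_npos // norm_zero; lra.
have := norm_RInt_le_const (fun s => phi (t - pH b C s)) 0 (pG b C t) (pK phi t) M.
rewrite Rminus_0_r; apply; first exact: pG_ge0.
  move=> s Hs; apply: HM; have := pH_range t s; lra.
by apply: RInt_correct; exact: ex_RInt_pK.
Qed.

Lemma pK_plus (phi psi : R -> X) t :
  (forall u, continuous phi u) -> (forall u, continuous psi u) ->
  pK (fun s => plus (phi s) (psi s)) t = plus (pK phi t) (pK psi t).
Proof. by move=> H1 H2; apply: RInt_plus; exact: ex_RInt_pK. Qed.

Lemma pK_minus (phi psi : R -> X) t :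
  (forall u, continuous phi u) -> (forall u, continuous psi u) ->
  pK (fun s => minus (phi s) (psi s)) t = minus (pK phi t) (pK psi t).
Proof. by move=> H1 H2; apply: RInt_minus; exact: ex_RInt_pK. Qed.

Lemma pK_scal (phi : R -> X) (k : R) t :
  (forall u, continuous phi u) -> pK (fun s => scal k (phi s)) t = scal k (pK phi t).
Proof. by move=> H1; apply: RInt_scal; exact: ex_RInt_pK. Qed.

Lemma pK_const (x : X) t : pK (fun _ => x) t = scal (pG b C t) x.
Proof. by rewrite /pK RInt_const Rminus_0_r. Qed.

Lemma pK_zero t : pK (fun _ => zero) t = zero.
Proof. by rewrite pK_const scal_zero_r. Qed.

Lemma pK_vsum (u : nat -> R -> X) n t :
  (forall i s, continuous (u i) s) ->
  pK (fun s => vsum (fun i => u i s) n) t = vsum (fun i => pK (u i) t) n.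
Proof.
move=> Hu; elim: n => [|n IH] /=; first exact: pK_zero.
rewrite pK_plus ?IH // => s; exact: continuous_vsum.
Qed.

(** Causality is the point: beyond [pG b C (t - c)] the argument [t - c - pH b C s] is nonpositive,
    so the surplus part of the integral is zero. *)
Lemma pK_shift (phi : R -> X) c t :
  (forall u, continuous phi u) -> (forall u, u <= 0 -> phi u = zero) -> 0 <= c ->
  pK (fun s => phi (s - c)) t = pK phi (t - c).
Proof.
move=> Hphi H0 Hc.
have Ec s : t - pH b C s - c = t - c - pH b C s by ring.
rewrite /pK (RInt_ext _ (fun s => phi (t - c - pH b C s))); last by move=> s _; rewrite Ec.
rewrite -(RInt_Chasles _ 0 (pG b C (t - c)) (pG b C t)); try exact: ex_RInt_pK.
rewrite [X in plus _ X](RInt_ext _ (fun _ => zero)).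
  by rewrite RInt_const scal_zero_r plus_zero_r.
have Hle : pG b C (t - c) <= pG b C t by apply: pG_le; lra.
move=> s; rewrite Rmin_left // Rmax_right // => Hs; apply: H0.
case: (Rle_dec 0 (t - c)) => Htc; last by have := pH_ge0 s; lra.
have := pH_le (pG b C (t - c)) s; rewrite pH_pG //; lra.
Qed.

End Kernel.

(** * Stieltjes sums and composition of power kernels *)

Definition pt (T : R) (n i : nat) : R := T * INR i / INR n.

Lemma pt_0 T n : pt T n 0 = 0.
Proof. rewrite /pt /= /Rdiv; ring. Qed.

Lemma INR_gt0 n : (1 <= n)%nat -> 0 < INR n.
Proof. by move=> Hn; apply: lt_0_INR; lia. Qed.

Lemma pt_n T n : (1 <= n)%nat -> pt T n n = T.
Proof. move=> /INR_gt0 Hn; rewrite /pt; field; lra. Qed.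

Lemma pt_S T n i : (1 <= n)%nat -> pt T n (S i) = pt T n i + T / INR n.
Proof. move=> /INR_gt0 Hn; rewrite /pt S_INR; field; lra. Qed.

Lemma pt_bound T n i : 0 <= T -> (i <= n)%nat -> (1 <= n)%nat -> 0 <= pt T n i <= T.
Proof.
move=> HT Hi /INR_gt0 Hn.
have Hi' := le_INR _ _ Hi; have H0 := pos_INR i.
have -> : pt T n i = T * (INR i / INR n) by rewrite /pt /Rdiv; ring.
have H1 : 0 <= INR i / INR n by apply: Rdiv_le_0_compat.
have H2 : INR i / INR n <= 1 by apply/Rle_div_l; lra.
split; nra.
Qed.

Lemma Rdiv_small e T : 0 < e -> 0 <= T ->
  exists N, (1 <= N)%nat /\ forall n, (N <= n)%nat -> T / INR n < e.
Proof.
move=> He HT.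
have [N HN] := archimed_cor1 (e / (T + 1)) (Rdiv_lt_0_compat _ _ He (Rle_lt_0_plus_1 _ HT)).
exists N; split; first lia.
move=> n Hn.
have HN0 : 0 < INR N by apply: INR_gt0; lia.
have Hle := le_INR _ _ Hn.
have Hi : / INR n <= / INR N by apply: Rinv_le_contravar.
have Hp : 0 < / INR n by apply: Rinv_0_lt_compat; lra.
have H1 : / INR n < e / (T + 1) by lra.
apply: Rle_lt_trans (_ : (T + 1) * / INR n < e); first by rewrite /Rdiv; nra.
apply: Rlt_le_trans (Rmult_lt_compat_l (T + 1) _ _ _ H1) _; first lra.
apply: Req_le; field; lra.
Qed.

Section Approx.
Context {X : CompleteNormedModule R_AbsRing}.

(** A Stieltjes sum for the integral of [f(s)] against [- d_s g(t - s)]. The subdivision of [[0,T]]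
    does not move with [t]: cells beyond [t] contribute nothing as soon as [g] is constant on
    nonpositive times. This makes the sum continuous in [t] and allows errors uniform in [t]. *)
Definition Stsum (g : R -> X -> X) (f : R -> X) (T : R) (n : nat) (t : R) : X :=
  vsum (fun i => minus (g (t - pt T n i) (f (pt T n i)))
                       (g (t - pt T n (S i)) (f (pt T n i)))) n.

Lemma continuous_Stsum g (f : R -> X) T n t :
  (forall z u, continuous (fun u => g u z) u) -> continuous (Stsum g f T n) t.
Proof.
move=> Hg; apply: (continuous_vsum (fun i s => _)) => i.
have Hc a z : continuous (fun s => g (s - a) z) t.
  apply: (continuous_comp (fun s => s - a) (fun u => g u z)) (Hg _ _).
  by apply: (continuous_minus (V := R_NormedModule));
    [exact: continuous_id | exact: continuous_const].
by apply: continuous_minus; exact: Hc.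
Qed.

Lemma unif_modulus (f : R -> X) T e : (forall u, continuous f u) -> 0 <= T -> 0 < e ->
  exists N, (1 <= N)%nat /\ forall n, (N <= n)%nat -> forall s s',
    0 <= s <= T -> 0 <= s' <= T -> Rabs (s' - s) <= T / INR n ->
    norm (minus (f s') (f s)) <= e.
Proof.
move=> Hf HT He.
have [d Hd] := unifcont_normed_1d f 0 T (fun x _ => Hf x) (mkposreal e He).
have [N [HN HN']] := Rdiv_small d T (cond_pos d) HT.
exists N; split => // n Hn s s' Hs Hs' Hss; apply: Rlt_le.
apply: Hd => //; apply: Rle_lt_trans Hss (HN' n Hn).
Qed.

Lemma RInt_near_const (f : R -> X) u v c e :
  (forall s, continuous f s) -> u <= v ->
  (forall s, u <= s <= v -> norm (minus (f s) c) <= e) ->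
  norm (minus (RInt f u v) (scal (v - u) c)) <= e * (v - u).
Proof.
move=> Hf Huv He; rewrite Rmult_comm.
have Hex g : (forall s : R, continuous g s) -> ex_RInt (V := X) g u v.
  by move=> Hg; apply: ex_RInt_continuous.
rewrite -RInt_const -RInt_minus; try by apply: Hex => // s; exact: continuous_const.
apply: (norm_RInt_le_const (fun s => minus (f s) c) u v) => //.
apply: RInt_correct; apply: Hex => s.
by apply: continuous_minus => //; exact: continuous_const.
Qed.

Lemma continuous_approx (f : R -> X) t :
  (forall e, 0 < e -> exists (g : R -> X) d, 0 < d /\ continuous g t /\
     forall s, Rabs (s - t) < d -> norm (minus (f s) (g s)) <= e) ->
  continuous f t.
Proof.
move=> H; apply/continuous_normE => e He.
have [g [d [Hd [/continuous_normE Hg Hfg]]]] := H (e / 4) ltac:(lra).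
have [d' [Hd' Hg']] := Hg (e / 4) ltac:(lra).
exists (Rmin d d'); split; first exact: Rmin_glb_lt.
move=> s Hs.
have Hs1 : Rabs (s - t) < d by apply: Rlt_le_trans Hs (Rmin_l _ _).
have Hs2 : Rabs (s - t) < d' by apply: Rlt_le_trans Hs (Rmin_r _ _).
have Ht : Rabs (t - t) < d by rewrite Rminus_diag_eq // Rabs_R0.
have := norm_minus_trans (f s) (g s) (f t).
have := norm_minus_trans (g s) (g t) (f t).
have := Hfg s Hs1; have := Hfg t Ht; have := Hg' s Hs2.
rewrite (norm_minus_sym (g t)); lra.
Qed.

(** Here the vector is fixed and the scalar varies; the fundamental theorem applies, with the right
    side as primitive. *)
Lemma RInt_scal_l (h : R -> R) (x : X) u v : (forall s, continuous h s) ->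
  RInt (fun s => scal (h s) x) u v = scal (RInt h u v) x.
Proof.
move=> Hh; apply: is_RInt_unique.
have -> : scal (RInt h u v) x = minus (scal (RInt h u v) x) (scal (RInt h u u) x).
  by rewrite RInt_point scal_zero_l minus_zero_r.
apply: (is_RInt_derive (fun w => scal (RInt h u w) x)) => w _.
  apply: is_derive_scal_l; apply: is_derive_RInt (Hh w).
  exists (mkposreal _ Rlt_0_1) => y _.
  by apply: (RInt_correct (V := R_CompleteNormedModule)); apply: ex_RInt_continuous.
exact: continuous_scal_l.
Qed.

End Approx.

Section PowerApprox.
Context {X : CompleteNormedModule R_AbsRing}.
Variables b C : R.
Hypothesis b_gt0 : 0 < b.
Hypothesis C_gt0 : 0 < C.

Definition pGs (t : R) (z : X) : X := scal (pG b C t) z.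

(** On the cell from [pG b C (t - s1)] to [pG b C (t - s0)] the argument [t - pH b C s] stays in
    [[s0,s1]], where [phi] oscillates by at most [e]. The error is thus [e] times an increment of
    the primitive, and these telescope. *)
Lemma pK_Stsum (phi : R -> X) T e :
  (forall u, continuous phi u) -> 0 <= T -> 0 < e ->
  exists N, (1 <= N)%nat /\ forall n, (N <= n)%nat -> forall t, t <= T ->
    norm (minus (pK b C phi t) (Stsum pGs phi T n t)) <= e * pG b C T.
Proof.
move=> Hphi HT He.
have [N [HN Hmod]] := unif_modulus phi T e Hphi HT He.
exists N; split => // n Hn t Ht.
have Hn1 : (1 <= n)%nat by lia.
have Hcont s := continuous_pK_integrand b C b_gt0 phi t s Hphi.
have Hex u v := ex_RInt_pK b C b_gt0 phi t u v Hphi.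
pose W i := RInt (fun s => phi (t - pH b C s)) (pG b C (t - pt T n i)) (pG b C t).
pose B i := e * (pG b C t - pG b C (t - pt T n i)).
have HW : pK b C phi t = minus (W n) (W O).
  rewrite /W pt_n // (pG_npos b C (t - T)); last lra.
  by rewrite pt_0 Rminus_0_r RInt_point minus_zero_r.
have HB : B n - B O <= e * pG b C T.
  rewrite /B pt_0 Rminus_0_r.
  have := pG_ge0 b C b_gt0 C_gt0 (t - pt T n n).
  have := pG_le b C b_gt0 C_gt0 t T Ht; nra.
rewrite HW; apply: Rle_trans HB; apply: norm_telescope_le => i Hi.
set s0 := pt T n i; set s1 := pt T n (S i).
have Hs0 : 0 <= s0 <= T by apply: pt_bound => //; lia.
have Hs1 : 0 <= s1 <= T by apply: pt_bound => //; lia.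
have Hstep : s1 = s0 + T / INR n by exact: pt_S.
have Hstep0 : 0 <= T / INR n by apply: Rdiv_le_0_compat HT (INR_gt0 _ Hn1).
have -> : minus (W (S i)) (W i) =
    RInt (fun s => phi (t - pH b C s)) (pG b C (t - s1)) (pG b C (t - s0)).
  rewrite /W -(RInt_Chasles _ (pG b C (t - s1)) (pG b C (t - s0)) (pG b C t)) // -/s0.
  vring.
have Hle : pG b C (t - s1) <= pG b C (t - s0) by apply: pG_le => //; lra.
have -> : minus (pGs (t - s0) (phi s0)) (pGs (t - s1) (phi s0)) =
    scal (pG b C (t - s0) - pG b C (t - s1)) (phi s0).
  by rewrite /pGs; vring.
have -> : B (S i) - B i = e * (pG b C (t - s0) - pG b C (t - s1)).
  by rewrite /B -/s0 -/s1; ring.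
(* A cell to the right of [t] contributes zero to the integral and to the sum. *)
case: (Rle_dec t s0) => Hts.
  rewrite !pG_npos; try lra.
  by rewrite RInt_point Rminus_diag_eq // scal_zero_l minus_eq_zero norm_zero; lra.
apply: RInt_near_const => // s Hs.
have [Hp0 Hp1] : s0 <= t - pH b C s <= s1.
  have H1 : pH b C s <= t - s0.
    by rewrite -(pH_pG b C b_gt0 C_gt0 (t - s0)); [apply: pH_le => //; lra | lra].
  have H2 : t - s1 <= pH b C s.
    case: (Rle_dec 0 (t - s1)) => H; last by have := pH_ge0 b C s; lra.
    by rewrite -(pH_pG b C b_gt0 C_gt0 (t - s1)) //; apply: pH_le => //; lra.
  lra.
apply: (Hmod n) => //; try lra.
rewrite Rabs_pos_eq; lra.
Qed.

Lemma continuous_pGs z u : continuous (fun u => pGs u z) u.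
Proof. by apply: continuous_scal_l; exact: continuous_pG. Qed.

Lemma continuous_pK (phi : R -> X) t :
  (forall u, continuous phi u) -> continuous (pK b C phi) t.
Proof.
move=> Hphi; apply: continuous_approx => e He.
pose T := Rabs t + 1.
have HT : 0 <= T by have := Rabs_pos t; rewrite /T; lra.
have HG := pG_ge0 b C b_gt0 C_gt0 T.
have He' : 0 < e / (pG b C T + 1) by apply: Rdiv_lt_0_compat; lra.
have [N [_ HN]] := pK_Stsum phi T _ Hphi HT He'.
exists (Stsum pGs phi T N), 1; split; first lra.
split; first by apply: continuous_Stsum => z u; exact: continuous_pGs.
move=> s Hs.
have Hs' : s <= T by have := Rle_abs t; have := Rabs_def2 _ _ Hs; rewrite /T; lra.
apply: Rle_trans (HN N (le_n N) s Hs') _.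
have -> : e / (pG b C T + 1) * pG b C T = e - e / (pG b C T + 1) by field; lra.
lra.
Qed.

Lemma pK_scal_l (h : R -> R) (x : X) t : (forall u, continuous h u) ->
  pK b C (fun s => scal (h s) x) t = scal (pK b C h t) x.
Proof.
move=> Hh; apply: (RInt_scal_l (fun s => h (t - pH b C s))) => s.
exact: (continuous_pK_integrand (X := R_CompleteNormedModule)).
Qed.

End PowerApprox.

Section Composition.
Context {X : CompleteNormedModule R_AbsRing}.
Variables b1 C1 b2 C2 b3 C3 : R.
Hypothesis b1_gt0 : 0 < b1.
Hypothesis C1_gt0 : 0 < C1.
Hypothesis b2_gt0 : 0 < b2.
Hypothesis C2_gt0 : 0 < C2.
Hypothesis b3_gt0 : 0 < b3.
Hypothesis C3_gt0 : 0 < C3.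

(** Only the scalar rule for the primitive kernel is assumed. A Stieltjes sum of [phi] is a
    combination of translates of that kernel with vector coefficients, so the rule holds for the sum
    by [pK_shift], and then in the limit. *)
Lemma pK_comp_scal c (phi : R -> X) t :
  (forall t, pK b1 C1 (pG b2 C2 : R -> R_CompleteNormedModule) t = c * pG b3 C3 t) ->
  (forall u, continuous phi u) ->
  pK b1 C1 (pK b2 C2 phi) t = scal c (pK b3 C3 phi t).
Proof.
move=> Hc Hphi.
have [Ht|Ht] : t <= 0 \/ 0 <= t by lra.
  by rewrite !pK_npos // scal_zero_r.
have Hsum n : pK b1 C1 (Stsum (pGs b2 C2) phi t n) t = scal c (Stsum (pGs b3 C3) phi t n t).
  case: n => [|n]; first by rewrite /Stsum /= pK_zero scal_zero_r.
  have Hcs a z s : continuous (fun s => pGs b2 C2 (s - a) z : X) s.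
    apply: (continuous_comp (fun s => s - a) (fun u => pGs b2 C2 u z)).
      by apply: (continuous_minus (V := R_NormedModule));
        [exact: continuous_id | exact: continuous_const].
    exact: continuous_pGs.
  rewrite /Stsum pK_vsum //; last by move=> i s; apply: continuous_minus.
  rewrite -vsum_scal; apply: vsum_ext => i Hi.
  have Hsh a z : 0 <= a -> pK b1 C1 (fun s => pGs b2 C2 (s - a) z : X) t =
      scal (c * pG b3 C3 (t - a)) z.
    move=> Ha; rewrite (pK_shift b1 C1 _ _ (fun u => pGs b2 C2 u z)) //.
    - by rewrite pK_scal_l ?Hc // => u; exact: continuous_pG.
    - by move=> u; exact: continuous_pGs.
    - by move=> u Hu; rewrite /pGs pG_npos // scal_zero_l.
  have Hb j : (j <= S n)%nat -> 0 <= pt t (S n) j.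
    by move=> Hj; have := pt_bound t (S n) j Ht Hj ltac:(lia); lra.
  rewrite pK_minus // !Hsh /pGs; try by apply: Hb; lia.
  by vring.
apply: norm_minus_eq0 => e He.
have HG1 := pG_ge0 b1 C1 b1_gt0 C1_gt0 t.
have HG2 := pG_ge0 b2 C2 b2_gt0 C2_gt0 t.
have HG3 := pG_ge0 b3 C3 b3_gt0 C3_gt0 t.
have Hc0 := Rabs_pos c.
(* The weights of the two approximation errors; the added 1 keeps [M] positive. *)
set M := pG b1 C1 t * pG b2 C2 t + Rabs c * pG b3 C3 t + 1.
have HM : 0 < M by rewrite /M; nra.
have He' : 0 < e / M by exact: Rdiv_lt_0_compat.
have [N2 [HN2 H2]] := pK_Stsum b2 C2 b2_gt0 C2_gt0 phi t _ Hphi Ht He'.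
have [N3 [HN3 H3]] := pK_Stsum b3 C3 b3_gt0 C3_gt0 phi t _ Hphi Ht He'.
pose n := Nat.max N2 N3.
apply: Rle_trans (norm_minus_trans _ (pK b1 C1 (Stsum (pGs b2 C2) phi t n) t) _) _.
have Hk2 u : continuous (pK b2 C2 phi) u by exact: continuous_pK.
have Hst u : continuous (Stsum (pGs b2 C2) phi t n) u.
  by apply: continuous_Stsum => z v; exact: continuous_pGs.
have E1 : norm (minus (pK b1 C1 (pK b2 C2 phi) t)
    (pK b1 C1 (Stsum (pGs b2 C2) phi t n) t)) <= pG b1 C1 t * (e / M * pG b2 C2 t).
  rewrite -pK_minus //; apply: pK_norm_le => //.
    by move=> u; apply: continuous_minus.
  by move=> s Hs; apply: H2; rewrite /n; lia || lra.
have E2 : norm (minus (pK b1 C1 (Stsum (pGs b2 C2) phi t n) t) (scal c (pK b3 C3 phi t)))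
    <= Rabs c * (e / M * pG b3 C3 t).
  rewrite Hsum norm_minus_sym.
  have -> (x y : X) : minus (scal c x) (scal c y) = scal c (minus x y) by vring.
  apply: Rle_trans (norm_scal_le _ _) _; apply: Rmult_le_compat_l => //.
  by apply: H3; rewrite /n; lia || lra.
have EM : e = e / M * (pG b1 C1 t * pG b2 C2 t) + e / M * (Rabs c * pG b3 C3 t) + e / M.
  rewrite {1}(_ : e = e / M * M); last by field; lra.
  by rewrite {2}/M; ring.
lra.
Qed.

(** Replacing the integration variable by its multiple [Rpower t b1] scales [pH] by [t], so the left
    side is homogeneous of degree [b1 + b2]. The constant is the ratio at [t = 1]; its value stays
    open here. *)
Lemma pK_pG_power : b3 = b1 + b2 -> exists c, forall t,
  pK b1 C1 (pG b2 C2 : R -> R_CompleteNormedModule) t = c * pG b3 C3 t.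
Proof.
move=> E3.
have H1 : 0 < pG b3 C3 1 by apply: pG_gt0 => //; lra.
exists (pK b1 C1 (pG b2 C2 : R -> R_CompleteNormedModule) 1 / pG b3 C3 1) => t.
case: (Rle_dec t 0) => Ht.
  by rewrite pK_npos // (pG_npos b3 C3 t) // Rmult_0_r.
have Ht0 : 0 < t by lra.
have -> : pG b3 C3 t = Rpower t b3 * pG b3 C3 1 by rewrite -pG_mult // Rmult_1_r.
have -> : forall y z, y / z * (Rpower t b3 * z) = Rpower t b3 * (y * (z / z)) by move=> *; rewrite /Rdiv; ring.
rewrite Rdiv_diag ?Rmult_1_r; last lra.
rewrite {1}/pK.
have -> : pG b1 C1 t = Rpower t b1 * pG b1 C1 1 by rewrite -pG_mult // Rmult_1_r.
have Hex u v : ex_RInt (V := R_CompleteNormedModule) (fun s => pG b2 C2 (t - pH b1 C1 s)) u v.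
  by apply: (ex_RInt_pK (X := R_CompleteNormedModule)) => // w; exact: continuous_pG.
have := RInt_comp_lin (V := R_CompleteNormedModule)
  (fun s => pG b2 C2 (t - pH b1 C1 s)) (Rpower t b1) 0 0 (pG b1 C1 1) (Hex _ _).
rewrite Rmult_0_r !Rplus_0_r => <-.
rewrite (RInt_ext (V := R_CompleteNormedModule) _ (fun y => scal (Rpower t b3) (pG b2 C2 (1 - pH b1 C1 y)))); last first.
  move=> y _; rewrite Rplus_0_r pH_mult // E3 Rpower_plus.
  have -> : t - t * pH b1 C1 y = t * (1 - pH b1 C1 y) by ring.
  rewrite pG_mult // /scal /= /mult /=; ring.
rewrite RInt_scal //.
by apply: (ex_RInt_pK (X := R_CompleteNormedModule)) => // w; exact: continuous_pG.
Qed.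

End Composition.

(** * Normalisation of the kernels and the Gamma function *)

(** [Lap b C (pG b C t)] is the integral of [C * s^(b-1) * exp (- s)] over [(0,t)] after the
    substitution of [pK]: an incomplete Gamma function. *)
Definition Lap (b C x : R) : R :=
  RInt (V := R_CompleteNormedModule) (fun s => exp (- pH b C s)) 0 x.

(** The Laplace transform of the kernel equals 1 at the point 1. *)
Definition normalized (b C : R) : Prop :=
  forall e, 0 < e -> exists T, forall t, T <= t -> Rabs (Lap b C (pG b C t) - 1) <= e.

Lemma continuous_exp t : continuous exp t.
Proof.
apply: (@ex_derive_continuous R_AbsRing R_NormedModule).
by eexists; exact: is_derive_exp.
Qed.

Lemma RInt_Rmult k (f : R -> R) u v : ex_RInt (V := R_CompleteNormedModule) f u v ->
  RInt (V := R_CompleteNormedModule) (fun s => k * f s) u v =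
  k * RInt (V := R_CompleteNormedModule) f u v.
Proof. exact: (RInt_scal (V := R_CompleteNormedModule)). Qed.

Section Normalisation.
Variables b C : R.
Hypothesis b_gt0 : 0 < b.
Hypothesis C_gt0 : 0 < C.

Lemma continuous_Lap_integrand s : continuous (fun s => exp (- pH b C s)) s.
Proof.
apply: (continuous_comp (fun s => - pH b C s) exp); last exact: continuous_exp.
by apply: (continuous_opp (V := R_NormedModule)); exact: continuous_pH.
Qed.

Lemma ex_RInt_Lap u v :
  ex_RInt (V := R_CompleteNormedModule) (fun s => exp (- pH b C s)) u v.
Proof. by apply: ex_RInt_continuous => s _; exact: continuous_Lap_integrand. Qed.

Lemma Lap_Chasles u v : Lap b C v = Lap b C u +
  RInt (V := R_CompleteNormedModule) (fun s => exp (- pH b C s)) u v.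
Proof. symmetry; apply: (RInt_Chasles (V := R_CompleteNormedModule)); exact: ex_RInt_Lap. Qed.

Lemma Lap_le u v : u <= v -> Lap b C u <= Lap b C v.
Proof.
move=> Huv; rewrite (Lap_Chasles u v).
have := RInt_ge_0 _ u v Huv (ex_RInt_Lap u v) (fun s _ => Rlt_le _ _ (exp_pos _)); lra.
Qed.

Lemma Lap_0 : Lap b C 0 = 0.
Proof. exact: (RInt_point (V := R_CompleteNormedModule)). Qed.

Lemma Lap_ge0 u : 0 <= u -> 0 <= Lap b C u.
Proof. by move=> Hu; rewrite -Lap_0; exact: Lap_le. Qed.

Lemma Lap_le_id u : 0 <= u -> Lap b C u <= u.
Proof.
move=> Hu; have E : RInt (fun _ => 1) 0 u = u.
  rewrite (RInt_const (V := R_CompleteNormedModule)) /scal /= /mult /=; ring.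
rewrite -{2}E /Lap; apply: RInt_le => //; first exact: ex_RInt_Lap.
  exact: ex_RInt_const.
move=> s _; rewrite -exp_0.
case: (pH_ge0 b C s) => [H|<-]; last by rewrite Ropp_0; lra.
by apply/Rlt_le/exp_increasing; lra.
Qed.

Lemma pK_exp t : pK b C (exp : R -> R_CompleteNormedModule) t = exp t * Lap b C (pG b C t).
Proof.
rewrite /pK /Lap -RInt_Rmult; last exact: ex_RInt_Lap.
by apply: (RInt_ext (V := R_CompleteNormedModule)) => s _; rewrite -exp_plus.
Qed.

Lemma Lap_le1 t : normalized b C -> Lap b C (pG b C t) <= 1.
Proof.
move=> HN; apply: Rnot_lt_le => Hlt.
have [T HT] := HN ((Lap b C (pG b C t) - 1) / 2) ltac:(lra).
have := HT (Rmax T t) (Rmax_l _ _).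
have : Lap b C (pG b C t) <= Lap b C (pG b C (Rmax T t)).
  by apply: Lap_le; apply: pG_le => //; exact: Rmax_r.
move=> H1 /Rabs_le_between; lra.
Qed.

Lemma Lap_rescale x : Lap b C (C * x) = C * Lap b 1 x.
Proof.
rewrite /Lap.
have := RInt_comp_lin (V := R_CompleteNormedModule) (fun s => exp (- pH b C s)) C 0 0 x
  (ex_RInt_Lap _ _).
rewrite Rmult_0_r !Rplus_0_r => <-.
rewrite RInt_Rmult.
  congr (_ * _); apply: (RInt_ext (V := R_CompleteNormedModule)) => s _.
  rewrite Rplus_0_r /pH; congr (exp (- ppow _ _)); field; lra.
have := ex_RInt_comp_lin (V := R_CompleteNormedModule) (fun s => exp (- pH b C s)) C 0 0 x
  (ex_RInt_Lap _ _).
move=> H; apply: ex_RInt_ext (ex_RInt_scal _ _ _ (/ C) H) => s _.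
rewrite /scal /= /mult /=; field; lra.
Qed.

End Normalisation.

Section NormalisedComposition.
Variables b1 C1 b2 C2 b3 C3 c : R.
Hypothesis b1_gt0 : 0 < b1.
Hypothesis C1_gt0 : 0 < C1.
Hypothesis b2_gt0 : 0 < b2.
Hypothesis C2_gt0 : 0 < C2.
Hypothesis b3_gt0 : 0 < b3.
Hypothesis C3_gt0 : 0 < C3.
Hypothesis N1 : normalized b1 C1.
Hypothesis N2 : normalized b2 C2.
Hypothesis comp : forall t,
  pK b1 C1 (pG b2 C2 : R -> R_CompleteNormedModule) t = c * pG b3 C3 t.

(* The exponential is an approximate eigenfunction with eigenvalue 1 of every
   normalised kernel operator; comparing both sides of the composition rule on
   it as [t -> oo] determines the constant. *)
Lemma comp_const_lim e : 0 < e -> exists T, forall t, T <= t ->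
  1 - e <= c * Lap b3 C3 (pG b3 C3 t) <= 1.
Proof.
move=> He.
(* Two factors [1 - e'] will be multiplied, and [(1 - e')^2 >= 1 - 2 * e']; [e' <= 1] keeps them
   nonnegative. *)
have [e' [He' [He1 Hee]]] : exists e', 0 < e' /\ e' <= 1 /\ 2 * e' <= e.
  exists (Rmin 1 (e / 2)); have := Rmin_l 1 (e / 2); have := Rmin_r 1 (e / 2).
  by have := Rmin_glb_lt 1 (e / 2) 0 ltac:(lra) ltac:(lra); lra.
have [T1 HT1] := N1 e' He'.
have [T2 HT2] := N2 e' He'.
pose T := Rmax 1 (Rmax T1 T2).
have HTa : 1 <= T := Rmax_l _ _.
have HTb : T1 <= T by apply: Rle_trans (Rmax_r _ _); exact: Rmax_l.
have HTc : T2 <= T by apply: Rle_trans (Rmax_r _ _); exact: Rmax_r.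
exists (2 * T) => t Ht.
have Ht0 : 0 <= t / 2 by lra.
pose psi u := pK b2 C2 (exp : R -> R_CompleteNormedModule) u.
have Hpsi u : continuous psi u.
  by apply: (continuous_pK (X := R_CompleteNormedModule)) => //; exact: continuous_exp.
have Hval : pK b1 C1 psi t = c * (exp t * Lap b3 C3 (pG b3 C3 t)).
  rewrite -pK_exp //.
  by apply: (pK_comp_scal (X := R_CompleteNormedModule)) => //; exact: continuous_exp.
have Hex u v : ex_RInt (V := R_CompleteNormedModule) (fun s => psi (t - pH b1 C1 s)) u v.
  exact: (ex_RInt_pK (X := R_CompleteNormedModule)).
have HexpI u v k : ex_RInt (V := R_CompleteNormedModule)
    (fun s => k * exp (t - pH b1 C1 s)) u v.
  apply: (ex_RInt_scal (V := R_CompleteNormedModule)).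
  by apply: (ex_RInt_pK (X := R_CompleteNormedModule)) => // w; exact: continuous_exp.
have Hint x k : RInt (fun s => k * exp (t - pH b1 C1 s)) 0 x = exp t * (k * Lap b1 C1 x).
  have -> : exp t * (k * Lap b1 C1 x) = k * exp t * Lap b1 C1 x by ring.
  rewrite /Lap -RInt_Rmult; last exact: ex_RInt_Lap.
  apply: (RInt_ext (V := R_CompleteNormedModule)) => s _.
  rewrite /scal /= /mult /= /Rminus exp_plus; ring.
have Hpos u : 0 <= psi u.
  rewrite /psi pK_exp //; apply: Rmult_le_pos; first exact/Rlt_le/exp_pos.
  by apply: Lap_ge0 => //; exact: pG_ge0.
have Het := exp_pos t.
have Hup : pK b1 C1 psi t <= exp t * (1 * Lap b1 C1 (pG b1 C1 t)).
  rewrite -Hint; apply: RInt_le => //; first exact: pG_ge0.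
  move=> s _; rewrite /psi pK_exp //.
  have := Lap_le1 b2 C2 b2_gt0 C2_gt0 (t - pH b1 C1 s) N2.
  have := exp_pos (t - pH b1 C1 s); nra.
(* Up to [pG b1 C1 (t / 2)] the argument of [psi] is at least [t / 2 >= T2], where [psi] is at least
   [1 - e'] times the exponential; the remaining part is nonnegative and dropped. *)
have Hlow : exp t * ((1 - e') * Lap b1 C1 (pG b1 C1 (t / 2))) <= pK b1 C1 psi t.
  have Hle : pG b1 C1 (t / 2) <= pG b1 C1 t by apply: pG_le => //; lra.
  rewrite /pK -(RInt_Chasles (V := R_CompleteNormedModule) _ 0 (pG b1 C1 (t / 2))) //.
  apply: Rle_trans (_ : RInt (fun s => psi (t - pH b1 C1 s)) 0 (pG b1 C1 (t / 2)) <= _).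
    rewrite -Hint; apply: RInt_le => //; first exact: pG_ge0.
    move=> s Hs; rewrite /psi pK_exp // Rmult_comm.
    apply: Rmult_le_compat_l; first exact/Rlt_le/exp_pos.
    have Hr := pH_range b1 C1 b1_gt0 C1_gt0 (t / 2) s Ht0 ltac:(lra).
    have := HT2 (t - pH b1 C1 s) ltac:(lra); move/Rabs_le_between; lra.
  rewrite /plus /=.
  have := RInt_ge_0 _ _ _ Hle (Hex _ _) (fun s _ => Hpos _); lra.
have HL1 := Lap_le1 b1 C1 b1_gt0 C1_gt0 t N1.
have /Rabs_le_between HL2 := HT1 (t / 2) ltac:(lra).
rewrite Hval in Hup, Hlow.
set L1 := Lap b1 C1 (pG b1 C1 t) in HL1 Hup.
set L2 := Lap b1 C1 (pG b1 C1 (t / 2)) in HL2 Hlow.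
set L3 := Lap b3 C3 (pG b3 C3 t) in Hup Hlow *.
have Hup' : c * L3 <= 1 * L1 by apply: (Rmult_le_reg_l (exp t)) => //; lra.
have Hlow' : (1 - e') * L2 <= c * L3 by apply: (Rmult_le_reg_l (exp t)) => //; lra.
split; nra.
Qed.

(** The limit relation is read in two directions: a known constant normalises the composite kernel,
    and a normalised composite kernel determines the constant. *)
Lemma comp_normalized : c = 1 -> normalized b3 C3.
Proof.
move=> Hc e He; have [T HT] := comp_const_lim e He.
exists T => t Ht; have := HT t Ht; rewrite Hc => H; apply: Rabs_le; lra.
Qed.

Lemma comp_const : normalized b3 C3 -> c = 1.
Proof.
move=> N3; apply: cond_eq => e He.
(* Then [L >= 3/4] and [c * L] differs from [L] by at most [e / 4], so [c] is within [e / 3] of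
   1. *)
pose e' := Rmin (1 / 4) (e / 8).
have He' : 0 < e' by apply: Rmin_glb_lt; lra.
have He1 : e' <= 1 / 4 := Rmin_l _ _.
have He2 : e' <= e / 8 := Rmin_r _ _.
have [T HT] := comp_const_lim e' He'.
have [T3 HT3] := N3 e' He'.
have := HT (Rmax T T3) (Rmax_l _ _).
have := HT3 (Rmax T T3) (Rmax_r _ _).
set L := Lap _ _ _ => /Rabs_le_between HL Hc.
apply: Rabs_def1; nra.
Qed.

End NormalisedComposition.

(** * Substituted integrals against ordinary and improper ones *)

Lemma pK_1 {X : CompleteNormedModule R_AbsRing} (phi : R -> X) t :
  (forall u, continuous phi u) -> 0 <= t -> pK 1 1 phi t = RInt phi 0 t.
Proof.
move=> Hphi Ht.
have HG s : 0 <= s -> pG 1 1 s = s by move=> Hs; rewrite /pG ppow_1 //; field.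
have HH s : 0 <= s -> pH 1 1 s = s.
  by move=> Hs; rewrite -{1}(HG s) // pH_pG //; lra.
(* The reflection of [[0,t]] as an affine substitution of slope -1: the inner factor is the
   Jacobian, the outer one compensates it. *)
rewrite /pK HG // (RInt_ext _ (fun s => scal (-1) (scal (-1) (phi (-1 * s + t))))).
  have Hex u v : ex_RInt phi u v by apply: ex_RInt_continuous.
  rewrite RInt_scal; last exact: ex_RInt_comp_lin.
  rewrite RInt_comp_lin //.
  have -> : -1 * 0 + t = t by ring.
  have -> : -1 * t + t = 0 by ring.
  rewrite -(opp_RInt_swap _ 0 t) //; vring.
rewrite Rmin_left // => s Hs; rewrite HH; last lra.
have -> : -1 * s + t = t - s by ring.
vring.
Qed.

Lemma is_RInt_gen_intro {X : CompleteNormedModule R_AbsRing} (f : R -> X) Fa Fb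
    {FFa : Filter Fa} {FFb : Filter Fb} (I : R * R -> X) (l : X) :
  filter_prod Fa Fb (fun ab => is_RInt f (fst ab) (snd ab) (I ab)) ->
  filterlim I (filter_prod Fa Fb) (locally l) -> is_RInt_gen f Fa Fb l.
Proof.
move=> H HI P HP.
have HIP : filter_prod Fa Fb (fun ab => P (I ab)) := HI P HP.
apply: (filter_imp _ _ _ (filter_and _ _ H HIP)) => ab [H1 H2].
by exists (I ab).
Qed.

Lemma continuous_Rpower b t : 0 < t -> continuous (fun t => Rpower t b) t.
Proof.
move=> Ht; apply: (@ex_derive_continuous R_AbsRing R_NormedModule).
by eexists; exact: is_derive_Rpower.
Qed.

(** The endpoints stay to the left of [t], where [pG b C (t - s)] is differentiable in [s]; the
    singular endpoint is reached only by a limit. *)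
Lemma pK_subst {X : CompleteNormedModule R_AbsRing} b C (phi : R -> X) t u v :
  0 < b -> 0 < C -> (forall s, continuous phi s) -> 0 < t -> u < t -> v < t ->
  is_RInt (fun s => scal (C * Rpower (t - s) (b - 1)) (phi s)) u v
    (RInt (fun s => phi (t - pH b C s)) (pG b C (t - v)) (pG b C (t - u))).
Proof.
move=> Hb HC Hphi Ht Hu Hv.
have Hx x : Rmin u v <= x <= Rmax u v -> 0 < t - x.
  by have := Rmax_lub_lt u v t Hu Hv; lra.
have Hex a c : ex_RInt (fun s => phi (t - pH b C s)) a c by exact: ex_RInt_pK.
rewrite -(opp_RInt_swap _ _ _ (Hex (pG b C (t - u)) (pG b C (t - v)))).
apply: (is_RInt_ext (fun s => opp (scal (- (C * Rpower (t - s) (b - 1)))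
    (phi (t - pH b C (pG b C (t - s))))))).
  move=> x Hxx; rewrite pH_pG //; last by have := Hx x; lra.
  have -> : t - (t - x) = x by ring.
  vring.
apply: is_RInt_opp.
apply: (is_RInt_comp (fun s => phi (t - pH b C s)) (fun s => pG b C (t - s))).
  by move=> x _; exact: continuous_pK_integrand.
move=> x /Hx Hx0; split.
  have := is_derive_comp (pG b C) (fun s => t - s) x _ (-1) (is_derive_pG b C Hb _ Hx0).
  have -> : scal (-1) (C * Rpower (t - x) (b - 1)) = - (C * Rpower (t - x) (b - 1)).
    by rewrite /scal /= /mult /=; ring.
  by apply; auto_derive => //; ring.
apply: (continuous_opp (V := R_NormedModule)).
apply: (continuous_scal_r (V := R_NormedModule)).
apply: (continuous_comp (fun s => t - s) (fun s => Rpower s (b - 1))).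
  by apply: (continuous_minus (V := R_NormedModule));
    [exact: continuous_const | exact: continuous_id].
exact: continuous_Rpower.
Qed.

Section RIntLimits.
Context {X : CompleteNormedModule R_AbsRing}.

Lemma continuous_RInt_upper (f : R -> X) a t :
  (forall s, continuous f s) -> continuous (fun t => RInt f a t) t.
Proof.
move=> Hf; apply: (@ex_derive_continuous R_AbsRing X); exists (f t).
apply: is_derive_RInt (Hf t); exists (mkposreal _ Rlt_0_1) => y _.
by apply: RInt_correct; apply: ex_RInt_continuous.
Qed.

Lemma filterlim_prod_minus (f g : R -> X) a b Fa Fb
    {FFa : Filter Fa} {FFb : Filter Fb} :
  filter_le Fa (locally a) -> filter_le Fb (locally b) ->
  continuous f a -> continuous g b ->
  filterlim (fun ab => minus (g (snd ab)) (f (fst ab))) (filter_prod Fa Fb)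
    (locally (minus (g b) (f a))).
Proof.
move=> Ha Hb Hf Hg.
have H1 : filterlim (fun ab : R * R => g (snd ab)) (filter_prod Fa Fb) (locally (g b)).
  apply: (filterlim_comp _ _ _ snd g) filterlim_snd _ => P HP; apply: Hb; exact: Hg.
have H2 : filterlim (fun ab : R * R => opp (f (fst ab))) (filter_prod Fa Fb)
    (locally (opp (f a))).
  apply: (filterlim_comp _ _ _ (fun ab => f (fst ab)) opp); last exact: filterlim_opp.
  apply: (filterlim_comp _ _ _ fst f) filterlim_fst _ => P HP; apply: Ha; exact: Hf.
exact: filterlim_comp_2 H1 H2 (filterlim_plus _ _).
Qed.

Lemma filter_le_at_right a : filter_le (at_right a) (locally a).
Proof. exact: filter_le_within. Qed.

Lemma filter_le_at_left a : filter_le (at_left a) (locally a).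
Proof. exact: filter_le_within. Qed.

Lemma at_right_left_prod a b (P : R * R -> Prop) : a < b ->
  (forall u v, a < u < b -> a < v < b -> P (u, v)) ->
  filter_prod (at_right a) (at_left b) P.
Proof.
move=> Hab HP.
apply: (Filter_prod _ _ _ (fun u => a < u < b) (fun v => a < v < b)) => //.
  exists (mkposreal (b - a) (Rlt_Rminus _ _ Hab)) => y /=.
  rewrite /ball /= /AbsRing_ball /abs /minus /plus /opp /= => /Rabs_def2; lra.
exists (mkposreal (b - a) (Rlt_Rminus _ _ Hab)) => y /=.
rewrite /ball /= /AbsRing_ball /abs /minus /plus /opp /= => /Rabs_def2; lra.
Qed.

Lemma Iint_RInt (f : R -> X) t :
  (forall s, continuous f s) -> 0 <= t -> Iint f 0 t = RInt f 0 t.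
Proof.
move=> Hf Ht; rewrite /Iint; case: Rlt_dec => H; last first.
  have -> : t = 0 by lra.
  by rewrite RInt_point.
have Hex u v : ex_RInt f u v by apply: ex_RInt_continuous.
apply (is_RInt_gen_unique (V := X)).
apply: (is_RInt_gen_intro f _ _ (fun ab => minus (RInt f 0 (snd ab)) (RInt f 0 (fst ab)))).
  apply: at_right_left_prod => // u v _ _ /=.
  rewrite -(RInt_Chasles f 0 u v) //.
  have -> : minus (plus (RInt f 0 u) (RInt f u v)) (RInt f 0 u) = RInt f u v by vring.
  exact: RInt_correct.
have -> : RInt f 0 t = minus (RInt f 0 t) (RInt f 0 0) by rewrite RInt_point minus_zero_r.
apply: (filterlim_prod_minus (fun s => RInt f 0 s) (fun s => RInt f 0 s)).
- exact: filter_le_at_right.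
- exact: filter_le_at_left.
- exact: continuous_RInt_upper.
- exact: continuous_RInt_upper.
Qed.

(** Away from [t] this is [pK_subst]; the primitive [J] is continuous up to both endpoints, which
    gives the improper integral. [psi] has to match only on [[0,t]], so [phi] may be a continuous
    extension to the line. *)
Lemma Iint_pK b C (k : R -> R) (phi psi : R -> X) t :
  0 < b -> 0 < C -> (forall s, 0 < s -> k s = C * Rpower s (b - 1)) ->
  (forall s, continuous phi s) -> 0 <= t -> (forall s, 0 <= s <= t -> psi s = phi s) ->
  Iint (fun s => scal (k (t - s)) (psi s)) 0 t = pK b C phi t.
Proof.
move=> Hb HC Hk Hphi Ht Hpsi; rewrite /Iint; case: Rlt_dec => H; last first.
  by rewrite pK_npos //; lra.
have Hex u v : ex_RInt (fun s => phi (t - pH b C s)) u v by exact: ex_RInt_pK.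
pose J u := RInt (fun s => phi (t - pH b C s)) 0 (pG b C (t - u)).
apply (is_RInt_gen_unique (V := X)).
apply: (is_RInt_gen_intro _ _ _ (fun ab => minus (opp (J (snd ab))) (opp (J (fst ab))))).
  apply: at_right_left_prod => // u v Hu Hv /=.
  apply: (is_RInt_ext (fun s => scal (C * Rpower (t - s) (b - 1)) (phi s))).
    move=> x Hx; have := Rmin_glb_lt u v 0; have := Rmax_lub_lt u v t => H1 H2.
    by rewrite Hk ?Hpsi //; lra.
  have -> : minus (opp (J v)) (opp (J u)) =
      RInt (fun s => phi (t - pH b C s)) (pG b C (t - v)) (pG b C (t - u)).
    rewrite /J -(RInt_Chasles _ 0 (pG b C (t - v)) (pG b C (t - u))) //; vring.
  by apply: pK_subst => //; lra.
have HJ u : continuous (fun u => opp (J u)) u.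
  apply: continuous_opp.
  apply: (continuous_comp (fun u => pG b C (t - u))
    (fun v => RInt (fun s => phi (t - pH b C s)) 0 v)).
    apply: (continuous_comp (fun u => t - u) (pG b C)); last exact: continuous_pG.
    by apply: (continuous_minus (V := R_NormedModule));
      [exact: continuous_const | exact: continuous_id].
  by apply: continuous_RInt_upper => s; exact: continuous_pK_integrand.
have -> : pK b C phi t = minus (opp (J t)) (opp (J 0)).
  rewrite /J Rminus_0_r (pG_npos b C (t - t)); last lra.
  by rewrite RInt_point /pK; vring.
apply: (filterlim_prod_minus (fun u => opp (J u)) (fun u => opp (J u))) => //.
- exact: filter_le_at_right.
- exact: filter_le_at_left.
Qed.

End RIntLimits.

Lemma pG_11 t : 0 <= t -> pG 1 1 t = t.
Proof. by move=> Ht; rewrite /pG ppow_1 //; field. Qed.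

Lemma is_derive_opp_exp k t : is_derive (fun s => - (k + s) * exp (- s)) t ((k - 1 + t) * exp (- t)).
Proof. by auto_derive => //; ring. Qed.

Lemma exp_opp_small e : 0 < e -> exists T, forall t, T <= t -> exp (- t) <= e.
Proof.
move=> He; exists (- ln e) => t Ht; rewrite -(exp_ln e) //.
have [H|->] : - t < ln e \/ - t = ln e by lra.
  exact/Rlt_le/exp_increasing.
exact: Rle_refl.
Qed.

Lemma normalized_1 : normalized 1 1.
Proof.
have HL t : 0 <= t -> Lap 1 1 (pG 1 1 t) = 1 - exp (- t).
  move=> Ht; rewrite /Lap pG_11 //.
  apply: (is_RInt_unique (V := R_CompleteNormedModule)).
  have -> : 1 - exp (- t) = minus (- exp (- t)) (- exp (- 0)).
    by rewrite Ropp_0 exp_0 /minus /plus /opp /=; ring.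
  apply: (is_RInt_ext (V := R_CompleteNormedModule) (fun s => exp (- s))).
    move=> s; rewrite Rmin_left // => Hs.
    by rewrite -{2}(pG_11 s) ?pH_pG //; lra.
  apply: (is_RInt_derive (V := R_CompleteNormedModule) (fun s => - exp (- s))) => s _.
    by auto_derive => //; ring.
  apply: (continuous_comp (fun s => - s) exp); last exact: continuous_exp.
  exact: (continuous_opp (V := R_NormedModule)) (continuous_id _).
move=> e He; have [T HT] := exp_opp_small e He.
exists (Rmax 0 T) => t Ht.
have H0 : 0 <= t := Rle_trans _ _ _ (Rmax_l _ _) Ht.
have H1 : T <= t := Rle_trans _ _ _ (Rmax_r _ _) Ht.
rewrite HL //; apply: Rabs_le; have := HT t H1; have := exp_pos (- t); lra.
Qed.

Lemma pK_pG_11 t : pK 1 1 (pG 1 1 : R -> R_CompleteNormedModule) t = 1 * pG 2 1 t.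
Proof.
case: (Rle_dec t 0) => Ht; first by rewrite pK_npos ?pG_npos ?Rmult_0_r //.
have Ht0 : 0 <= t by lra.
rewrite pK_1 //; last by move=> u; apply: continuous_pG; lra.
have -> : 1 * pG 2 1 t = minus (/ 2 * t ^ 2) (/ 2 * 0 ^ 2).
  rewrite /pG ppow_pos; last lra.
  have -> : Rpower t 2 = t ^ 2 by rewrite -Rpower_pow //; lra.
  by rewrite /minus /plus /opp /=; field.
apply: (is_RInt_unique (V := R_CompleteNormedModule)).
apply: (is_RInt_ext (V := R_CompleteNormedModule) (fun s => s)).
  move=> s; rewrite Rmin_left // => Hs.
  by rewrite pG_11 //; lra.
apply: (is_RInt_derive (V := R_CompleteNormedModule) (fun s => / 2 * s ^ 2)) => s _.
  by auto_derive => //; field.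
exact: continuous_id.
Qed.

(** Order 2 is two integrations of order 1 with composition constant 1, so no exponential integral
    of order 2 is evaluated. *)
Lemma normalized_2 : normalized 2 1.
Proof.
by apply: (comp_normalized 1 1 1 1 2 1 1) => //; try lra;
  [exact: normalized_1 | exact: normalized_1 | exact: pK_pG_11].
Qed.

(** * The Gamma function as normalising constant *)

Section Gamma.
Variable b : R.
Hypothesis b_gt0 : 0 < b.
Hypothesis b_le2 : b <= 2.

Lemma Gamma_integrand u v : 0 < u -> 0 < v ->
  is_RInt (V := R_CompleteNormedModule) (fun t => Rpower t (b - 1) * exp (- t)) u v
    (Lap b 1 (pG b 1 v) - Lap b 1 (pG b 1 u)).
Proof.
move=> Hu Hv.
have -> : Lap b 1 (pG b 1 v) - Lap b 1 (pG b 1 u) =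
  RInt (V := R_CompleteNormedModule) (fun s => exp (- pH b 1 s)) (pG b 1 u) (pG b 1 v).
  rewrite (Lap_Chasles b 1 b_gt0 (pG b 1 u) (pG b 1 v)); ring.
have Hx x : Rmin u v <= x <= Rmax u v -> 0 < x.
  by have := Rmin_glb_lt u v 0 Hu Hv; lra.
apply: (is_RInt_ext (V := R_CompleteNormedModule)
   (fun t => scal (1 * Rpower t (b - 1)) (exp (- pH b 1 (pG b 1 t))))).
  move=> x Hxx; rewrite pH_pG //; try lra; last by have := Hx x; lra.
  by rewrite /scal /= /mult /=; ring.
apply: (is_RInt_comp (V := R_CompleteNormedModule) (fun s => exp (- pH b 1 s)) (pG b 1)).
  by move=> x _; exact: continuous_Lap_integrand.
move=> x /Hx Hx0; split; first exact: is_derive_pG.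
apply: (continuous_scal_r (V := R_NormedModule)); exact: continuous_Rpower.
Qed.

(** For [b <= 2] and [t >= 1] one has [t^(b-1) <= t], and [t * exp (- t)] has the primitive
    [- (1 + t) * exp (- t)]: the tail is at most [2 * exp (- 1)]. The part below time 1 is bounded
    with [exp (- s) <= 1]. *)
Lemma Lap_bounded x : 0 <= x -> Lap b 1 x <= pG b 1 1 + 2.
Proof.
move=> Hx.
have [T [_ HT]] := pG_lim b 1 b_gt0 Rlt_0_1 (x + 1) ltac:(lra).
pose t := Rmax T 1.
have Ht1 : 1 <= t := Rmax_r _ _.
have HxG : x <= pG b 1 t by have := HT t (Rmax_l _ _); lra.
apply: Rle_trans (Lap_le b 1 b_gt0 _ _ HxG) _.
have H1 := Lap_le_id b 1 b_gt0 (pG b 1 1) (pG_ge0 b 1 b_gt0 Rlt_0_1 1).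
have HI := Gamma_integrand 1 t Rlt_0_1 ltac:(lra).
have HJ : is_RInt (V := R_CompleteNormedModule) (fun t => (1 - 1 + t) * exp (- t)) 1 t
    (minus (- (1 + t) * exp (- t)) (- (1 + 1) * exp (- 1))).
  apply: (is_RInt_derive (V := R_CompleteNormedModule) (fun s => - (1 + s) * exp (- s))) => s _.
    exact: is_derive_opp_exp.
  apply: (@ex_derive_continuous R_AbsRing R_NormedModule); auto_derive => //.
have HIJ : Lap b 1 (pG b 1 t) - Lap b 1 (pG b 1 1) <=
    minus (- (1 + t) * exp (- t)) (- (1 + 1) * exp (- 1)).
  apply: (is_RInt_le _ _ _ _ _ _ Ht1 HI HJ) => s Hs.
  apply: Rmult_le_compat_r; first exact/Rlt_le/exp_pos.
  have -> : 1 - 1 + s = Rpower s 1 by rewrite Rpower_1; lra.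
  by apply: Rle_Rpower; lra.
have He : exp (- 1) < 1 by rewrite -exp_0; apply: exp_increasing; lra.
move: HIJ; rewrite /minus /plus /opp /=; have := exp_pos (- t); nra.
Qed.

Lemma Lap_limit : exists l, 0 < l /\
  forall e, 0 < e -> exists T, forall t, T <= t -> Rabs (Lap b 1 (pG b 1 t) - l) <= e.
Proof.
pose E y := exists x, 0 <= x /\ y = Lap b 1 x.
have [l [Hub Hlub]] : {l | is_lub E l}.
  apply: completeness.
    by exists (pG b 1 1 + 2) => y [x [Hx ->]]; exact: Lap_bounded.
  by exists (Lap b 1 0), 0; split; [lra | ].
have Hle x : 0 <= x -> Lap b 1 x <= l by move=> Hx; apply: Hub; exists x.
exists l; split.
  apply: Rlt_le_trans (Hle 1 ltac:(lra)).
  apply: (RInt_gt_0 _ 0 1 Rlt_0_1) => x _; first exact: exp_pos.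
  exact: continuous_Lap_integrand.
move=> e He.
have [x [Hx Hxe]] : exists x, 0 <= x /\ l - e < Lap b 1 x.
  apply: NNPP => Hn; have : l <= l - e; last lra.
  apply: Hlub => y [x [Hx ->]]; apply: Rnot_lt_le => Hlt.
  by apply: Hn; exists x.
have [T [_ HT]] := pG_lim b 1 b_gt0 Rlt_0_1 (x + 1) ltac:(lra).
exists T => t Ht; have H1 := HT t Ht.
have H2 := Hle (pG b 1 t) ltac:(lra).
have := Lap_le b 1 b_gt0 x (pG b 1 t) ltac:(lra).
move=> H3; apply: Rabs_le; lra.
Qed.

(** The improper integral is the supremum found in [Lap_limit], since the piece over [(0,u)] is at
    most [pG b 1 u], which tends to 0. Dividing the kernel by it gives mass 1. *)
Lemma Gamma_normalized : 0 < Gamma b /\ normalized b (/ Gamma b).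
Proof.
have [l [Hl Hlim]] := Lap_limit.
have -> : Gamma b = l.
  apply (@is_RInt_gen_unique R_CompleteNormedModule (at_right 0) (Rbar_locally p_infty) _ _
    (fun t => Rpower t (b - 1) * exp (- t)) l).
  apply: (is_RInt_gen_intro (X := R_CompleteNormedModule) _ _ _
    (fun ab => Lap b 1 (pG b 1 (snd ab)) - Lap b 1 (pG b 1 (fst ab)))).
    apply: (Filter_prod _ _ _ (fun u => 0 < u) (fun v => 0 < v)).
    - by exists (mkposreal _ Rlt_0_1) => y _.
    - by exists 0.
    - by move=> u v Hu Hv; exact: Gamma_integrand.
  have HF : Filter (filter_prod (at_right 0) (Rbar_locally p_infty)) by apply: filter_prod_filter.
  apply/(filterlim_normE (X := R_CompleteNormedModule)) => e He.
  have [T HT] := Hlim (e / 4) ltac:(lra).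
  have /(continuous_normE (X := R_CompleteNormedModule)) Hc := continuous_pG b 1 b_gt0 0.
  have [d [Hd Hd']] := Hc (e / 4) ltac:(lra).
  apply: (Filter_prod _ _ _ (fun u => 0 < u < d) (fun v => T < v)).
  - exists (mkposreal d Hd) => y Hy Hy0; split => //.
    by move: Hy; rewrite /ball /= /AbsRing_ball /abs /minus /plus /opp /= => /Rabs_def2; lra.
  - by exists T.
  move=> u v Hu Hv /=.
  have := HT v ltac:(lra).
  have := Hd' u; rewrite (pG_npos b 1 0); last lra.
  rewrite /norm /= /abs /= /minus /plus /opp /= !Ropp_0 !Rplus_0_r Rabs_pos_eq; last lra.
  move=> H1; have {H1} := H1 ltac:(lra).
  have Hg := pG_ge0 b 1 b_gt0 Rlt_0_1 u.
  rewrite Rabs_pos_eq // => H1 /Rabs_le_between H2.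
  have := Lap_le_id b 1 b_gt0 _ Hg; have := Lap_ge0 b 1 b_gt0 _ Hg.
  move=> H3 H4; apply: Rabs_def1; lra.
split => // e He.
have Hl' : 0 < / l by exact: Rinv_0_lt_compat.
have [T HT] := Hlim (e * l) ltac:(nra).
exists T => t Ht.
have -> : pG b (/ l) t = / l * pG b 1 t by rewrite /pG; field; lra.
rewrite Lap_rescale //.
have -> : / l * Lap b 1 (pG b 1 t) - 1 = / l * (Lap b 1 (pG b 1 t) - l) by field; lra.
rewrite Rabs_mult (Rabs_pos_eq (/ l)); last lra.
apply: (Rmult_le_reg_l l) => //; rewrite -Rmult_assoc Rinv_r; last lra.
rewrite Rmult_1_l Rmult_comm; exact: HT.
Qed.

End Gamma.

(** * Semigroup laws of the fractional kernels *)

Section KernelIdentities.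
Context {X : CompleteNormedModule R_AbsRing}.

Lemma pK_semigroup b1 C1 b2 C2 b3 C3 (phi : R -> X) t :
  0 < b1 -> 0 < C1 -> 0 < b2 -> 0 < C2 -> 0 < C3 -> b3 = b1 + b2 ->
  normalized b1 C1 -> normalized b2 C2 -> normalized b3 C3 ->
  (forall u, continuous phi u) -> pK b1 C1 (pK b2 C2 phi) t = pK b3 C3 phi t.
Proof.
move=> Hb1 HC1 Hb2 HC2 HC3 Hb N1 N2 N3 Hphi.
have Hb3 : 0 < b3 by lra.
have [c Hc] := pK_pG_power b1 C1 b2 C2 b3 C3 Hb1 Hb2 Hb3 HC3 Hb.
rewrite (pK_comp_scal b1 C1 b2 C2 b3 C3 _ _ _ _ _ _ c) //.
have -> : c = 1 by apply: (comp_const b1 C1 b2 C2 b3 C3).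
exact: scal_one.
Qed.

(** The order [b1 + b2] may exceed 2, where no normalisation has been proved. Both compositions are
    therefore compared with the same kernel of factor 1: [c * L t] and [d * L t] both tend to 1
    while [L] is increasing and eventually positive, so [c = d]. *)
Lemma pK_comm b1 C1 b2 C2 (phi : R -> X) t :
  0 < b1 -> 0 < C1 -> 0 < b2 -> 0 < C2 ->
  normalized b1 C1 -> normalized b2 C2 -> (forall u, continuous phi u) ->
  pK b1 C1 (pK b2 C2 phi) t = pK b2 C2 (pK b1 C1 phi) t.
Proof.
move=> Hb1 HC1 Hb2 HC2 N1 N2 Hphi.
have Hb3 : 0 < b1 + b2 by lra.
have H1 := Rlt_0_1.
have [c Hc] := pK_pG_power b1 C1 b2 C2 _ 1 Hb1 Hb2 Hb3 H1 eq_refl.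
have [d Hd] := pK_pG_power b2 C2 b1 C1 _ 1 Hb2 Hb1 Hb3 H1 (Rplus_comm _ _).
rewrite (pK_comp_scal b1 C1 b2 C2 (b1 + b2) 1 _ _ _ _ _ _ c) //.
rewrite (pK_comp_scal b2 C2 b1 C1 (b1 + b2) 1 _ _ _ _ _ _ d) //.
have Lc := comp_const_lim b1 C1 b2 C2 _ 1 c Hb1 HC1 Hb2 HC2 Hb3 H1 N1 N2 Hc.
have Ld := comp_const_lim b2 C2 b1 C1 _ 1 d Hb2 HC2 Hb1 HC1 Hb3 H1 N2 N1 Hd.
pose L t := Lap (b1 + b2) 1 (pG (b1 + b2) 1 t).
have L0 s : 0 <= L s by apply: Lap_ge0 => //; exact: pG_ge0.
have [T0 HT0] := Lc (1 / 2) ltac:(lra).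
have HL0 : 0 < L T0.
  have := HT0 T0 (Rle_refl _); rewrite -/(L T0).
  case: (L0 T0) => // <-; lra.
have -> // : c = d.
apply: cond_eq => e He.
have He' : 0 < e * L T0 / 2 by apply: Rdiv_lt_0_compat; [exact: Rmult_lt_0_compat | lra].
have [T1 HT1] := Lc _ He'.
have [T2 HT2] := Ld _ He'.
pose T := Rmax T0 (Rmax T1 T2).
have A0 : T0 <= T := Rmax_l _ _.
have A1 : T1 <= T := Rle_trans _ _ _ (Rmax_l _ _) (Rmax_r _ _).
have A2 : T2 <= T := Rle_trans _ _ _ (Rmax_r _ _) (Rmax_r _ _).
have HL : L T0 <= L T by apply: Lap_le => //; exact: pG_le.
have := HT1 T A1; have := HT2 T A2; rewrite -/(L T) => B1 B2.
apply: Rabs_def1; apply: (Rmult_lt_reg_r (L T)); nra.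
Qed.

Variable a : R.
Hypothesis a_bd : 1 < a < 2.

Lemma Gamma_inv_gt0 b : 0 < b <= 2 -> 0 < / Gamma b.
Proof. by move=> Hb; apply: Rinv_0_lt_compat; apply Gamma_normalized; lra. Qed.

Lemma pK_int_frac (phi : R -> X) t : (forall u, continuous phi u) ->
  pK 1 1 (pK (a - 1) (/ Gamma (a - 1)) phi) t = pK a (/ Gamma a) phi t.
Proof.
move=> Hphi; apply: pK_semigroup => //; try (apply: Gamma_inv_gt0; lra); try lra.
- exact: normalized_1.
- by apply Gamma_normalized; lra.
- by apply Gamma_normalized; lra.
Qed.

Lemma pK_frac_int (phi : R -> X) t : (forall u, continuous phi u) ->
  pK 1 1 (pK a (/ Gamma a) phi) t = pK a (/ Gamma a) (pK 1 1 phi) t.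
Proof.
move=> Hphi; apply: pK_comm => //; try (apply: Gamma_inv_gt0; lra); try lra.
- exact: normalized_1.
- by apply Gamma_normalized; lra.
Qed.

(** This evaluates the Caputo derivative: convolving [g_a * phi] with [g_(2-a)] yields the second
    primitive of [phi]. *)
Lemma pK_complement (phi : R -> X) t : (forall u, continuous phi u) ->
  pK (2 - a) (/ Gamma (2 - a)) (pK a (/ Gamma a) phi) t = pK 1 1 (pK 1 1 phi) t.
Proof.
move=> Hphi.
transitivity (pK 2 1 phi t).
  apply: pK_semigroup => //; try (apply: Gamma_inv_gt0; lra); try lra.
  - by apply Gamma_normalized; lra.
  - by apply Gamma_normalized; lra.
  - exact: normalized_2.
symmetry; apply: pK_semigroup => //; try lra;
  by [exact: normalized_1 | exact: normalized_2].
Qed.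

End KernelIdentities.

(** * Uniform boundedness *)

Section UniformBoundedness.
Context {X : CompleteNormedModule R_AbsRing}.

Lemma cauchy_seq_lim (u : nat -> X) :
  (forall e, 0 < e -> exists N, forall n m, (N <= n)%nat -> (N <= m)%nat ->
     norm (minus (u n) (u m)) <= e) ->
  exists l, forall e, 0 < e -> exists N, forall n, (N <= n)%nat -> norm (minus l (u n)) <= e.
Proof.
move=> H.
have [l Hl] : exists l : X, filterlim u eventually (locally l).
  apply (filterlim_locally_cauchy (U := X) (F := eventually)) => e.
  have [N HN] := H (e / 2) ltac:(have := cond_pos e; lra).
  exists (fun n => (N <= n)%nat); split; first by exists N.
  move=> n m Hn Hm; apply: norm_compat1.
  apply: Rle_lt_trans (HN m n Hm Hn) _; have := cond_pos e; lra.
exists l => e He.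
move/filterlim_normE: Hl => /(_ e He) [N HN].
by exists N => n Hn; rewrite norm_minus_sym; apply: Rlt_le; exact: HN.
Qed.

Lemma uniform_cauchy_lim {U : Type} (P : U -> Prop) (u : nat -> U -> X) :
  (forall e, 0 < e -> exists N, forall n m, (N <= n)%nat -> (N <= m)%nat ->
     forall t, P t -> norm (minus (u n t) (u m t)) <= e) ->
  exists z : U -> X, forall e, 0 < e -> exists N, forall n, (N <= n)%nat ->
    forall t, P t -> norm (minus (z t) (u n t)) <= e.
Proof.
move=> H.
have Hl t : exists l, P t -> forall e, 0 < e -> exists N, forall n, (N <= n)%nat ->
    norm (minus l (u n t)) <= e.
  case: (classic (P t)) => HP; last by exists zero.
  have [|l Hl] := cauchy_seq_lim (fun n => u n t); last by exists l.
  move=> e He; have [N HN] := H e He; exists N => n m Hn Hm; exact: HN.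
pose z t := proj1_sig (constructive_indefinite_description _ (Hl t)).
have Hz t : P t -> forall e, 0 < e -> exists N, forall n, (N <= n)%nat ->
    norm (minus (z t) (u n t)) <= e.
  exact: proj2_sig (constructive_indefinite_description _ (Hl t)).
exists z => e He; have [N HN] := H (e / 2) ltac:(lra).
exists N => n Hn t HP.
have [N' HN'] := Hz t HP (e / 2) ltac:(lra).
have := norm_minus_trans (z t) (u (Nat.max N N') t) (u n t).
have := HN' (Nat.max N N') ltac:(lia).
have := HN (Nat.max N N') n ltac:(lia) Hn t HP; lra.
Qed.

Definition cont (f : R -> X) : Prop := forall u, continuous f u.

Variable J : Type.
Variable T : J -> (R -> X) -> X.
Hypothesis Tplus : forall j f g, cont f -> cont g ->
  T j (fun s => plus (f s) (g s)) = plus (T j f) (T j g).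
Hypothesis Tscal : forall j (k : R) f, cont f -> T j (fun s => scal k (f s)) = scal k (T j f).
Hypothesis Tbounded : forall j, exists M, forall f, cont f ->
  (forall s, norm (f s) <= 1) -> norm (T j f) <= M.
Hypothesis Tpointwise : forall f, cont f -> exists M, forall j, norm (T j f) <= M.

Lemma operator_bound_scal j N f B :
  (forall f, cont f -> (forall s, norm (f s) <= 1) -> norm (T j f) <= N) ->
  cont f -> 0 < B -> (forall s, norm (f s) <= B) -> norm (T j f) <= B * N.
Proof.
move=> HN Hf HB Hfb.
have E : T j f = scal B (T j (fun s => scal (/ B) (f s))).
  by rewrite Tscal //; vring; lra.
rewrite E; apply: Rle_trans (norm_scal_le _ _) _.
rewrite Rabs_pos_eq; last lra.
apply: Rmult_le_compat_l; first lra.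
apply: HN => s; first by apply: continuous_scal_r.
apply: Rle_trans (norm_scal_le _ _) _.
rewrite Rabs_pos_eq; last by apply/Rlt_le/Rinv_0_lt_compat.
apply: (Rmult_le_reg_l B) => //; rewrite -Rmult_assoc Rinv_r ?Rmult_1_l ?Rmult_1_r //; lra.
Qed.

Lemma almost_norming j M : 0 <= M ->
  ~ (forall f, cont f -> (forall s, norm (f s) <= 1) -> norm (T j f) <= M) ->
  exists N y, M <= N /\ 0 < N /\
    (forall f, cont f -> (forall s, norm (f s) <= 1) -> norm (T j f) <= N) /\
    cont y /\ (forall s, norm (y s) <= 1) /\ 3 / 4 * N <= norm (T j y).
Proof.
move=> HM Hnot.
pose E v := exists f, cont f /\ (forall s, norm (f s) <= 1) /\ v = norm (T j f).
have [N [Hub Hlub]] : {N | is_lub E N}.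
  apply: completeness.
    have [M' HM'] := Tbounded j.
    by exists M' => v [f [Hf [Hf1 ->]]]; exact: HM'.
  exists (norm (T j (fun _ => zero))), (fun _ => zero).
  by split; [move=> u; exact: continuous_const | split => // s; rewrite norm_zero; lra].
have HN f : cont f -> (forall s, norm (f s) <= 1) -> norm (T j f) <= N.
  by move=> Hf Hf1; apply: Hub; exists f.
have HMN : M < N.
  apply: Rnot_le_lt => H; apply: Hnot => f Hf Hf1.
  by have := HN f Hf Hf1; lra.
have [y [Hy [Hy1 Hy2]]] : exists y, cont y /\ (forall s, norm (y s) <= 1) /\
    3 / 4 * N <= norm (T j y).
  apply: NNPP => Hn.
  have : N <= 3 / 4 * N; last lra.
  apply: Hlub => v [f [Hf [Hf1 ->]]]; apply: Rnot_lt_le => Hlt.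
  by apply: Hn; exists f; split => //; split => //; lra.
by exists N, y; do !split => //; lra.
Qed.

(* Sokal's gliding hump: perturb by [(/3)^k] times an almost norming vector of
   the k-th operator, with the sign that makes the value large. *)
Lemma uniform_boundedness : exists M, forall j f, cont f ->
  (forall s, norm (f s) <= 1) -> norm (T j f) <= M.
Proof.
apply: NNPP => Hnot.
pose q k := (/ 3) ^ k.
have q_gt0 k : 0 < q k by apply: pow_lt; lra.
have qS k : q (S k) = q k / 3 by rewrite /q /=; field.
(* At the limit point the k-th operator has norm at least [3/4 - 1/2] times [q (S k) * N]: [3/4]
   from almost norming, [1/2] lost to the later perturbations. That quarter is made at least [k]. *)
have Hchoice k : exists p : J * R * (R -> X), INR k <= q (S k) * snd (fst p) / 4 /\
    0 < snd (fst p) /\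
    (forall f, cont f -> (forall s, norm (f s) <= 1) ->
       norm (T (fst (fst p)) f) <= snd (fst p)) /\
    cont (snd p) /\ (forall s, norm (snd p s) <= 1) /\
    3 / 4 * snd (fst p) <= norm (T (fst (fst p)) (snd p)).
  pose M := 4 * INR k / q (S k).
  have HM : 0 <= M.
    by apply: Rdiv_le_0_compat => //; have := pos_INR k; lra.
  have [j Hj] : exists j, ~ (forall f, cont f -> (forall s, norm (f s) <= 1) ->
      norm (T j f) <= M).
    apply: not_all_ex_not => H; apply: Hnot; exists M => j f; exact: H.
  have [N [y [HMN H]]] := almost_norming j M HM Hj.
  exists (j, N, y); split => //=.
  have -> : INR k = q (S k) * M / 4.
    rewrite /M; field; exact/not_eq_sym/Rlt_not_eq.
  have := q_gt0 (S k); nra.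
pose p k := proj1_sig (constructive_indefinite_description _ (Hchoice k)).
pose j k := fst (fst (p k)); pose N k := snd (fst (p k)); pose y k := snd (p k).
have Hp k : INR k <= q (S k) * N k / 4 /\ 0 < N k /\
    (forall f, cont f -> (forall s, norm (f s) <= 1) -> norm (T (j k) f) <= N k) /\
    cont (y k) /\ (forall s, norm (y k s) <= 1) /\ 3 / 4 * N k <= norm (T (j k) (y k)).
  exact: proj2_sig (constructive_indefinite_description _ (Hchoice k)).
pose step k x : R -> X :=
  let x' := fun s => plus (x s) (scal (q (S k)) (y k s)) in
  if Rle_dec (q (S k) * norm (T (j k) (y k))) (norm (T (j k) x')) then x'
  else fun s => plus (x s) (scal (- q (S k)) (y k s)).
pose fix x k : R -> X := match k with O => fun _ => zero | S k => step k (x k) end.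
have Hy k := proj1 (proj2 (proj2 (proj2 (Hp k)))).
have Hxc k : cont (x k).
  elim: k => [|k IH] /=; first by move=> u; exact: continuous_const.
  rewrite /step; case: Rle_dec => _ u; apply: continuous_plus; try exact: IH;
    by apply: continuous_scal_r; exact: Hy.
(* The two candidate values differ by [2 * q (S k)] times [T (j k) (y k)], so they cannot both be
   shorter than half of that. *)
have Hbig k : q (S k) * norm (T (j k) (y k)) <= norm (T (j k) (x (S k))).
  rewrite /= /step; case: Rle_dec => // /Rnot_le_lt.
  have Hys c : cont (fun s => scal c (y k s)) by move=> u; apply: continuous_scal_r; exact: Hy.
  rewrite !Tplus // !Tscal //; set v := T _ (x k); set w := T _ (y k) => Hlt.
  have E : scal (2 * q (S k)) w =
    minus (plus v (scal (q (S k)) w)) (plus v (scal (- q (S k)) w)) by vring.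
  have H1 := norm_minus_le (plus v (scal (q (S k)) w)) (plus v (scal (- q (S k)) w)).
  rewrite -E norm_scal_eq Rabs_pos_eq in H1; last by have := q_gt0 (S k); lra.
  lra.
have Hstep k s : norm (minus (x (S k) s) (x k s)) <= q (S k).
  have Hy1 : norm (y k s) <= 1 by apply Hp.
  have Hq := q_gt0 (S k).
  rewrite [x (S k)]/= /step; case: Rle_dec => _.
    have -> : minus (plus (x k s) (scal (q (S k)) (y k s))) (x k s) =
      scal (q (S k)) (y k s) by vring.
    apply: Rle_trans (norm_scal_le _ _) _; rewrite Rabs_pos_eq; nra.
  have -> : minus (plus (x k s) (scal (- q (S k)) (y k s))) (x k s) =
    scal (- q (S k)) (y k s) by vring.
  apply: Rle_trans (norm_scal_le _ _) _; rewrite Rabs_Ropp Rabs_pos_eq; nra.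
(* The geometric series: the powers of [/ 3] with exponents [k+1] to [k+m] add up to the right
   side. *)
have Hdist k m s : norm (minus (x (k + m)%nat s) (x k s)) <= (q k - q (k + m)%nat) / 2.
  elim: m => [|m IH].
    by rewrite Nat.add_0_r minus_eq_zero norm_zero; lra.
  rewrite Nat.add_succ_r.
  have := norm_minus_trans (x (S (k + m)) s) (x (k + m)%nat s) (x k s).
  have := Hstep (k + m)%nat s; rewrite qS; lra.
have Hq0 e : 0 < e -> exists K, forall k, (K <= k)%nat -> q k <= e.
  move=> He; have [K HK] := pow_lt_1_zero (/ 3) ltac:(rewrite Rabs_pos_eq; lra) e He.
  exists K => k Hk; have := HK k Hk; rewrite Rabs_pos_eq; [rewrite /q; lra|].
  exact/Rlt_le/q_gt0.
have Hdist' k m s : (k <= m)%nat -> norm (minus (x m s) (x k s)) <= q k / 2.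
  move=> Hkm; have -> : m = (k + (m - k))%nat by lia.
  by have := Hdist k (m - k)%nat s; have := q_gt0 (k + (m - k))%nat; lra.
have [z Hz] : exists z : R -> X, forall e, 0 < e -> exists K, forall n, (K <= n)%nat ->
    forall t, True -> norm (minus (z t) (x n t)) <= e.
  apply: uniform_cauchy_lim => e He; have [K HK] := Hq0 e He.
  exists K => n m Hn Hm t _.
  have := norm_minus_trans (x n t) (x K t) (x m t).
  rewrite (norm_minus_sym (x K t)).
  have := Hdist' K n t Hn; have := Hdist' K m t Hm; have := HK K (le_n K); lra.
have Hzc : cont z.
  move=> u; apply: continuous_approx => e He.
  have [K HK] := Hz e He.
  by exists (x K), 1; split; [lra | split => [|s _]; [exact: Hxc | exact: HK]].
have Hzx k s : norm (minus (z s) (x k s)) <= q k / 2.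
  apply: Rnot_lt_le => Hlt.
  have [K HK] := Hz ((norm (minus (z s) (x k s)) - q k / 2) / 2) ltac:(lra).
  have := HK (Nat.max K k) ltac:(lia) s I.
  have := Hdist' k (Nat.max K k) s ltac:(lia).
  have := norm_minus_trans (z s) (x (Nat.max K k) s) (x k s); lra.
have [M HM] := Tpointwise z Hzc.
have [k Hk] := INR_unbounded M.
have [Hk1 [HN [HNb [_ [_ Hk2]]]]] := Hp k.
have Hd : T (j k) (fun s => minus (z s) (x (S k) s)) =
    plus (T (j k) z) (scal (-1) (T (j k) (x (S k)))).
  rewrite -Tscal // -Tplus //.
    congr T; apply: functional_extensionality => s; vring.
  by move=> u; apply: continuous_scal_r; exact: Hxc.
have H1 : norm (T (j k) (fun s => minus (z s) (x (S k) s))) <= q (S k) / 2 * N k.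
  apply: operator_bound_scal => //.
  - by move=> u; apply: continuous_minus; [exact: Hzc | exact: Hxc].
  - by have := q_gt0 (S k); lra.
have H2 := Hbig k.
have H3 := HM (j k).
have H4 := norm_le_minus (T (j k) (x (S k))) (T (j k) z).
rewrite norm_minus_sym in H4.
have E : minus (T (j k) z) (T (j k) (x (S k))) =
  plus (T (j k) z) (scal (-1) (T (j k) (x (S k)))) by vring.
rewrite E -Hd in H4.
have Hq := q_gt0 (S k).
have H5 : q (S k) * (3 / 4 * N k) <= q (S k) * norm (T (j k) (y k)).
  by apply: Rmult_le_compat_l => //; lra.
lra.
Qed.

End UniformBoundedness.

(** * Closed operators *)

(** The 1-Lipschitz retraction onto [[0,r]]; composing with it turns continuity on the interval into
    continuity on the line. *)
Definition clamp (r s : R) : R := Rmax 0 (Rmin r s).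

Lemma clamp_range r s : 0 <= r -> 0 <= clamp r s <= r.
Proof.
move=> Hr; split; first exact: Rmax_l.
by apply: Rmax_lub => //; exact: Rmin_l.
Qed.

Lemma clamp_id r s : 0 <= s <= r -> clamp r s = s.
Proof. by move=> Hs; rewrite /clamp Rmin_right ?Rmax_right; lra. Qed.

Lemma clamp_npos r s : 0 <= r -> s <= 0 -> clamp r s = 0.
Proof. by move=> Hr Hs; rewrite /clamp Rmin_right ?Rmax_left; lra. Qed.

Lemma clamp_lipschitz r s t : Rabs (clamp r s - clamp r t) <= Rabs (s - t).
Proof.
rewrite /clamp /Rmax /Rmin.
do !case: Rle_dec; move=> *; split_Rabs; lra.
Qed.

Section Clamp.
Context {X : CompleteNormedModule R_AbsRing}.

Lemma cont_clamp r (f : R -> X) : 0 <= r ->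
  cont_on 0 r f -> cont (fun s => f (clamp r s)).
Proof.
move=> Hr Hf t; apply: (filterlim_comp _ _ _ (clamp r) f) (Hf _ (clamp_range r t Hr)).
move=> P [d Hd]; exists d => s Hs; apply: Hd; last exact: clamp_range.
apply: Rle_lt_trans (clamp_lipschitz r s t) _; exact: Hs.
Qed.

Lemma cont_on_ext r (f g : R -> X) :
  cont f -> (forall s, 0 <= s <= r -> g s = f s) -> cont_on 0 r g.
Proof.
move=> Hf Hfg t Ht; rewrite Hfg //.
apply: (filterlim_within_ext (fun s => 0 <= s <= r) f g); first by move=> s Hs; rewrite Hfg.
by apply: filterlim_filter_le_1 (Hf t); exact: filter_le_within.
Qed.

Lemma cont_comp_minus (f : R -> X) (a : R) : cont f -> cont (fun s => f (a - s)).
Proof.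
move=> Hf s; apply: (continuous_comp (fun s => a - s) f) (Hf _).
by apply: (continuous_minus (V := R_NormedModule));
  [exact: continuous_const | exact: continuous_id].
Qed.

Lemma cont_comp_shift (f : R -> X) (a : R) : cont f -> cont (fun s => f (s - a)).
Proof.
move=> Hf s; apply: (continuous_comp (fun s => s - a) f) (Hf _).
by apply: (continuous_minus (V := R_NormedModule));
  [exact: continuous_id | exact: continuous_const].
Qed.

Lemma cont_bounded (f : R -> X) r : 0 <= r -> cont f ->
  exists M, forall s, 0 <= s <= r -> norm (f s) <= M.
Proof.
move=> Hr Hf.
have [m [Hm _]] := continuity_ab_maj (fun s => norm (f s)) 0 r Hr
  (fun c _ => proj2 (continuity_pt_filterlim _ c)
     (filterlim_comp _ _ _ f norm _ _ _ (Hf c) (filterlim_norm _))).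
by exists (norm (f m)).
Qed.

Lemma continuous_joint (g : R -> X -> X) (a : R -> R) (f : R -> X) :
  (forall z, cont (fun s => g s z)) ->
  (forall s y z, g s (minus y z) = minus (g s y) (g s z)) ->
  (forall T, exists B, 0 <= B /\ forall s z, s <= T -> norm (g s z) <= B * norm z) ->
  (forall s, continuous a s) -> cont f -> cont (fun s => g (a s) (f s)).
Proof.
move=> Hg Hadd Hbd Ha Hf t; apply: continuous_approx => e He.
have [B [HB0 HB]] := Hbd (a t + 1).
have Hat : continuous (fun s => g (a s) (f t)) t.
  exact: (continuous_comp a (fun u => g u (f t)) t (Ha t) (Hg _ _)).
have /(continuous_normE (X := R_CompleteNormedModule)) Ha1 := Ha t.
have [d1 [Hd1 Ha2]] := Ha1 1 Rlt_0_1.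
have /continuous_normE Hf1 := Hf t.
have He' : 0 < e / (B + 1) by apply: Rdiv_lt_0_compat; lra.
have [d2 [Hd2 Hf2]] := Hf1 _ He'.
exists (fun s => g (a s) (f t)), (Rmin d1 d2); split; first exact: Rmin_glb_lt.
split => // s Hs.
have Hs1 : Rabs (s - t) < d1 by apply: Rlt_le_trans Hs (Rmin_l _ _).
have Hs2 : Rabs (s - t) < d2 by apply: Rlt_le_trans Hs (Rmin_r _ _).
rewrite -Hadd.
have Has : a s <= a t + 1.
  have := Ha2 s Hs1; rewrite /norm /= /abs /= /minus /plus /opp /= => /Rabs_def2; lra.
apply: Rle_trans (HB _ _ Has) _.
have := Hf2 s Hs2 => H2.
apply: Rle_trans (_ : B * (e / (B + 1)) <= _); first by apply: Rmult_le_compat_l => //; lra.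
have -> : B * (e / (B + 1)) = e - e / (B + 1) by field; lra.
lra.
Qed.

Lemma pK_1_causal (phi : R -> X) t : cont phi -> (forall s, s <= 0 -> phi s = zero) ->
  pK 1 1 phi t = RInt phi 0 t.
Proof.
move=> Hphi H0; case: (Rle_dec 0 t) => Ht; first exact: pK_1.
rewrite pK_npos; last lra.
rewrite (RInt_ext phi (fun _ => zero)); first by rewrite RInt_const scal_zero_r.
by move=> s; rewrite Rmax_left; [move=> Hs; apply: H0; lra | lra].
Qed.

Lemma is_derive_RInt_cont (phi : R -> X) a t : cont phi ->
  is_derive (fun t => RInt phi a t) t (phi t).
Proof.
move=> Hphi; apply: is_derive_RInt (Hphi t); exists (mkposreal _ Rlt_0_1) => y _.
by apply: RInt_correct; apply: ex_RInt_continuous.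
Qed.

Lemma is_derive_pK_1 (phi : R -> X) t : cont phi -> (forall s, s <= 0 -> phi s = zero) ->
  is_derive (pK 1 1 phi) t (phi t).
Proof.
move=> Hphi H0; apply: (is_derive_ext (fun t => RInt phi 0 t)).
  by move=> s; rewrite pK_1_causal.
exact: is_derive_RInt_cont.
Qed.

Lemma RInt_pK_1 (phi : R -> X) t u v : cont phi -> (forall s, s <= 0 -> phi s = zero) ->
  RInt (fun s => phi (t - s)) u v = minus (pK 1 1 phi (t - u)) (pK 1 1 phi (t - v)).
Proof.
move=> Hphi H0; apply: is_RInt_unique.
have -> : minus (pK 1 1 phi (t - u)) (pK 1 1 phi (t - v)) =
  minus (opp (pK 1 1 phi (t - v))) (opp (pK 1 1 phi (t - u))) by vring.
apply: (is_RInt_derive (fun s => opp (pK 1 1 phi (t - s)))) => s _.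
  have -> : phi (t - s) = opp (scal (-1) (phi (t - s))) by vring.
  apply: is_derive_opp; apply: (is_derive_comp (pK 1 1 phi)).
    exact: is_derive_pK_1.
  by auto_derive => //; ring.
exact: cont_comp_minus.
Qed.

End Clamp.

Section ClosedOp.
Context {X : CompleteNormedModule R_AbsRing}.
Variables (D : X -> Prop) (A : X -> X).
Hypothesis HA : closed_dense_op D A.

Lemma op_zero : A zero = zero.
Proof.
have := op_scal D A HA 0 zero (op_dom_zero D A HA).
have E (x : X) : scal 0 x = zero by exact: scal_zero_l.
by rewrite !E.
Qed.

Lemma op_minus x y : D x -> D y -> D (minus x y) /\ A (minus x y) = minus (A x) (A y).
Proof.
move=> Hx Hy.
have E (u v : X) : minus u v = plus u (scal (-1) v) by vring.
have Hy' := op_dom_scal D A HA (-1) y Hy.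
rewrite !E; split; first exact: (op_dom_plus D A HA).
by rewrite (op_plus D A HA) // (op_scal D A HA).
Qed.

Lemma op_vsum (u : nat -> X) n : (forall i, (i < n)%nat -> D (u i)) ->
  D (vsum u n) /\ A (vsum u n) = vsum (fun i => A (u i)) n.
Proof.
elim: n => [|n IH] Hu /=; first by split; [exact: op_dom_zero HA | exact: op_zero].
have [H1 H2] : D (vsum u n) /\ A (vsum u n) = vsum (fun i => A (u i)) n.
  by apply: IH => i Hi; apply: Hu; lia.
have Hn : D (u n) by apply: Hu; lia.
split; first exact: (op_dom_plus D A HA).
by rewrite (op_plus D A HA) // H2.
Qed.

Lemma op_closed_norm (u : nat -> X) (x y : X) : (forall n, D (u n)) ->
  (forall e, 0 < e -> exists N, forall n, (N <= n)%nat -> norm (minus x (u n)) <= e) ->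
  (forall e, 0 < e -> exists N, forall n, (N <= n)%nat -> norm (minus y (A (u n))) <= e) ->
  D x /\ A x = y.
Proof.
have Hlim (v : nat -> X) l :
    (forall e, 0 < e -> exists N, forall n, (N <= n)%nat -> norm (minus l (v n)) <= e) ->
    filterlim v eventually (locally l).
  move=> H; apply/filterlim_normE => e He.
  have [N HN] := H (e / 2) ltac:(lra).
  by exists N => n Hn; rewrite norm_minus_sym; have := HN n Hn; lra.
by move=> HD Hx Hy; apply: (op_closed D A HA u) => //; exact: Hlim.
Qed.

Lemma op_Stsum (g h : R -> X -> X) f T n t :
  (forall i j, (i <= n)%nat -> (j <= n)%nat ->
    D (g (t - pt T n i) (f (pt T n j))) /\
    A (g (t - pt T n i) (f (pt T n j))) = h (t - pt T n i) (f (pt T n j))) ->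
  D (Stsum g f T n t) /\ A (Stsum g f T n t) = Stsum h f T n t.
Proof.
move=> H.
have Hi i : (i < n)%nat ->
    D (minus (g (t - pt T n i) (f (pt T n i))) (g (t - pt T n (S i)) (f (pt T n i)))) /\
    A (minus (g (t - pt T n i) (f (pt T n i))) (g (t - pt T n (S i)) (f (pt T n i)))) =
    minus (h (t - pt T n i) (f (pt T n i))) (h (t - pt T n (S i)) (f (pt T n i))).
  move=> Hi; have [H1 H2] := H i i ltac:(lia) ltac:(lia).
  have [H3 H4] := H (S i) i ltac:(lia) ltac:(lia).
  by rewrite -H2 -H4; exact: op_minus.
have [H1 H2] := op_vsum _ n (fun i Hin => proj1 (Hi i Hin)).
split => //; rewrite /Stsum H2; apply: vsum_ext => i Hin.
exact: (proj2 (Hi i Hin)).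
Qed.

(** A form of Hille's theorem: [A] acts on Stieltjes sums term by term, the sums converge before and
    after applying it, and closedness concludes. *)
Lemma pK_op b C (phi : R -> X) t : 0 < b -> 0 < C -> cont phi ->
  (forall s, D (phi s)) -> cont (fun s => A (phi s)) ->
  D (pK b C phi t) /\ A (pK b C phi t) = pK b C (fun s => A (phi s)) t.
Proof.
move=> Hb HC Hphi HD HAphi.
case: (Rle_dec t 0) => Ht.
  by rewrite !pK_npos //; split; [exact: op_dom_zero HA | exact: op_zero].
have Ht0 : 0 <= t by lra.
have HS n : D (Stsum (pGs b C) phi t n t) /\
    A (Stsum (pGs b C) phi t n t) = Stsum (pGs b C) (fun s => A (phi s)) t n t.
  have [|H1 H2] := op_Stsum (fun a z => scal (pG b C a) z) (fun a z => scal (pG b C a) (A z))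
    phi t n t; last by split.
  by move=> i j _ _; split; [exact: (op_dom_scal D A HA) | exact: (op_scal D A HA)].
have Hlim (psi : R -> X) : cont psi -> forall e, 0 < e -> exists N, forall n, (N <= n)%nat ->
    norm (minus (pK b C psi t) (Stsum (pGs b C) psi t n t)) <= e.
  move=> Hpsi e He.
  have HG := pG_ge0 b C Hb HC t.
  have He' : 0 < e / (pG b C t + 1) by apply: Rdiv_lt_0_compat; lra.
  have [N [_ HN]] := pK_Stsum b C Hb HC psi t _ Hpsi Ht0 He'.
  exists N => n Hn; apply: Rle_trans (HN n Hn t (Rle_refl _)) _.
  have -> : e / (pG b C t + 1) * pG b C t = e - e / (pG b C t + 1) by field; lra.
  lra.
apply: (op_closed_norm (fun n => Stsum (pGs b C) phi t n t)).
- by move=> n; apply HS.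
- exact: Hlim.
- move=> e He; have [N HN] := Hlim _ HAphi e He.
  by exists N => n Hn; rewrite (proj2 (HS n)); exact: HN.
Qed.

End ClosedOp.

(** * Differentiation and semivariation *)

Section Differentiation.
Context {X : CompleteNormedModule R_AbsRing}.

Lemma is_derive_expand (F : R -> X) t l : is_derive F t l ->
  forall e, 0 < e -> exists d, 0 < d /\ forall h, Rabs h < d ->
    norm (minus (minus (F (t + h)) (F t)) (scal h l)) <= e * Rabs h.
Proof.
move=> [_ H] e He.
have [d Hd] := H t (fun P HP => HP) (mkposreal e He).
exists d; split; first exact: cond_pos.
move=> h Hh; have E : minus (t + h) t = h by rewrite /minus /plus /opp /=; ring.
have Hb : ball t d (t + h).
  by change (Rabs (minus (t + h) t) < d); rewrite E.
by have := Hd _ Hb; rewrite E.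
Qed.

(** Passes from the two-sided derivative of an extension to difference quotients inside [[0,r]],
    which are one-sided at the ends. *)
Lemma deriv_on_ext r (F F' g : R -> X) :
  (forall t, 0 <= t <= r -> is_derive F t (F' t)) ->
  (forall t, 0 <= t <= r -> g t = F t) -> deriv_on 0 r g F'.
Proof.
move=> HF Hg t Ht; apply/filterlim_normE => e He.
have [d [Hd Hd']] := is_derive_expand F t _ (HF t Ht) (e / 2) ltac:(lra).
exists (mkposreal d Hd) => h Hh [Hh0 Hth].
have Hh' : Rabs h < d by move: Hh; rewrite /ball /= /AbsRing_ball /abs /minus /plus /opp /= Ropp_0 Rplus_0_r.
rewrite !Hg //.
have -> : minus (scal (/ h) (minus (F (t + h)) (F t))) (F' t) =
    scal (/ h) (minus (minus (F (t + h)) (F t)) (scal h (F' t))) by vring.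
rewrite norm_scal_eq Rabs_inv.
have Hp := Rabs_pos_lt h Hh0.
have := Hd' h Hh' => H1.
apply: Rle_lt_trans (_ : / Rabs h * (e / 2 * Rabs h) < e).
  by apply: Rmult_le_compat_l H1; exact/Rlt_le/Rinv_0_lt_compat.
have -> : / Rabs h * (e / 2 * Rabs h) = e / 2 by field; lra.
lra.
Qed.

Lemma norm_le_limit (F : R -> X) C : continuous F 0 ->
  (forall h, 0 < h < 1 -> norm (F h) <= C) -> norm (F 0) <= C.
Proof.
move=> /continuous_normE HF HC; apply: Rnot_lt_le => Hlt.
have [d [Hd Hd']] := HF (norm (F 0) - C) ltac:(lra).
pose h := Rmin (d / 2) (1 / 2).
have Hh0 : 0 < h by apply: Rmin_glb_lt; lra.
have Hh1 : h <= d / 2 := Rmin_l _ _.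
have Hh2 : h <= 1 / 2 := Rmin_r _ _.
have := HC h ltac:(lra).
have := Hd' h ltac:(rewrite Rminus_0_r Rabs_pos_eq; lra).
have := norm_le_minus (F 0) (F h); rewrite (norm_minus_sym (F 0)); lra.
Qed.

End Differentiation.

Section Semivariation.
Context {X : CompleteNormedModule R_AbsRing}.

Lemma continuous_affine (a b t : R) : continuous (fun e => (1 - e) * a + e * b) t.
Proof. by apply: (@ex_derive_continuous R_AbsRing R_NormedModule); auto_derive. Qed.

(* The subdivision points may coincide and need not reach the ends: move them
   to a strict subdivision with end intervals of weight zero, then use strong
   continuity. *)
Lemma semivariation_weak (G : R -> X -> X) r M : 0 < r ->
  (forall z, cont (fun s => G s z)) -> (forall s, G s zero = zero) ->
  (forall (n : nat) (d : nat -> R) (xs : nat -> X),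
      d O = 0 -> d n = r -> (forall i, (i < n)%nat -> d i < d (S i)) ->
      (forall i, norm (xs i) <= 1) ->
      norm (sum_n_m (fun i => minus (G (d i) (xs i)) (G (d (i - 1)%nat) (xs i))) 1 n) <= M) ->
  forall (n : nat) (tau : nat -> R) (y : nat -> X),
    (forall j, (j <= n)%nat -> 0 <= tau j <= r) ->
    (forall j, (j < n)%nat -> tau (S j) <= tau j) ->
    (forall j, norm (y j) <= 1) ->
    norm (vsum (fun j => minus (G (tau j) (y j)) (G (tau (S j)) (y j))) n) <= M.
Proof.
move=> Hr HG HG0 HM n tau y Htau Hmono Hy.
(* Strictly decreasing points inside [(0,r)]. A small weight [e] on them makes the weakly decreasing
   [tau] strictly decreasing and moves it off the ends. *)
pose w j := r * INR (n + 1 - j) / INR (n + 2).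
pose te e j := (1 - e) * tau j + e * w j.
pose F e := vsum (fun j => minus (G (te e j) (y j)) (G (te e (S j)) (y j))) n.
have HF0 : vsum (fun j => minus (G (tau j) (y j)) (G (tau (S j)) (y j))) n = F 0.
  apply: vsum_ext => j _; rewrite /te.
  by congr minus; congr (G _ _); ring.
rewrite HF0; apply: norm_le_limit.
  have Hc i z : continuous (fun e => G (te e i) z) 0.
    apply: (continuous_comp (fun e => te e i) (fun s => G s z)) (HG _ _).
    exact: continuous_affine.
  apply: (continuous_vsum (fun j e => minus (G (te e j) (y j)) (G (te e (S j)) (y j)))) => j.
  by apply: continuous_minus; exact: Hc.
move=> e He.
have Hn2 : 0 < INR (n + 2) by apply: INR_gt0; lia.
have Hw j : (j <= n)%nat -> 0 < w j < r.
  move=> Hj; have H1 : 0 < INR (n + 1 - j) by apply: INR_gt0; lia.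
  have H2 : INR (n + 1 - j) < INR (n + 2) by apply: lt_INR; lia.
  have -> : w j = r * (INR (n + 1 - j) / INR (n + 2)) by rewrite /w; field; lra.
  have H3 : 0 < INR (n + 1 - j) / INR (n + 2) by exact: Rdiv_lt_0_compat.
  have H4 : INR (n + 1 - j) / INR (n + 2) < 1 by apply/Rlt_div_l; lra.
  by split; nra.
have Hws j : (j < n)%nat -> w (S j) < w j.
  move=> Hj; rewrite /w /Rdiv; apply: Rmult_lt_compat_r; first exact: Rinv_0_lt_compat.
  by apply: Rmult_lt_compat_l => //; apply: lt_INR; lia.
(* [tau] decreases while a subdivision increases, hence the reversed index [n + 1 - i]. The added
   points 0 and [r] bound the two intervals where [xs] is zero. *)
pose d i := if Nat.eqb i 0 then 0 else if Nat.leb i (n + 1) then te e (n + 1 - i)%nat else r.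
pose xs i := if andb (Nat.leb 2 i) (Nat.leb i (n + 1)) then y (n + 1 - i)%nat else zero.
have Hd1 i : (1 <= i)%nat -> (i <= n + 1)%nat -> d i = te e (n + 1 - i)%nat.
  rewrite /d; case: Nat.eqb_spec => [->|_]; first lia.
  by case: Nat.leb_spec => //; lia.
have Hd2 : d (n + 2)%nat = r.
  rewrite /d; case: Nat.eqb_spec => [|_]; first lia.
  by case: Nat.leb_spec => //; lia.
have Hxs i : (2 <= i)%nat -> (i <= n + 1)%nat -> xs i = y (n + 1 - i)%nat.
  move=> H2 Hi; rewrite /xs (proj2 (Nat.leb_le 2 i) H2) (proj2 (Nat.leb_le i (n + 1)) Hi) //.
have Hte j : (j <= n)%nat -> 0 < te e j < r.
  by move=> Hj; have := Htau j Hj; have := Hw j Hj; rewrite /te; nra.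
have := HM (n + 2)%nat d xs eq_refl Hd2.
rewrite vsum_sum_n_m.
have -> : vsum (fun i => minus (G (d (S i)) (xs (S i))) (G (d (S i - 1)%nat) (xs (S i)))) (n + 2) =
    F e.
  have -> : (n + 2 = S (S n))%nat by lia.
  rewrite -[LHS]/(plus (vsum _ (S n)) _) vsum_shift.
  have -> : xs 1%nat = zero by [].
  have -> : xs (S (S n)) = zero.
    by rewrite /xs (proj2 (Nat.leb_gt (S (S n)) (n + 1))) ?Bool.andb_false_r //; lia.
  rewrite !HG0 !minus_eq_zero plus_zero_l plus_zero_r /F -[RHS]vsum_rev.
  apply: vsum_ext => i Hi.
  rewrite Hxs; try lia.
  rewrite !Hd1; try lia.
  have -> : (n + 1 - S (S i) = n - 1 - i)%nat by lia.
  have -> : (n + 1 - (S (S i) - 1) = S (n - 1 - i))%nat by lia.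
  by [].
apply.
  move=> i Hi; case: i Hi => [|i] Hi.
    have -> : d O = 0 by [].
    by rewrite Hd1; [apply Hte; lia | lia | lia].
  case: (Nat.eq_dec i n) => Hin.
    rewrite Hd1; try lia.
    have -> : S (S i) = (n + 2)%nat by lia.
    by rewrite Hd2; apply Hte; lia.
  rewrite !Hd1; try lia.
  have -> : (n + 1 - S i = S (n + 1 - S (S i)))%nat by lia.
  have H1 := Hmono (n + 1 - S (S i))%nat ltac:(lia).
  have H2 := Hws (n + 1 - S (S i))%nat ltac:(lia).
  rewrite /te; nra.
move=> i; rewrite /xs; case: andb => //; rewrite norm_zero; lra.
Qed.

Lemma vsum_mul (u : nat -> X) n m :
  vsum u (n * m) = vsum (fun i => vsum (fun l => u (i * m + l)%nat) m) n.
Proof.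
elim: n => [|n IH] //=.
by rewrite Nat.add_comm vsum_add IH.
Qed.

Lemma pt_refine T n m i l : (1 <= n)%nat -> (1 <= m)%nat ->
  pt T (n * m) (i * m + l) = pt T n i + INR l * (T / INR (n * m)).
Proof.
move=> /INR_gt0 Hn /INR_gt0 Hm.
rewrite /pt plus_INR !mult_INR; field; lra.
Qed.

(** The coarse sum splits over the fine cells by telescoping, and [j / m] is the coarse cell of fine
    index [j]. The difference is again a sum of increments of [g], now applied to oscillations of
    [f]. *)
Lemma Stsum_refine (g : R -> X -> X) f T n m t : (1 <= n)%nat -> (1 <= m)%nat ->
  (forall s y z, g s (minus y z) = minus (g s y) (g s z)) ->
  minus (Stsum g f T n t) (Stsum g f T (n * m) t) =
  vsum (fun j => let y := minus (f (pt T n (j / m))) (f (pt T (n * m) j)) in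
    minus (g (t - pt T (n * m) j) y) (g (t - pt T (n * m) (S j)) y)) (n * m).
Proof.
move=> Hn Hm Hg.
have -> : Stsum g f T n t =
    vsum (fun j => minus (g (t - pt T (n * m) j) (f (pt T n (j / m))))
      (g (t - pt T (n * m) (S j)) (f (pt T n (j / m))))) (n * m).
  rewrite vsum_mul; apply: vsum_ext => i Hi.
  rewrite (vsum_ext _ (fun l => minus
      (opp (g (t - pt T (n * m) (i * m + S l)) (f (pt T n i))))
      (opp (g (t - pt T (n * m) (i * m + l)) (f (pt T n i)))))).
    rewrite (vsum_telescope (fun l => opp (g (t - pt T (n * m) (i * m + l)) (f (pt T n i))))).
    have -> : (i * m + m = S i * m + 0)%nat by lia.
    rewrite !pt_refine // !Rmult_0_l !Rplus_0_r; vring.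
  move=> l Hl; rewrite Nat.div_add_l; last lia.
  rewrite (Nat.div_small l) // Nat.add_0_r Nat.add_succ_r; vring.
rewrite /Stsum -vsum_minus; apply: vsum_ext => j _ /=.
by rewrite !Hg; vring.
Qed.

End Semivariation.

(** * The inhomogeneous problem *)

Section Resolvent.
Context {X : CompleteNormedModule R_AbsRing}.
Variables (D : X -> Prop) (A : X -> X) (alpha r : R) (Sf : R -> X -> X).
Hypothesis Ha : 1 < alpha < 2.
Hypothesis HA : closed_dense_op D A.
Hypothesis HS : resolvent_family D A alpha Sf.
Hypothesis Hr : 0 < r.

Let r_ge0 : 0 <= r := Rlt_le _ _ Hr.

(* Freezing [S] outside [0,r] makes every integrand continuous on the line. *)
Definition Sr (s : R) (x : X) : X := Sf (clamp r s) x.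
Definition Qr (t : R) (z : X) : X := pK alpha (/ Gamma alpha) (fun s => Sr s z) t.
Definition Pr (t : R) (z : X) : X := pK (alpha - 1) (/ Gamma (alpha - 1)) (fun s => Sr s z) t.

Let Ca_gt0 : 0 < / Gamma alpha.
Proof. by apply: Gamma_inv_gt0; lra. Qed.
Let C1_gt0 : 0 < / Gamma (alpha - 1).
Proof. by apply: Gamma_inv_gt0; lra. Qed.
Let a_gt0 : 0 < alpha. Proof. lra. Qed.
Let a1_gt0 : 0 < alpha - 1. Proof. lra. Qed.

Lemma Sr_linear s : is_linear (Sr s).
Proof. by apply HS; apply clamp_range. Qed.

Lemma Sr_id s x : 0 <= s <= r -> Sr s x = Sf s x.
Proof. by move=> Hs; rewrite /Sr clamp_id. Qed.

Lemma Sr_npos s x : s <= 0 -> Sr s x = x.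
Proof. by move=> Hs; rewrite /Sr clamp_npos //; apply HS. Qed.

Lemma Sr_cont x : cont (fun s => Sr s x).
Proof.
apply: (cont_clamp r (fun s => Sf s x)) => // t Ht P HP.
have [d Hd] := proj1 (proj2 HS) x t (proj1 Ht) P HP.
by exists d => s Hs [Hs0 _]; exact: Hd.
Qed.

Lemma Sr_plus s y z : Sr s (plus y z) = plus (Sr s y) (Sr s z).
Proof. exact: linear_plus (Sr_linear s) y z. Qed.

Lemma Sr_scal s (k : R) z : Sr s (scal k z) = scal k (Sr s z).
Proof. exact: linear_scal (Sr_linear s) k z. Qed.

Lemma Sr_minus s y z : Sr s (minus y z) = minus (Sr s y) (Sr s z).
Proof.
have E (u v : X) : minus u v = plus u (scal (-1) v) by vring.
by rewrite !E Sr_plus Sr_scal.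
Qed.

(** Uniform boundedness is stated for operators on continuous functions; evaluation at 0 and
    constant functions specialise it to operators on [X]. [Rmax M 1] makes the bound positive. *)
Lemma Sr_bound : exists M, 0 < M /\ forall s x, norm (Sr s x) <= M * norm x.
Proof.
have [M HM] := uniform_boundedness R (fun s (f : R -> X) => Sr s (f 0))
  (fun j f g _ _ => Sr_plus j (f 0) (g 0))
  (fun j k f _ => Sr_scal j k (f 0)) ltac:(
    move=> j; have [K [HK HK']] := linear_norm _ (Sr_linear j);
    exists K => f _ Hf; apply: Rle_trans (HK' _) _; have := Hf 0; nra) ltac:(
    move=> f _; have [K HK] := cont_bounded (fun s => Sr s (f 0)) r r_ge0 (Sr_cont _);
    exists K => j; have Hc := clamp_range r j r_ge0;
    have := HK (clamp r j) Hc; rewrite {1}/Sr clamp_id //).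
exists (Rmax M 1); split; first by apply: Rlt_le_trans (Rmax_r _ _); lra.
move=> s x.
case: (Req_dec (norm x) 0) => Hx.
  have -> : x = zero by exact: norm_eq_zero.
  have -> : Sr s zero = zero.
    by have := Sr_minus s zero zero; rewrite !minus_eq_zero.
  by rewrite norm_zero; lra.
have Hx0 : 0 < norm x by have := norm_ge_0 x; lra.
have E : x = scal (norm x) (scal (/ norm x) x) by vring.
rewrite {1}E Sr_scal norm_scal_eq Rabs_pos_eq; last lra.
rewrite Rmult_comm; apply: Rmult_le_compat_r; first lra.
apply: Rle_trans (Rmax_l M 1).
apply: (HM s (fun _ => scal (/ norm x) x)).
  by move=> u; exact: continuous_const.
move=> _; rewrite norm_scal_eq Rabs_pos_eq; last exact/Rlt_le/Rinv_0_lt_compat.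
by rewrite Rinv_l //; lra.
Qed.

Lemma gk_kernel b s : 0 < s -> gk b s = / Gamma b * Rpower s (b - 1).
Proof. by move=> Hs; rewrite /gk; case: Rlt_dec => // _; rewrite /Rdiv Rmult_comm. Qed.

Lemma Sr_Qr x t : D x -> t <= r -> Sr t x = plus x (Qr t (A x)).
Proof.
move=> Hx Ht; case: (Rle_dec t 0) => Ht0.
  by rewrite Sr_npos // /Qr pK_npos // plus_zero_r.
rewrite Sr_id; last lra.
have [_ [_ [_ [_ ->]]]] := HS => //; last lra.
congr plus; rewrite /Qr.
have Egk u : / Gamma alpha * ppow (alpha - 1) u = gk alpha u.
  by rewrite /gk /ppow; case: Rlt_dec => _; rewrite /Rdiv; ring.
(* Since [alpha > 1] this kernel is continuous even at 0, so the plain integral in the resolvent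
   equation agrees with the improper one. *)
have Hgk s : continuous (gk alpha) s.
  apply: (continuous_ext (fun t => / Gamma alpha * ppow (alpha - 1) t) (gk alpha)) => //.
  by apply: (continuous_scal_r (V := R_NormedModule)); apply: continuous_ppow; lra.
rewrite (RInt_ext _ (fun s => scal (gk alpha (t - s)) (Sr s (A x)))).
  rewrite -Iint_RInt; last lra.
    apply: Iint_pK => //; try lra.
    - by move=> s; exact: gk_kernel.
    - exact: Sr_cont.
  move=> s; apply: continuous_scal; last exact: Sr_cont.
  exact: (cont_comp_minus (X := R_CompleteNormedModule) (gk alpha)).
move=> s; rewrite Rmin_left ?Rmax_right; try lra.
by move=> Hs; rewrite Sr_id //; lra.
Qed.

Lemma Qr_op x t : D x -> D (Qr t x) /\ A (Qr t x) = Qr t (A x).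
Proof.
move=> Hx.
have Hop s : D (Sr s x) /\ A (Sr s x) = Sr s (A x).
  by apply HS => //; apply clamp_range.
have E : (fun s => A (Sr s x)) = (fun s => Sr s (A x)).
  by apply: functional_extensionality => s; apply Hop.
rewrite /Qr -E; apply: (pK_op D A HA) => //.
- exact: Sr_cont.
- by move=> s; apply Hop.
- rewrite E; exact: Sr_cont.
Qed.

Section Bounds.
Variable M : R.
Hypothesis M_gt0 : 0 < M.
Hypothesis HM : forall s x, norm (Sr s x) <= M * norm x.

Lemma pK_Sr_bound b C t z : 0 < b -> 0 < C ->
  norm (pK b C (fun s => Sr s z) t) <= pG b C t * (M * norm z).
Proof. by move=> Hb HC; apply: pK_norm_le => // u; exact: Sr_cont. Qed.

Lemma pK_Sr_minus b C t y z : 0 < b -> 0 < C ->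
  pK b C (fun s => Sr s (minus y z)) t =
  minus (pK b C (fun s => Sr s y) t) (pK b C (fun s => Sr s z) t).
Proof.
move=> Hb HC; rewrite -pK_minus //; try exact: Sr_cont.
by apply: (pK_ext b C Hb HC) => s _; exact: Sr_minus.
Qed.

(** For [x] in [D(A)] this is the resolvent equation with [A] moved in front of [Q]. In general [x]
    is a limit of such vectors, the right side is bounded in [x], and [A] is closed. *)
Lemma Qr_dom x t : t <= r -> D (Qr t x) /\ A (Qr t x) = minus (Sr t x) x.
Proof.
move=> Ht.
have Hxn n : exists d, D d /\ norm (minus d x) < / INR (S n).
  by apply: (op_dense D A HA); apply: Rinv_0_lt_compat; apply: INR_gt0; lia.
pose xn n := proj1_sig (constructive_indefinite_description _ (Hxn n)).
have Hx n : D (xn n) /\ norm (minus (xn n) x) < / INR (S n).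
  exact: proj2_sig (constructive_indefinite_description _ (Hxn n)).
have Hsmall K : 0 <= K -> forall e, 0 < e -> exists N, forall n, (N <= n)%nat ->
    K * norm (minus x (xn n)) <= e.
  move=> HK e He; have [N [HN HN']] := Rdiv_small e K He HK.
  exists N => n Hn; have := HN' (S n) ltac:(lia).
  have [_] := Hx n; rewrite norm_minus_sym /Rdiv => H1 H2; nra.
apply: (op_closed_norm D A HA (fun n => Qr t (xn n))).
- by move=> n; apply Qr_op; apply Hx.
- have HG := pG_ge0 alpha _ a_gt0 Ca_gt0 t.
  move=> e He.
  have [N HN] := Hsmall (pG alpha (/ Gamma alpha) t * M) ltac:(nra) e He.
  exists N => n Hn; rewrite /Qr -pK_Sr_minus //.
  apply: Rle_trans (pK_Sr_bound _ _ _ _ a_gt0 Ca_gt0) _.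
  by rewrite -Rmult_assoc; exact: HN.
- move=> e He; have [N HN] := Hsmall (M + 1) ltac:(lra) e He.
  exists N => n Hn.
  have [_ ->] := Qr_op (xn n) t (proj1 (Hx n)).
  have E : Qr t (A (xn n)) = minus (Sr t (xn n)) (xn n).
    by rewrite Sr_Qr //; [vring | apply Hx].
  have -> : minus (minus (Sr t x) x) (Qr t (A (xn n))) =
      minus (Sr t (minus x (xn n))) (minus x (xn n)).
    by rewrite E Sr_minus; vring.
  apply: Rle_trans (norm_minus_le _ _) _.
  have := HM t (minus x (xn n)); have := HN n Hn; lra.
Qed.

Lemma Pr_cont z : cont (fun t => Pr t z).
Proof. by move=> t; apply: continuous_pK => // u; exact: Sr_cont. Qed.

Lemma Pr_joint (f : R -> X) t : cont f -> cont (fun s => Pr (t - s) (f s)).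
Proof.
move=> Hf; apply: (continuous_joint Pr (fun s => t - s)) => //.
- exact: Pr_cont.
- by move=> s y z; exact: pK_Sr_minus.
- move=> T; exists (pG (alpha - 1) (/ Gamma (alpha - 1)) T * M).
  have HG := pG_ge0 _ _ a1_gt0 C1_gt0 T.
  split; first nra.
  move=> s z HsT; apply: Rle_trans (pK_Sr_bound _ _ _ _ a1_gt0 C1_gt0) _.
  rewrite Rmult_assoc; apply: Rmult_le_compat_r; first by have := norm_ge_0 z; nra.
  exact: pG_le.
- by move=> s; apply: (continuous_minus (V := R_NormedModule));
    [exact: continuous_const | exact: continuous_id].
Qed.

Lemma Pr_npos t z : t <= 0 -> Pr t z = zero.
Proof. by move=> Ht; rewrite /Pr pK_npos. Qed.

Lemma Qr_npos t z : t <= 0 -> Qr t z = zero.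
Proof. by move=> Ht; rewrite /Qr pK_npos. Qed.

(** The law [1 + (alpha - 1) = alpha]. It makes increments of [Q] integrals of [P], the link between
    Stieltjes sums and [P_alpha * f]. *)
Lemma Qr_Pr t z : Qr t z = pK 1 1 (fun s => Pr s z) t.
Proof. by rewrite /Qr -pK_int_frac //; exact: Sr_cont. Qed.

Lemma Qr_cont z : cont (fun t => Qr t z).
Proof. by move=> t; apply: continuous_pK => // u; exact: Sr_cont. Qed.

Lemma RInt_Pr t z u v : RInt (fun s => Pr (t - s) z) u v = minus (Qr (t - u) z) (Qr (t - v) z).
Proof.
rewrite !Qr_Pr; apply: (RInt_pK_1 (fun s => Pr s z)); first exact: Pr_cont.
by move=> s Hs; exact: Pr_npos.
Qed.

Lemma is_derive_Qr t z : is_derive (fun t => Qr t z) t (Pr t z).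
Proof.
apply: (is_derive_ext (pK 1 1 (fun s => Pr s z))); first by move=> s; rewrite Qr_Pr.
apply: (is_derive_pK_1 (fun s => Pr s z)); first exact: Pr_cont.
by move=> s Hs; exact: Pr_npos.
Qed.

(** [Pr] vanishes at nonpositive times, so integrating to [r] instead of [t] changes nothing and one
    subdivision serves all [t]. *)
Definition Wr (f : R -> X) (t : R) : X := RInt (fun s => Pr (t - s) (f s)) 0 r.

Lemma Pconv_Wr (f g : R -> X) t : cont f -> (forall s, 0 <= s <= r -> g s = f s) ->
  0 <= t <= r -> Pconv alpha Sf g t = Wr f t.
Proof.
move=> Hf Hg Ht; rewrite /Pconv /Wr.
have Hex u v : ex_RInt (fun s => Pr (t - s) (f s)) u v.
  by apply: ex_RInt_continuous => s _; exact: Pr_joint.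
rewrite -(RInt_Chasles _ 0 t r) // [RInt _ t r](RInt_ext _ (fun _ => zero)).
  rewrite RInt_const scal_zero_r plus_zero_r.
  apply: RInt_ext => s; rewrite Rmin_left ?Rmax_right; try lra.
  move=> Hs; rewrite /Pop Hg; last lra.
  apply: Iint_pK => //; try lra.
  - by move=> u; exact: gk_kernel.
  - exact: Sr_cont.
  - by move=> u Hu; rewrite Sr_id //; lra.
move=> s; rewrite Rmin_left ?Rmax_right; try lra.
by move=> Hs; apply: Pr_npos; lra.
Qed.

(** With [f] frozen on a cell the integral of [Pr] is exactly the increment of [Qr]; what remains is
    at most the bound [B] on [Pr] times the oscillation of [f]. *)
Lemma Wr_Stsum (f : R -> X) e : cont f -> 0 < e ->
  exists N, (1 <= N)%nat /\ forall n, (N <= n)%nat -> forall t, t <= r ->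
    norm (minus (Wr f t) (Stsum Qr f r n t)) <= e.
Proof.
move=> Hf He.
pose B := pG (alpha - 1) (/ Gamma (alpha - 1)) r * M.
have HB : 0 <= B by have := pG_ge0 _ _ a1_gt0 C1_gt0 r; rewrite /B; nra.
have HPr s z : s <= r -> norm (Pr s z) <= B * norm z.
  move=> Hs; apply: Rle_trans (pK_Sr_bound _ _ _ _ a1_gt0 C1_gt0) _.
  rewrite /B Rmult_assoc; apply: Rmult_le_compat_r; first by have := norm_ge_0 z; nra.
  exact: pG_le.
have HBr : 0 < B * r + 1 by nra.
have He' : 0 < e / (B * r + 1) by exact: Rdiv_lt_0_compat.
have [N [HN Hmod]] := unif_modulus f r _ Hf r_ge0 He'.
exists N; split => // n Hn t Ht.
have Hn1 : (1 <= n)%nat by lia.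
have Hex u v : ex_RInt (fun s => Pr (t - s) (f s)) u v.
  by apply: ex_RInt_continuous => s _; exact: Pr_joint.
have Hcz z : cont (fun s => Pr (t - s) z) by apply: cont_comp_minus; exact: Pr_cont.
have Hexz z u v : ex_RInt (fun s => Pr (t - s) z) u v.
  by apply: ex_RInt_continuous => s _; exact: Hcz.
pose W i := RInt (fun s => Pr (t - s) (f s)) 0 (pt r n i).
have -> : Wr f t = minus (W n) (W O).
  by rewrite /W pt_n // pt_0 RInt_point minus_zero_r.
have HE : e / (B * r + 1) * B * pt r n n - e / (B * r + 1) * B * pt r n 0 <= e.
  rewrite pt_n // pt_0.
  have -> : e / (B * r + 1) * B * r - e / (B * r + 1) * B * 0 = e - e / (B * r + 1).
    by field; lra.
  lra.
apply: Rle_trans HE.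
apply: (norm_telescope_le W _ (fun i => e / (B * r + 1) * B * pt r n i)) => i Hi.
have Hs0 : 0 <= pt r n i <= r by apply: pt_bound => //; lia.
have Hs1 : 0 <= pt r n (S i) <= r by apply: pt_bound => //; lia.
have Hstep := pt_S r n i Hn1.
have Hstep0 : 0 <= r / INR n by apply: Rdiv_le_0_compat r_ge0 (INR_gt0 _ Hn1).
have -> : minus (minus (W (S i)) (W i))
    (minus (Qr (t - pt r n i) (f (pt r n i))) (Qr (t - pt r n (S i)) (f (pt r n i)))) =
    RInt (fun s => Pr (t - s) (minus (f s) (f (pt r n i)))) (pt r n i) (pt r n (S i)).
  rewrite -RInt_Pr /W -(RInt_Chasles _ 0 (pt r n i) (pt r n (S i))) //.
  rewrite [RHS](RInt_ext _ (fun s => minus (Pr (t - s) (f s)) (Pr (t - s) (f (pt r n i))))).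
    by rewrite RInt_minus //; vring.
  by move=> s _; exact: pK_Sr_minus.
have -> : e / (B * r + 1) * B * pt r n (S i) - e / (B * r + 1) * B * pt r n i =
    (pt r n (S i) - pt r n i) * (B * (e / (B * r + 1))) by ring.
apply: (norm_RInt_le_const (fun s => Pr (t - s) (minus (f s) (f (pt r n i))))
  (pt r n i) (pt r n (S i))); first lra.
  move=> s Hs; apply: Rle_trans (HPr _ _ _) _; first lra.
  apply: Rmult_le_compat_l => //; apply: (Hmod n) => //; try lra.
  rewrite Rabs_pos_eq; lra.
apply: RInt_correct; apply: ex_RInt_continuous => s _; apply: Pr_joint => u.
by apply: continuous_minus; [exact: Hf | exact: continuous_const].
Qed.

(** From [A (Qr t z) = minus (Sr t z) z]: the vector [z] cancels in each increment. *)
Lemma A_Stsum_Qr (f : R -> X) n t : t <= r ->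
  D (Stsum Qr f r n t) /\ A (Stsum Qr f r n t) = Stsum Sr f r n t.
Proof.
move=> Ht; case: n => [|n].
  by split; [exact: op_dom_zero HA | exact: (op_zero D A HA)].
have [|H1 H2] := op_Stsum D A HA Qr (fun a z => minus (Sr a z) z) f r (S n) t.
  move=> i j Hi Hj; apply: Qr_dom.
  have := pt_bound r (S n) i r_ge0 Hi ltac:(lia); lra.
split => //; rewrite H2; apply: vsum_ext => i _; vring.
Qed.

(* Convolving the Stieltjes sum of [S] with the kernel of [Qr] gives back, by
   translation invariance, the Stieltjes sums of [Qr] and of the kernel. *)
Lemma pK_Stsum_Sr (f : R -> X) n t :
  pK alpha (/ Gamma alpha) (Stsum Sr f r n) t =
  minus (Stsum Qr f r n t) (Stsum (pGs alpha (/ Gamma alpha)) f r n t).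
Proof.
case: n => [|n].
  rewrite /Stsum /= minus_eq_zero; exact: pK_zero.
pose phi z s := minus (Sr s z) z.
have Hphi z : cont (phi z).
  by move=> s; apply: continuous_minus; [exact: Sr_cont | exact: continuous_const].
have Hphi0 z s : s <= 0 -> phi z s = zero.
  by move=> Hs; rewrite /phi Sr_npos // minus_eq_zero.
have Hsh a z : 0 <= a -> pK alpha (/ Gamma alpha) (fun s => phi z (s - a)) t =
    minus (Qr (t - a) z) (pGs alpha (/ Gamma alpha) (t - a) z).
  move=> Ha0; rewrite (pK_shift _ _ a_gt0 Ca_gt0 (phi z) a t (Hphi z) (Hphi0 z)) //.
  rewrite (pK_minus _ _ a_gt0 (fun s => Sr s z) (fun _ => z)) //.
  - by rewrite pK_const.
  - exact: Sr_cont.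
  - by move=> u; exact: continuous_const.
rewrite /Stsum -vsum_minus.
have -> : (fun s => vsum (fun i => minus (Sr (s - pt r (S n) i) (f (pt r (S n) i)))
    (Sr (s - pt r (S n) (S i)) (f (pt r (S n) i)))) (S n)) =
  (fun s => vsum (fun i => minus (phi (f (pt r (S n) i)) (s - pt r (S n) i))
    (phi (f (pt r (S n) i)) (s - pt r (S n) (S i)))) (S n)).
  apply: functional_extensionality => s.
  by apply: vsum_ext => i _; rewrite /phi; vring.
have Hc a z : cont (fun s => phi z (s - a)) by exact: cont_comp_shift.
rewrite (pK_vsum _ _ _ (fun i s => minus (phi (f (pt r (S n) i)) (s - pt r (S n) i))
    (phi (f (pt r (S n) i)) (s - pt r (S n) (S i))))) //.
  apply: vsum_ext => i Hi.
  have Hb j : (j <= S n)%nat -> 0 <= pt r (S n) j.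
    by move=> Hj; have := pt_bound r (S n) j r_ge0 Hj ltac:(lia); lra.
  rewrite pK_minus //; try exact: Hc.
  rewrite !Hsh; try by apply: Hb; lia.
  vring.
by move=> i s; apply: continuous_minus; exact: Hc.
Qed.

(** * Bounded semivariation implies strong solutions *)

Definition semivariation_bound (N : R) : Prop :=
  forall (n : nat) (d : nat -> R) (xs : nat -> X),
    d O = 0 -> d n = r -> (forall i, (i < n)%nat -> d i < d (S i)) ->
    (forall i, norm (xs i) <= 1) ->
    norm (sum_n_m (fun i => minus (Sr (d i) (xs i)) (Sr (d (i - 1)%nat) (xs i))) 1 n) <= N.

Lemma subdivision_mono n (d : nat -> R) : (forall i, (i < n)%nat -> d i < d (S i)) ->
  forall i j, (i <= j)%nat -> (j <= n)%nat -> d i <= d j.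
Proof.
move=> Hd i j; elim: j => [|j IH] Hij Hj.
  have -> : i = O by lia.
  exact: Rle_refl.
case: (Nat.eq_dec i (S j)) => [->|Hne]; first exact: Rle_refl.
have := IH ltac:(lia) ltac:(lia); have := Hd j ltac:(lia); lra.
Qed.

Lemma bounded_semivariationE :
  bounded_semivariation 0 r Sf <-> exists N, semivariation_bound N.
Proof.
have Hsum n d (xs : nat -> X) : d O = 0 -> d n = r ->
    (forall i, (i < n)%nat -> d i < d (S i)) ->
    sum_n_m (fun i => minus (Sr (d i) (xs i)) (Sr (d (i - 1)%nat) (xs i))) 1 n =
    sum_n_m (fun i => minus (Sf (d i) (xs i)) (Sf (d (i - 1)%nat) (xs i))) 1 n.
  move=> Hd0 Hdn Hd; apply: sum_n_m_ext_loc => i Hi.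
  have Hm := subdivision_mono n d Hd.
  have H1 := Hm O i ltac:(lia) ltac:(lia).
  have H2 := Hm i n ltac:(lia) ltac:(lia).
  have H3 := Hm O (i - 1)%nat ltac:(lia) ltac:(lia).
  have H4 := Hm (i - 1)%nat n ltac:(lia) ltac:(lia).
  by rewrite !Sr_id //; lra.
split=> -[N HN]; exists N => n d xs Hd0 Hdn Hd Hxs.
  by rewrite (Hsum n d xs Hd0 Hdn Hd); exact: (HN n d xs Hd0 Hdn Hd Hxs).
by rewrite -(Hsum n d xs Hd0 Hdn Hd); exact: (HN n d xs Hd0 Hdn Hd Hxs).
Qed.

Lemma Sr_zero s : Sr s zero = zero.
Proof. by have := Sr_minus s zero zero; rewrite !minus_eq_zero. Qed.

(** Both sums are compared with the one on [S n * S m] cells. The difference carries oscillations of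
    [f], which divided by [e'] lie in the unit ball, so it is at most [e'] times the semivariation,
    uniformly in [t]. *)
Lemma Stsum_Sr_cauchy N (f : R -> X) : semivariation_bound N -> cont f ->
  forall e, 0 < e -> exists K, forall n m, (K <= n)%nat -> (K <= m)%nat ->
    forall t, t <= r ->
    norm (minus (Stsum Sr f r (S n) t) (Stsum Sr f r (S m) t)) <= e.
Proof.
move=> HN Hf e He.
pose N' := Rmax N 1.
have HN1 : 1 <= N' := Rmax_r _ _.
have He' : 0 < e / (2 * N') by apply: Rdiv_lt_0_compat; lra.
have [K [HK Hmod]] := unif_modulus f r _ Hf r_ge0 He'.
have Hone n m t : (K <= n)%nat -> t <= r ->
    norm (minus (Stsum Sr f r (S n) t) (Stsum Sr f r (S n * S m) t)) <= e / 2.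
  move=> Hn Ht.
  rewrite Stsum_refine //; try lia; last exact: Sr_minus.
  set k := (S n * S m)%nat; set e' := e / (2 * N') in He' Hmod.
  (* The times [t - pt r k j] may be negative; clamping brings them into [[0,r]] without changing
     [Sr]. They may then coincide, which [semivariation_weak] permits. *)
  pose tau j := clamp r (t - pt r k j).
  (* The zero default is there because the norm bound is demanded for every index. *)
  pose y j := scal (/ e') (if Nat.leb j k then minus (f (pt r (S n) (j / S m))) (f (pt r k j)) else zero).
  have Hk : (1 <= k)%nat by rewrite /k; lia.
  have Hy j : norm (y j) <= 1.
    rewrite norm_scal_eq Rabs_pos_eq; last exact/Rlt_le/Rinv_0_lt_compat.
    apply: (Rmult_le_reg_l e') => //; rewrite -Rmult_assoc Rinv_r; last lra.
    rewrite Rmult_1_l Rmult_1_r; case: Nat.leb_spec => Hj; last by rewrite norm_zero; lra.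
    have Hdiv : (j = j / S m * S m + j mod S m)%nat.
      by have := Nat.div_mod j (S m) ltac:(lia); lia.
    have Hmd := Nat.mod_upper_bound j (S m) ltac:(lia).
    have Hjn : (j / S m <= S n)%nat.
      by apply: (proj2 (Nat.mul_le_mono_pos_r _ _ (S m) ltac:(lia))); rewrite /k in Hj; lia.
    apply: (Hmod (S n)); try lia; try exact: pt_bound.
      by apply: pt_bound => //; lia.
    have -> : pt r k j = pt r (S n) (j / S m) + INR (j mod S m) * (r / INR k).
      by rewrite {1}Hdiv /k pt_refine //; lia.
    set q := pt _ _ _.
    have Hk0 := INR_gt0 k Hk.
    have Hn0 := INR_gt0 (S n) ltac:(lia).
    have Hm0 := INR_gt0 (S m) ltac:(lia).
    have Hrk : 0 <= r / INR k by exact: Rdiv_le_0_compat.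
    have Hmod0 := pos_INR (j mod S m).
    have Hmod1 : INR (j mod S m) <= INR (S m) by apply: le_INR; lia.
    have -> : q - (q + INR (j mod S m) * (r / INR k)) = - (INR (j mod S m) * (r / INR k)) by ring.
    rewrite Rabs_Ropp Rabs_pos_eq; last nra.
    have -> : r / INR (S n) = INR (S m) * (r / INR k).
      by rewrite /k mult_INR; field; lra.
    exact: Rmult_le_compat_r.
  have -> : vsum (fun j => let y := minus (f (pt r (S n) (j / S m))) (f (pt r k j)) in
      minus (Sr (t - pt r k j) y) (Sr (t - pt r k (S j)) y)) k =
    scal e' (vsum (fun j => minus (Sr (tau j) (y j)) (Sr (tau (S j)) (y j))) k).
    rewrite -vsum_scal; apply: vsum_ext => j Hj.
    rewrite /y (proj2 (Nat.leb_le j k)); last lia.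
    have Hc s z : Sr (clamp r s) z = Sr s z.
      by rewrite {1}/Sr clamp_id //; exact: clamp_range.
    rewrite /tau !Hc !Sr_scal /=; vring; lra.
  rewrite norm_scal_eq Rabs_pos_eq; last exact: Rlt_le.
  apply: Rle_trans (_ : e' * N' <= _); last by rewrite /e'; apply: Req_le; field; lra.
  apply: Rmult_le_compat_l; first exact: Rlt_le.
  apply: Rle_trans (Rmax_l N 1).
  apply: (semivariation_weak Sr r N Hr) => //.
  - exact: Sr_cont.
  - exact: Sr_zero.
  - by move=> j _; exact: clamp_range.
  - move=> j Hj; rewrite /tau /clamp.
    have Hst := pt_S r k j Hk.
    have Hrk : 0 <= r / INR k by apply: Rdiv_le_0_compat r_ge0 (INR_gt0 _ Hk).
    by apply: Rle_max_compat_l; apply: Rle_min_compat_l; lra.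
exists K => n m Hn Hm t Ht.
have H1 := Hone n m t Hn Ht.
have := Hone m n t Hm Ht; rewrite Nat.mul_comm norm_minus_sym => H2.
have := norm_minus_trans (Stsum Sr f r (S n) t) (Stsum Sr f r (S n * S m) t)
  (Stsum Sr f r (S m) t); lra.
Qed.

(* The limit [z] plays the role of [A (P * f)]. *)
Lemma Wr_domain N (f : R -> X) : semivariation_bound N -> cont f ->
  exists z : R -> X, cont z /\ (forall t, 0 <= t <= r ->
    D (Wr f t) /\ A (Wr f t) = z t /\
    Wr f t = pK alpha (/ Gamma alpha) (fun s => plus (f s) (z s)) t).
Proof.
move=> HN Hf.
have [z0 Hz0] := uniform_cauchy_lim (fun t => t <= r)
  (fun n t => Stsum Sr f r (S n) t) (Stsum_Sr_cauchy N f HN Hf).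
(* The convergence to [z0] is controlled only for [t <= r]; clamping makes the limit continuous on
   the line. *)
pose z t := z0 (clamp r t).
have Hz e : 0 < e -> exists K, forall n, (K <= n)%nat -> forall t, 0 <= t <= r ->
    norm (minus (z t) (Stsum Sr f r (S n) t)) <= e.
  move=> He; have [K HK] := Hz0 e He; exists K => n Hn t Ht.
  by rewrite /z clamp_id //; apply: HK => //; lra.
have HSt n : cont (Stsum Sr f r n) by move=> t; apply: continuous_Stsum; exact: Sr_cont.
have Hzc : cont z.
  move=> t; apply: continuous_approx => e He.
  have [K HK] := Hz0 e He.
  exists (fun s => Stsum Sr f r (S K) (clamp r s)), 1; split; first lra.
  split; last by move=> s _; apply: HK => //; apply clamp_range.
  apply: (cont_clamp r (Stsum Sr f r (S K)) r_ge0).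
  exact: (cont_on_ext r (Stsum Sr f r (S K))).
exists z; split => // t Ht.
have [HD HAz] : D (Wr f t) /\ A (Wr f t) = z t.
  apply: (op_closed_norm D A HA (fun n => Stsum Qr f r (S n) t)).
  - by move=> n; apply A_Stsum_Qr; lra.
  - move=> e He; have [K [_ HK]] := Wr_Stsum f e Hf He.
    by exists K => n Hn; apply: HK; [lia | lra].
  - move=> e He; have [K HK] := Hz e He.
    by exists K => n Hn; rewrite (proj2 (A_Stsum_Qr f (S n) t (proj2 Ht))); exact: HK.
split => //; split => //.
rewrite pK_plus //.
apply: norm_minus_eq0 => e He.
have HG := pG_ge0 alpha _ a_gt0 Ca_gt0 t.
have HGr := pG_ge0 alpha _ a_gt0 Ca_gt0 r.
(* Weights of three errors: [W] against the sum of [Qr], the convolution of [z] against that of the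
   sum of [Sr], and the convolution of [f] against its kernel sum. *)
pose K0 := 1 + pG alpha (/ Gamma alpha) t + pG alpha (/ Gamma alpha) r.
have HK0 : 0 < K0 by rewrite /K0; lra.
have He' : 0 < e / K0 by exact: Rdiv_lt_0_compat.
have [K1 [_ HK1]] := Wr_Stsum f _ Hf He'.
have [K2 HK2] := Hz _ He'.
have [K3 [_ HK3]] := pK_Stsum alpha _ a_gt0 Ca_gt0 f r _ Hf r_ge0 He'.
pose n := Nat.max K1 (Nat.max K2 K3).
have B1 := HK1 (S n) ltac:(rewrite /n; lia) t (proj2 Ht).
have B3 := HK3 (S n) ltac:(rewrite /n; lia) t (proj2 Ht).
have B2 : norm (minus (pK alpha (/ Gamma alpha) z t)
    (pK alpha (/ Gamma alpha) (Stsum Sr f r (S n)) t)) <= pG alpha (/ Gamma alpha) t * (e / K0).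
  rewrite -pK_minus //; last exact: HSt.
  apply: pK_norm_le => //; first by move=> u; apply: continuous_minus; [exact: Hzc | exact: HSt].
  by move=> s Hs; apply: HK2; [rewrite /n; lia | lra].
rewrite pK_Stsum_Sr in B2.
set W := Wr f t in B1 *; set Z := pK _ _ z t in B2 *; set F := pK _ _ f t in B3 *.
set Q := Stsum Qr f r (S n) t in B1 B2; set G := Stsum _ f r (S n) t in B2 B3.
have -> : minus W (plus F Z) = minus (minus W Q) (plus (minus F G) (minus Z (minus Q G))) by vring.
apply: Rle_trans (norm_minus_le _ _) _.
have := norm_triangle (minus F G) (minus Z (minus Q G)) => B4.
have E : e = e / K0 + pG alpha (/ Gamma alpha) t * (e / K0) + e / K0 * pG alpha (/ Gamma alpha) r.
  by rewrite {1}(_ : e = e / K0 * K0); [rewrite {2}/K0; ring | field; lra].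
rewrite E.
apply: Rle_trans (Rplus_le_compat_l _ _ _ B4) _; lra.
Qed.

(** [V] stands for [A u + f]. Differentiating once lowers the order [alpha] to [alpha - 1], still
    positive, so [u] is of class C^1; convolving with [g_(2-alpha)] gives the second primitive of
    [V], whose second derivative is [V]. *)
Lemma solution_of_integral_eq (u f V : R -> X) x y : cont V -> cont f ->
  (forall t, 0 <= t <= r -> u t = plus (plus x (scal t y)) (pK alpha (/ Gamma alpha) V t)) ->
  (forall t, 0 <= t <= r -> D (u t) /\ A (u t) = minus (V t) (f t)) ->
  strong_solution D A alpha r f x y u.
Proof.
move=> HV Hf Hu HDu.
have HK b C : 0 < b -> 0 < C -> cont (pK b C V) by move=> Hb HC t; exact: continuous_pK.
have HKa := HK _ _ a_gt0 Ca_gt0.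
have HK1 := HK _ _ a1_gt0 C1_gt0.
have HK11 := HK _ _ Rlt_0_1 Rlt_0_1.
have Hder t : is_derive (pK alpha (/ Gamma alpha) V) t
    (pK (alpha - 1) (/ Gamma (alpha - 1)) V t).
  apply: (is_derive_ext (pK 1 1 (pK (alpha - 1) (/ Gamma (alpha - 1)) V))).
    by move=> s; rewrite pK_int_frac.
  apply: is_derive_pK_1 => // s Hs; exact: pK_npos.
have Hlin t : is_derive (fun t => plus x (scal t y)) t y.
  have H : is_derive (fun t => plus x (scal t y)) t (plus zero (scal 1 y)).
    apply: is_derive_plus; first exact: is_derive_const.
    by apply: (is_derive_scal_l (fun t => t)); exact: is_derive_id.
  by rewrite plus_zero_l [scal 1 y]scal_one in H.
pose F t := plus (plus x (scal t y)) (pK alpha (/ Gamma alpha) V t).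
pose u1 t := plus y (pK (alpha - 1) (/ Gamma (alpha - 1)) V t).
have HF t : is_derive F t (u1 t) by apply: is_derive_plus.
have HFc : cont F.
  by move=> t; apply: (@ex_derive_continuous R_AbsRing X); exists (u1 t).
have Hu1 : cont u1.
  by move=> t; apply: continuous_plus; [exact: continuous_const | exact: HK1].
split; first by move=> t Ht; apply HDu.
split; first exact: (cont_on_ext r F).
split.
  apply: (cont_on_ext r (fun t => minus (V t) (f t))).
    by move=> t; apply: continuous_minus; [exact: HV | exact: Hf].
  by move=> t Ht; apply HDu.
split.
  exists u1; split; first by apply: (deriv_on_ext r F).
  split; first exact: (cont_on_ext r u1).
  by rewrite /u1 pK_npos ?plus_zero_r //; lra.
split.
  rewrite Hu; last lra.
  rewrite pK_npos ?plus_zero_r; last lra.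
  by rewrite [scal 0 y]scal_zero_l plus_zero_r.
exists (pK 1 1 V), V; split.
  apply: (deriv_on_ext r (pK 1 1 (pK 1 1 V))).
    by move=> t _; apply: is_derive_pK_1 => // s Hs; exact: pK_npos.
  move=> t Ht; rewrite -(pK_complement alpha) //; rewrite /caputo_pre.
  apply: Iint_pK => //; try lra.
  - by apply: Gamma_inv_gt0; lra.
  - by move=> s; exact: gk_kernel.
  - by move=> s Hs; rewrite Hu; [vring | lra].
split.
  apply: (deriv_on_ext r (fun t => RInt V 0 t)).
    by move=> t _; exact: is_derive_RInt_cont.
  by move=> t Ht; rewrite pK_1 //; lra.
split; first exact: (cont_on_ext r V).
by move=> t Ht; rewrite (proj2 (HDu t Ht)); vring.
Qed.

Lemma strong_solution_ext (f g : R -> X) x y u :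
  (forall t, 0 <= t <= r -> f t = g t) ->
  strong_solution D A alpha r f x y u -> strong_solution D A alpha r g x y u.
Proof.
move=> Hfg [H1 [H2 [H3 [H4 [H5 [v1 [v2 [H6 [H7 [H8 H9]]]]]]]]]].
do 5!split => //; exists v1, v2; do 3!split => //.
by move=> t Ht; rewrite -Hfg //; exact: H9.
Qed.

Lemma semivariation_solution N x y (f0 : R -> X) : semivariation_bound N ->
  D x -> D y -> cont_on 0 r f0 ->
  strong_solution D A alpha r f0 x y
    (fun t => plus (plus (Sf t x) (RInt (fun s => Sf s y) 0 t)) (Pconv alpha Sf f0 t)).
Proof.
move=> HN Hx Hy Hf0.
pose f t := f0 (clamp r t).
have Hf : cont f by exact: cont_clamp.
have Hff t : 0 <= t <= r -> f0 t = f t by move=> Ht; rewrite /f clamp_id.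
apply: (strong_solution_ext f); first by move=> t Ht; rewrite Hff.
have [z [Hz HWz]] := Wr_domain N f HN Hf.
have HSc w : cont (fun s => Sr s w) by exact: Sr_cont.
have HIc w : cont (pK 1 1 (fun s => Sr s w)) by move=> t; apply: (continuous_pK 1 1 Rlt_0_1 Rlt_0_1); exact: HSc.
(* The expected [A u + f]: [A] applied to the three terms of [u], with [z] for [A (P_alpha * f)]. *)
pose V t := plus (plus (Sr t (A x)) (pK 1 1 (fun s => Sr s (A y)) t)) (plus (f t) (z t)).
have Hfz : cont (fun t => plus (f t) (z t)).
  by move=> t; apply: continuous_plus; [exact: Hf | exact: Hz].
have HSI : cont (fun t => plus (Sr t (A x)) (pK 1 1 (fun s => Sr s (A y)) t)).
  by move=> t; apply: continuous_plus; [exact: HSc | exact: HIc].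
have HV : cont V by move=> t; apply: continuous_plus; [exact: HSI | exact: Hfz].
have Hut t : 0 <= t <= r ->
    plus (plus (Sf t x) (RInt (fun s => Sf s y) 0 t)) (Pconv alpha Sf f0 t) =
    plus (plus (Sr t x) (pK 1 1 (fun s => Sr s y) t)) (Wr f t).
  move=> Ht; rewrite (Pconv_Wr f) // Sr_id //; congr plus; congr plus.
  rewrite (pK_1 _ _ (HSc y)); last lra.
  apply: RInt_ext => s; rewrite Rmin_left ?Rmax_right; try lra.
  by move=> Hs; rewrite Sr_id //; lra.
apply: (solution_of_integral_eq _ f V) => //.
- move=> t Ht; rewrite Hut // (proj2 (proj2 (HWz t Ht))) Sr_Qr //; last lra.
  (* Integrate the resolvent equation at [y] and commute the integration with the kernel of order
     [alpha]. *)
  have -> : pK 1 1 (fun s => Sr s y) t =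
      plus (scal t y) (pK alpha (/ Gamma alpha) (pK 1 1 (fun s => Sr s (A y))) t).
    rewrite -(pK_frac_int alpha Ha _ _ (HSc (A y))).
    rewrite (pK_ext _ _ Rlt_0_1 Rlt_0_1 _ (fun s => plus y (Qr s (A y)))); last first.
      by move=> s Hs; rewrite Sr_Qr //; lra.
    rewrite (pK_plus 1 1 Rlt_0_1); last exact: Qr_cont.
      by rewrite pK_const pG_11 //; lra.
    by move=> s; exact: continuous_const.
  have -> : pK alpha (/ Gamma alpha) V t = plus (plus (Qr t (A x))
      (pK alpha (/ Gamma alpha) (pK 1 1 (fun s => Sr s (A y))) t))
      (pK alpha (/ Gamma alpha) (fun s => plus (f s) (z s)) t).
    have E := pK_plus _ (/ Gamma alpha) a_gt0 _ _ t (HSc (A x)) (HIc (A y)).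
    by rewrite -[X in plus X _]E; exact: (pK_plus _ _ a_gt0 _ _ t HSI Hfz).
  vring.
- move=> t Ht; rewrite Hut //.
  have [HW1 [HW2 _]] := HWz t Ht.
  have Hop s w : D w -> D (Sr s w) /\ A (Sr s w) = Sr s (A w).
    by move=> Hw; apply HS => //; apply clamp_range.
  have E : (fun s => A (Sr s y)) = (fun s => Sr s (A y)).
    by apply: functional_extensionality => s; apply Hop.
  have [HI1 HI2] : D (pK 1 1 (fun s => Sr s y) t) /\
      A (pK 1 1 (fun s => Sr s y) t) = pK 1 1 (fun s => Sr s (A y)) t.
    rewrite -E; apply: (pK_op D A HA) => //; try lra.
      by move=> s; apply Hop.
    by rewrite E.
  have [HS1 HS2] := Hop t x Hx.
  have HD1 := op_dom_plus D A HA _ _ HS1 HI1.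
  split; first exact: (op_dom_plus D A HA).
  rewrite !(op_plus D A HA) // HS2 HI2 HW2 /V; vring.
Qed.

(** * Strong solutions imply bounded semivariation *)

Lemma Pr_plus t y z : Pr t (plus y z) = plus (Pr t y) (Pr t z).
Proof.
rewrite /Pr -pK_plus //; try exact: Sr_cont.
by apply: (pK_ext _ _ a1_gt0 C1_gt0) => s _; exact: Sr_plus.
Qed.

Lemma Pr_scal t (k : R) z : Pr t (scal k z) = scal k (Pr t z).
Proof.
rewrite /Pr -pK_scal //; last exact: Sr_cont.
by apply: (pK_ext _ _ a1_gt0 C1_gt0) => s _; exact: Sr_scal.
Qed.

Lemma ex_RInt_Wr (f : R -> X) t u v : cont f -> ex_RInt (fun s => Pr (t - s) (f s)) u v.
Proof. by move=> Hf; apply: ex_RInt_continuous => s _; exact: Pr_joint. Qed.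

Lemma Wr_plus (f g : R -> X) t : cont f -> cont g ->
  Wr (fun s => plus (f s) (g s)) t = plus (Wr f t) (Wr g t).
Proof.
move=> Hf Hg; rewrite /Wr -RInt_plus; try exact: ex_RInt_Wr.
by apply: RInt_ext => s _; exact: Pr_plus.
Qed.

Lemma Wr_scal (k : R) (f : R -> X) t : cont f ->
  Wr (fun s => scal k (f s)) t = scal k (Wr f t).
Proof.
move=> Hf; rewrite /Wr -RInt_scal; last exact: ex_RInt_Wr.
by apply: RInt_ext => s _; exact: Pr_scal.
Qed.

Lemma Wr_zero t : Wr (fun _ => zero) t = zero.
Proof.
have := Wr_scal 0 (fun _ => zero) t (fun u => continuous_const _ _).
have E (v : X) : scal 0 v = zero by exact: scal_zero_l.
by rewrite !E.
Qed.

Lemma Wr_vsum (u : nat -> R -> X) n t : (forall i, cont (u i)) ->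
  Wr (fun s => vsum (fun i => u i s) n) t = vsum (fun i => Wr (u i) t) n.
Proof.
move=> Hu; elim: n => [|n IH] /=; first exact: Wr_zero.
by rewrite Wr_plus ?IH // => s; apply: continuous_vsum => i; exact: Hu.
Qed.

Lemma Wr_bound : exists K, 0 <= K /\ forall f, cont f ->
  (forall s, norm (f s) <= 1) -> norm (Wr f r) <= K.
Proof.
pose B := pG (alpha - 1) (/ Gamma (alpha - 1)) r * M.
have HB : 0 <= B by have := pG_ge0 _ _ a1_gt0 C1_gt0 r; rewrite /B; nra.
exists ((r - 0) * B); split; first nra.
move=> f Hf Hf1.
apply: (norm_RInt_le_const (fun s => Pr (r - s) (f s)) 0 r) => //; last first.
  by apply: RInt_correct; exact: ex_RInt_Wr.
move=> s Hs; apply: Rle_trans (pK_Sr_bound _ _ _ _ a1_gt0 C1_gt0) _.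
rewrite /B; have := Hf1 s; have := norm_ge_0 (f s) => H0 H1.
apply: Rmult_le_compat; [exact: pG_ge0 | nra | apply: pG_le => //; lra | nra].
Qed.

(** [S(h) v - v = Q(h) A v], and [Q(h) A v] is close to [pG(h) A v] because [S(s) A v] tends to
    [A v]. The quotient thus converges to [A v] and the bound survives. *)
Lemma op_small_time v C : D v ->
  (forall h, 0 < h <= r ->
     norm (scal (/ pG alpha (/ Gamma alpha) h) (minus (Sr h v) v)) <= C) ->
  norm (A v) <= C.
Proof.
move=> Hv HC; apply: Rnot_lt_le => Hlt.
pose e := (norm (A v) - C) / 2.
have He : 0 < e by rewrite /e; lra.
have /continuous_normE Hc := Sr_cont (A v) 0.
have [d [Hd Hd']] := Hc e He.
pose h := Rmin (d / 2) r.
have Hh0 : 0 < h by apply: Rmin_glb_lt; lra.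
have Hh1 : h <= d / 2 := Rmin_l _ _.
have Hh2 : h <= r := Rmin_r _ _.
have HG := pG_gt0 alpha _ a_gt0 Ca_gt0 h Hh0.
set G := pG alpha (/ Gamma alpha) h in HG.
have H1 := HC h (conj Hh0 Hh2).
rewrite Sr_Qr // -/G in H1.
have H2 : norm (minus (Qr h (A v)) (scal G (A v))) <= G * e.
  rewrite /G -pK_const /Qr -pK_minus //.
  - apply: pK_norm_le => //.
      move=> u; apply: continuous_minus; [exact: Sr_cont | exact: continuous_const].
    move=> s Hs; have := Hd' s ltac:(rewrite Rminus_0_r Rabs_pos_eq; lra).
    by rewrite (Sr_npos 0) ?minus_zero_r; lra.
  - exact: Sr_cont.
  - by move=> u; exact: continuous_const.
have H3 : norm (minus (A v) (scal (/ G) (minus (plus v (Qr h (A v))) v))) <= e.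
  have -> : minus (A v) (scal (/ G) (minus (plus v (Qr h (A v))) v)) =
      scal (- / G) (minus (Qr h (A v)) (scal G (A v))) by vring; lra.
  rewrite norm_scal_eq Rabs_Ropp Rabs_pos_eq; last exact/Rlt_le/Rinv_0_lt_compat.
  apply: (Rmult_le_reg_l G) => //; rewrite -Rmult_assoc Rinv_r; lra.
have := norm_le_minus (A v) (scal (/ G) (minus (plus v (Qr h (A v))) v)).
rewrite /e in H3; lra.
Qed.

(** Each quotient is bounded in [f] with a constant depending on [h]. For fixed [f], membership in
    [D(A)] rewrites it as [Q(h) A w / pG(h)], at most [M * norm (A w)] for all [h]. *)
Lemma A_Wr_bounded : (forall f, cont f -> D (Wr f r)) ->
  exists C, forall f, cont f -> (forall s, norm (f s) <= 1) -> norm (A (Wr f r)) <= C.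
Proof.
move=> HD.
pose g h := / pG alpha (/ Gamma alpha) h.
pose J := {h : R | 0 < h <= r}.
pose T (j : J) f := scal (g (proj1_sig j)) (minus (Sr (proj1_sig j) (Wr f r)) (Wr f r)).
have Hg h : 0 < h -> 0 < g h by move=> Hh; apply: Rinv_0_lt_compat; exact: pG_gt0.
have [||||C HC] := uniform_boundedness J T.
- by move=> j f1 f2 H1 H2; rewrite /T Wr_plus // Sr_plus; vring.
- by move=> j k f Hf; rewrite /T Wr_scal // Sr_scal; vring.
- move=> [h Hh]; have [K [HK HK']] := Wr_bound.
  exists (g h * (M * K + K)) => f Hf Hf1; rewrite /T /= norm_scal_eq.
  have Hgh := Hg h (proj1 Hh).
  rewrite Rabs_pos_eq; last lra.
  apply: Rmult_le_compat_l; first lra.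
  apply: Rle_trans (norm_minus_le _ _) _.
  have := HM h (Wr f r); have := HK' f Hf Hf1; nra.
- move=> f Hf; exists (M * norm (A (Wr f r))) => -[h Hh]; rewrite /T /=.
  rewrite Sr_Qr //; try exact: HD; last lra.
  have -> : minus (plus (Wr f r) (Qr h (A (Wr f r)))) (Wr f r) = Qr h (A (Wr f r)) by vring.
  have Hgh := Hg h (proj1 Hh).
  rewrite norm_scal_eq Rabs_pos_eq; last lra.
  have HG := pG_gt0 alpha _ a_gt0 Ca_gt0 h (proj1 Hh).
  apply: (Rmult_le_reg_l (pG alpha (/ Gamma alpha) h)) => //.
  rewrite -Rmult_assoc /g Rinv_r ?Rmult_1_l; last lra.
  exact: pK_Sr_bound.
exists C => f Hf Hf1; apply: op_small_time; first exact: HD.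
by move=> h Hh; exact: (HC (exist _ h Hh) f Hf Hf1).
Qed.

(** The second primitive of [P_alpha]; [Zr] below is its image under [A], the primitive of
    [S - I]. *)
Definition Yr (x : X) (c : R) : X := pK 1 1 (fun s => Qr s x) c.
Definition Zr (x : X) (c : R) : X := pK 1 1 (fun s => minus (Sr s x) x) c.

Lemma Yr_op x c : c <= r -> D (Yr x c) /\ A (Yr x c) = Zr x c.
Proof.
move=> Hc.
have Hcl s : 0 <= s <= c -> clamp r s = s by move=> Hs; rewrite clamp_id //; lra.
(* [pK_op] asks for domain membership at every time, while [Qr_dom] grants it up to [r]; hence the
   clamped integrand. *)
have Hdom s := Qr_dom x (clamp r s) (proj2 (clamp_range r s r_ge0)).
have Hcont : cont (fun s => Qr (clamp r s) x).
  apply: (cont_clamp r (fun s => Qr s x) r_ge0).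
  by apply: (cont_on_ext r (fun s => Qr s x)) => //; exact: Qr_cont.
have E : (fun s => A (Qr (clamp r s) x)) = (fun s => minus (Sr (clamp r s) x) x).
  by apply: functional_extensionality => s; apply Hdom.
have [|H1 H2] := pK_op D A HA 1 1 (fun s => Qr (clamp r s) x) c Rlt_0_1 Rlt_0_1 Hcont
  (fun s => proj1 (Hdom s)).
  rewrite E => s; apply: continuous_minus; last exact: continuous_const.
  apply: (cont_clamp r (fun s => Sr s x) r_ge0).
  by apply: (cont_on_ext r (fun s => Sr s x)) => //; exact: Sr_cont.
have EY : Yr x c = pK 1 1 (fun s => Qr (clamp r s) x) c.
  by apply: (pK_ext _ _ Rlt_0_1 Rlt_0_1) => s Hs; rewrite Hcl.
rewrite EY H2 E; split => //.
by apply: (pK_ext _ _ Rlt_0_1 Rlt_0_1) => s Hs; rewrite Hcl.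
Qed.

Lemma is_derive_Zr x c : is_derive (Zr x) c (minus (Sr c x) x).
Proof.
apply: (is_derive_pK_1 (fun s => minus (Sr s x) x)).
  by move=> s; apply: continuous_minus; [exact: Sr_cont | exact: continuous_const].
by move=> s Hs; rewrite Sr_npos // minus_eq_zero.
Qed.

Lemma is_derive_Yr x c : is_derive (Yr x) c (Qr c x).
Proof.
apply: (is_derive_pK_1 (fun s => Qr s x)); first exact: Qr_cont.
by move=> s Hs; exact: Qr_npos.
Qed.

Lemma cont_ramp c (x : X) : cont (fun s => scal (pG 1 1 (c - (r - s))) x).
Proof.
move=> s; apply: continuous_scal_l.
apply: (continuous_comp (fun s => c - (r - s)) (pG 1 1)).
  by apply: (@ex_derive_continuous R_AbsRing R_NormedModule); auto_derive.
exact: (continuous_pG 1 1 Rlt_0_1).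
Qed.

(* Integration by parts: [pG 1 1] is the positive part, so the convolution of
   a ramp with [P] is the second primitive of [P]. *)
Lemma Wr_ramp c x : c <= r -> Wr (fun s => scal (pG 1 1 (c - (r - s))) x) r = Yr x c.
Proof.
move=> Hc; rewrite /Wr.
have Hz s : s <= r - c -> Pr (r - s) (scal (pG 1 1 (c - (r - s))) x) = zero.
  move=> Hs; rewrite Pr_scal pG_npos; last lra.
  exact: scal_zero_l.
have Hex u v := ex_RInt_Wr (fun s => scal (pG 1 1 (c - (r - s))) x) r u v (cont_ramp c x).
have H0 u v : u <= v -> v <= r - c ->
    RInt (fun s => Pr (r - s) (scal (pG 1 1 (c - (r - s))) x)) u v = zero.
  move=> Huv Hv; rewrite (RInt_ext _ (fun _ => zero)).
    by rewrite RInt_const scal_zero_r.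
  move=> s; rewrite Rmax_right // => Hs; apply: Hz; lra.
(* Nonpositive [c] does occur, through [c - e]; the ramp is then zero on all of [[0,r]]. *)
case: (Rle_dec c 0) => Hc0.
  by rewrite H0 ?/Yr ?pK_npos //; lra.
rewrite -(RInt_Chasles _ 0 (r - c) r) // H0; try lra.
rewrite plus_zero_l.
pose a := r - c.
(* In the derivative the two terms in [Qr] cancel, leaving [(s - a) * Pr (r - s) x]. *)
pose F s := opp (plus (scal (s - a) (Qr (r - s) x)) (Yr x (r - s))).
have -> : Yr x c = minus (F r) (F a).
  rewrite /F Qr_npos; last lra.
  have -> : r - a = c by rewrite /a; ring.
  have -> : Yr x (r - r) = zero by apply: pK_npos; lra.
  vring.
apply: is_RInt_unique.
apply: (is_RInt_ext (fun s => scal (s - a) (Pr (r - s) x))).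
  move=> s; rewrite /a Rmin_left ?Rmax_right; try lra.
  move=> Hs; rewrite Pr_scal pG_11; last lra.
  by have -> : c - (r - s) = s - (r - c) by ring.
apply: (is_RInt_derive F) => s _; last first.
  apply: continuous_scal.
    by apply: (@ex_derive_continuous R_AbsRing R_NormedModule); auto_derive.
  by apply: (cont_comp_minus (fun s => Pr s x)); exact: Pr_cont.
have Hsub : is_derive (fun s => r - s) s (-1) by auto_derive => //; ring.
have HQ : is_derive (fun s => Qr (r - s) x) s (scal (-1) (Pr (r - s) x)).
  by apply: (is_derive_comp (fun s => Qr s x)) => //; exact: is_derive_Qr.
have HY : is_derive (fun s => Yr x (r - s)) s (scal (-1) (Qr (r - s) x)).
  by apply: (is_derive_comp (Yr x)) => //; exact: is_derive_Yr.
have HsQ : is_derive (fun s => scal (s - a) (Qr (r - s) x)) s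
    (plus (scal 1 (Qr (r - s) x)) (scal (s - a) (scal (-1) (Pr (r - s) x)))).
  have Hid : is_derive (fun s => s - a) s 1 by auto_derive => //; ring.
  have H := filterdiff_scal_fct s (fun s => s - a) (fun s => Qr (r - s) x) _ _ Rmult_comm Hid HQ.
  apply: (filterdiff_ext_lin _ _ _ H) => y.
  have E (k : R) (p q : X) : plus (scal (k * 1) p) (scal (s - a) (scal k (scal (-1) q))) =
      scal k (plus (scal 1 p) (scal (s - a) (scal (-1) q))) by vring.
  exact: E.
have -> : scal (s - a) (Pr (r - s) x) = opp (plus (plus (scal 1 (Qr (r - s) x))
    (scal (s - a) (scal (-1) (Pr (r - s) x)))) (scal (-1) (Qr (r - s) x))) by vring.
by apply: is_derive_opp; apply: is_derive_plus.
Qed.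

(** A continuous step: 1 for [tau <= c - e], 0 for [tau >= c], linear between. *)
Definition ramp (e c tau : R) : R := (pG 1 1 (c - tau) - pG 1 1 (c - e - tau)) / e.

Lemma ramp_range e c tau : 0 < e -> 0 <= ramp e c tau <= 1.
Proof.
move=> He; rewrite /ramp.
have H : 0 <= pG 1 1 (c - tau) - pG 1 1 (c - e - tau) <= e.
  have [H1|H1] : 0 <= c - tau \/ c - tau <= 0 by lra.
    have [H2|H2] : 0 <= c - e - tau \/ c - e - tau <= 0 by lra.
      by rewrite !pG_11 //; lra.
    by rewrite pG_11 // (pG_npos _ _ _ H2); lra.
  by rewrite !pG_npos; lra.
split; first by apply: Rdiv_le_0_compat; lra.
by apply/Rle_div_l; lra.
Qed.

Lemma ramp_le e c c' tau : 0 < e -> c <= c' -> ramp e c tau <= ramp e c' tau.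
Proof.
move=> He Hc; rewrite /ramp /Rdiv.
apply: Rmult_le_compat_r; first exact/Rlt_le/Rinv_0_lt_compat.
have HG s : (0 <= s /\ pG 1 1 s = s) \/ (s <= 0 /\ pG 1 1 s = 0).
  have [H|H] : 0 <= s \/ s <= 0 by lra.
    by left; rewrite pG_11.
  by right; rewrite pG_npos.
have := HG (c - tau); have := HG (c - e - tau).
have := HG (c' - tau); have := HG (c' - e - tau).
by move=> [[? ->]|[? ->]] [[? ->]|[? ->]] [[? ->]|[? ->]] [[? ->]|[? ->]]; lra.
Qed.

(** Under [A] the quotient becomes the mean of [S - I] over [[c - e, c]], with [S] frozen at [I] for
    negative times. *)
Lemma Wr_ramp_quotient e c x : 0 < e -> c <= r ->
  cont (fun s => scal (ramp e c (r - s)) x) /\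
  Wr (fun s => scal (ramp e c (r - s)) x) r = scal (/ e) (minus (Yr x c) (Yr x (c - e))).
Proof.
move=> He Hc.
have E : (fun s => scal (ramp e c (r - s)) x) =
    (fun s => scal (/ e) (plus (scal (pG 1 1 (c - (r - s))) x)
      (scal (-1) (scal (pG 1 1 (c - e - (r - s))) x)))).
  by apply: functional_extensionality => s; rewrite /ramp; vring; lra.
have H1 := cont_ramp c x; have H2 := cont_ramp (c - e) x.
have H3 : cont (fun s => scal (-1) (scal (pG 1 1 (c - e - (r - s))) x)).
  by move=> s; apply: continuous_scal_r; exact: H2.
have H4 : cont (fun s => plus (scal (pG 1 1 (c - (r - s))) x)
      (scal (-1) (scal (pG 1 1 (c - e - (r - s))) x))).
  by move=> s; apply: continuous_plus; [exact: H1 | exact: H3].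
rewrite E; split; first by move=> s; apply: continuous_scal_r; exact: H4.
by rewrite Wr_scal // Wr_plus // Wr_scal // !Wr_ramp; [vring | lra | lra].
Qed.

Lemma solution_semivariation : (forall f, cont f -> D (Wr f r)) ->
  exists N, semivariation_bound N.
Proof.
move=> HD; have [C HC] := A_Wr_bounded HD.
exists C => n d xs Hd0 Hdn Hd Hxs.
have Hm := subdivision_mono n d Hd.
have Hdr i : (i <= n)%nat -> d i <= r by move=> Hi; rewrite -Hdn; apply: Hm.
(* The difference quotient of [Zr], completed at [e = 0] by its derivative so that it is continuous
   there. The summand [- x] drops out when values at two points are subtracted. *)
pose q x c e := if Req_EM_T e 0 then minus (Sr c x) x
  else scal (/ e) (minus (Zr x c) (Zr x (c - e))).
have Hq x c : continuous (q x c) 0.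
  apply/continuous_normE => eps Heps.
  have [dl [Hdl Hdl']] := is_derive_expand _ _ _ (is_derive_Zr x c) (eps / 2) ltac:(lra).
  exists dl; split => // h; rewrite Rminus_0_r => Hh.
  rewrite /q; case: (Req_EM_T 0 0) => // _; case: Req_EM_T => Hh0.
    by rewrite minus_eq_zero norm_zero; lra.
  have := Hdl' (- h); rewrite Rabs_Ropp => H; have {}H := H Hh.
  have -> : minus (scal (/ h) (minus (Zr x c) (Zr x (c - h)))) (minus (Sr c x) x) =
      scal (- / h) (minus (minus (Zr x (c + - h)) (Zr x c)) (scal (- h) (minus (Sr c x) x))).
    by rewrite /Rminus; vring.
  have Hp := Rabs_pos_lt h Hh0.
  rewrite norm_scal_eq Rabs_Ropp Rabs_inv.
  apply: Rle_lt_trans (_ : / Rabs h * (eps / 2 * Rabs h) < eps).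
    by apply: Rmult_le_compat_l H; exact/Rlt_le/Rinv_0_lt_compat.
  have -> : / Rabs h * (eps / 2 * Rabs h) = eps / 2 by field; lra.
  lra.
pose F e := vsum (fun i => minus (q (xs (S i)) (d (S i)) e) (q (xs (S i)) (d i) e)) n.
have -> : sum_n_m (fun i => minus (Sr (d i) (xs i)) (Sr (d (i - 1)%nat) (xs i))) 1 n = F 0.
  rewrite vsum_sum_n_m; apply: vsum_ext => i Hi; rewrite /q.
  case: (Req_EM_T 0 0) => // _.
  have -> : (S i - 1 = i)%nat by lia.
  vring.
apply: norm_le_limit.
  apply: (continuous_vsum (fun i e =>
    minus (q (xs (S i)) (d (S i)) e) (q (xs (S i)) (d i) e))) => i.
  by apply: continuous_minus; exact: Hq.
move=> e [He _].
(* A smoothed indicator of the i-th interval of the subdivision. *)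
pose rho i tau := ramp e (d (S i)) tau - ramp e (d i) tau.
pose u i s := scal (rho i (r - s)) (xs (S i)).
have Hu i : (i < n)%nat -> cont (u i) /\ Wr (u i) r =
    minus (scal (/ e) (minus (Yr (xs (S i)) (d (S i))) (Yr (xs (S i)) (d (S i) - e))))
      (scal (/ e) (minus (Yr (xs (S i)) (d i)) (Yr (xs (S i)) (d i - e)))).
  move=> Hi.
  have [H1 H2] := Wr_ramp_quotient e (d (S i)) (xs (S i)) He (Hdr (S i) ltac:(lia)).
  have [H3 H4] := Wr_ramp_quotient e (d i) (xs (S i)) He (Hdr i ltac:(lia)).
  have E : u i = (fun s => plus (scal (ramp e (d (S i)) (r - s)) (xs (S i)))
      (scal (-1) (scal (ramp e (d i) (r - s)) (xs (S i))))).
    by apply: functional_extensionality => s; rewrite /u /rho; vring.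
  have H5 : cont (fun s => scal (-1) (scal (ramp e (d i) (r - s)) (xs (S i)))).
    by move=> s; apply: continuous_scal_r; exact: H3.
  rewrite E; split; first by move=> s; apply: continuous_plus; [exact: H1 | exact: H5].
  by rewrite Wr_plus // Wr_scal // H2 H4; vring.
(* Only indices below [n] have both points known to be at most [r], while [Wr_vsum] wants continuity
   for every index. *)
pose v i := if Nat.ltb i n then u i else fun _ => zero.
have Hv i : cont (v i).
  rewrite /v; case: Nat.ltb_spec => Hi; first by apply Hu.
  by move=> s; exact: continuous_const.
have Hvu i : (i < n)%nat -> v i = u i.
  by move=> Hi; rewrite /v (proj2 (Nat.ltb_lt i n) Hi).
pose f s := vsum (fun i => v i s) n.
have Hf : cont f by move=> s; apply: continuous_vsum => i; exact: Hv.
(* The weights are nonnegative by monotonicity of [ramp] in [c], and they telescope to a difference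
   of two values in [[0,1]]. *)
have Hf1 s : norm (f s) <= 1.
  have H1 := proj2 (ramp_range e (d n) (r - s) He).
  have H2 := proj1 (ramp_range e (d O) (r - s) He).
  apply: Rle_trans (_ : ramp e (d n) (r - s) - ramp e (d O) (r - s) <= 1); last lra.
  apply: (norm_vsum_le _ (fun i => ramp e (d i) (r - s))) => i Hi.
  rewrite Hvu // /u norm_scal_eq.
  have Hle : ramp e (d i) (r - s) <= ramp e (d (S i)) (r - s).
    by apply: ramp_le => //; have := Hd i Hi; lra.
  rewrite /rho Rabs_pos_eq; last lra.
  have := Hxs (S i); nra.
have -> : F e = A (Wr f r); last exact: HC.
have Hquot x c : c <= r -> D (scal (/ e) (minus (Yr x c) (Yr x (c - e)))) /\
    A (scal (/ e) (minus (Yr x c) (Yr x (c - e)))) = q x c e.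
  move=> Hc; have [H1 H2] := Yr_op x c Hc.
  have [H3 H4] := Yr_op x (c - e) ltac:(lra).
  have [H5 H6] := op_minus D A HA _ _ H1 H3.
  split; first exact: (op_dom_scal D A HA).
  rewrite (op_scal D A HA) // H6 H2 H4 /q; case: Req_EM_T => //; lra.
have Hterm i : (i < n)%nat -> D (Wr (v i) r) /\
    A (Wr (v i) r) = minus (q (xs (S i)) (d (S i)) e) (q (xs (S i)) (d i) e).
  move=> Hi; rewrite Hvu // (proj2 (Hu i Hi)).
  have [H1 <-] := Hquot (xs (S i)) (d (S i)) (Hdr (S i) ltac:(lia)).
  have [H2 <-] := Hquot (xs (S i)) (d i) (Hdr i ltac:(lia)).
  exact: (op_minus D A HA).
rewrite /f Wr_vsum //.
have [_ ->] := op_vsum D A HA (fun i => Wr (v i) r) n (fun i Hi => proj1 (Hterm i Hi)).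
by apply: vsum_ext => i Hi; rewrite (proj2 (Hterm i Hi)).
Qed.

End Bounds.
End Resolvent.

Theorem theorem3p5 (X : CompleteNormedModule R_AbsRing) (alpha : R)
  (D : X -> Prop) (A : X -> X) (S : R -> X -> X) (r : R) :
  1 < alpha < 2 ->
  closed_dense_op D A ->
  resolvent_family D A alpha S ->
  0 < r ->
  ((forall (x y : X) (f : R -> X), D x -> D y -> cont_on 0 r f ->
      strong_solution D A alpha r f x y
        (fun t => plus (plus (S t x) (RInt (fun s => S s y) 0 t))
                       (Pconv alpha S f t)))
   <-> bounded_semivariation 0 r S).
Proof.
move=> Ha HA HS Hr.
have [M [HM0 HM]] := Sr_bound D A alpha r S HS Hr.
rewrite bounded_semivariationE; split; last first.
  move=> [N HN] x y f Hx Hy Hf.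
  exact: (semivariation_solution D A alpha r S Ha HA HS Hr M HM0 HM N).
move=> Hsol; apply: (solution_semivariation D A alpha r S Ha HA HS Hr M HM0 HM) => f Hf.
have H0 := op_dom_zero D A HA.
have Hfr : cont_on 0 r f by exact: (cont_on_ext r f).
(* Zero initial data leave [u = P_alpha * f], and its membership in [D(A)] at time [r] is
   extracted. *)
have [HD _] := Hsol zero zero f H0 H0 Hfr.
have {HD} := HD r (conj (Rlt_le _ _ Hr) (Rle_refl r)).
have HSz s : 0 <= s <= r -> S s zero = zero.
  by move=> Hs; rewrite -(Sr_id r S s) //; exact: (Sr_zero D A alpha r S HS Hr).
rewrite HSz; last lra.
rewrite (RInt_ext _ (fun _ => zero)); last first.
  by move=> s; rewrite Rmin_left ?Rmax_right; try lra; move=> Hs; rewrite HSz //; lra.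
rewrite RInt_const scal_zero_r !plus_zero_l.
by rewrite (Pconv_Wr D A alpha r S Ha HS Hr M HM0 HM f f r) //; lra.
Qed.
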